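(* Let $\lambda>0$ and $N\sim\mathrm{Po}(\lambda)$ (Poisson with mean $\lambda$). Let $X_1,X_2,\ldots$ be exchangeable non-negative random variables, independent of $N$, with $\mathbb{E}[X_1]>0$ and $\mathbb{E}[X_1^3]<\infty$, which satisfy the equally correlated model with parameter $\rho\in[0,1]$ (see context). Let $Y=X_1+\cdots+X_N$. Let $Z\sim\Gamma(r,s)$, where $$r=\frac{\lambda\,\mathbb{E}[X_1]^2}{\mathbb{E}[X_1^2]+\lambda\rho\,\mathrm{Var}(X_1)},\qquad s=\frac{\mathbb{E}[X_1]}{\mathbb{E}[X_1^2]+\lambda\rho\,\mathrm{Var}(X_1)},$$ and let $$\sigma=\frac{\rho\left(\mathbb{E}[X_1^2]+\lambda\,\mathrm{Var}(X_1)\right)}{\mathbb{E}[X_1^2]+\lambda\rho\,\mathrm{Var}(X_1)},\qquad c_r=\frac{\sqrt{2\pi}+e^{-1}}{\sqrt{r+2}}+\frac{2}{r+2},$$ $$\beta=\frac{(\lambda^2+3\lambda+1)\mathbb{E}[X_1^3]-\lambda(\lambda+1)\mathbb{E}[X_1]\mathbb{E}[X_1^2]}{2\left(\mathbb{E}[X_1^2]+\lambda\,\mathrm{Var}(X_1)\right)}.$$ Then $$d_{SL}(Y,Z)\leq2\sqrt{\lambda c_r\mathbb{E}[X_1]\left\{\frac{\lambda\rho\,\mathbb{E}[X_1^2]}{\mathbb{E}[X_1]}+\sigma\left(\frac{\mathbb{E}[X_1^2]}{\mathbb{E}[X_1]}+\beta\right)+(\sigma-\rho)\lambda\,\mathbb{E}[X_1]+(1-\sigma)\,\mathbb{E}|X_1^s-X_1^{gz}|\right\}}$$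 for any coupling of $X_1^s$ and $X_1^{gz}$, the size-biased and generalized-zero-biased versions of $X_1$.
   Context: Equally correlated model with parameter $\rho\in[0,1]$: for all $n\in\{1,2,\ldots\}$ and all real $t_1,\ldots,t_n$, $$\mathbb{E}[e^{i(t_1X_1+\cdots+t_nX_n)}]=\rho\,\mathbb{E}[e^{iX_1(t_1+\cdots+t_n)}]+(1-\rho)\prod_{j=1}^n\mathbb{E}[e^{it_jX_j}].$$ Stop-loss distance: $d_{SL}(U,V)=\sup_{a\in\mathbb{R}}|\mathbb{E}(U-a)_+-\mathbb{E}(V-a)_+|$, where $x_+=\max\{0,x\}$. Size-biased version: for a non-negative random variable $X$ with $\mathbb{E}[X]>0$, $X^s$ is a random variable whose law is determined by $\mathbb{E}g(X^s)=\mathbb{E}[Xg(X)]/\mathbb{E}[X]$ for all $g:\mathbb{R}^+\to\mathbb{R}$ for which this expectation exists. Generalized-zero-biased version: for a real-valued random variable $X$ with $\mathbb{E}[X^2]>0$ (finite), $X^{gz}$ is a random variable whose law is determined by $\mathbb{E}[g'(X^{gz})]=\mathbb{E}[X(g(X)-g(0))]/\mathbb{E}[X^2]$ for all Lipschitz $g:\mathbb{R}\to\mathbb{R}$ for which this expectation exists. $\Gamma(r,s)$ is the gamma distribution with density $\frac{s^r}{\Gamma(r)}x^{r-1}e^{-sx}$ for $x>0$. A coupling of two random variables is a construction of them on a common probability space with their given marginal laws. $\mathbb{E}[X_1]^2$ means $(\mathbb{E}[X_1])^2$. An empty sum is $0$. *)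

(* Defs.v *)
From HB Require Import structures.
From mathcomp Require Import all_boot all_order all_algebra all_fingroup.
From mathcomp Require Import all_classical all_reals all_analysis.
From mathcomp Require Import complex.
Import Order.TTheory GRing.Theory Num.Theory.
Import numFieldNormedType.Exports.

Set Implicit Arguments.
Unset Strict Implicit.
Unset Printing Implicit Defensive.

Local Open Scope classical_set_scope.
Local Open Scope ring_scope.

Section Laws.
Context {R : realType} {d : measure_display} {T : measurableType d}.
Variable P : probability T R.

(* The expectation as a real number; only meaningful when it is finite. *)
Definition mean (U : T -> R) : R := fine ('E_P[U])%E.

Definition var (U : T -> R) : R := fine ('V_P[U])%E.

(* E[e^{iU}], whose real and imaginary parts are E[cos U] and E[sin U]. *)
Definition mean_expi (U : T -> R) : complex R :=
  Complex (mean (cos \o U)) (mean (sin \o U)).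

(* Finite permutations of an infinite sequence preserve all the
   finite-dimensional laws; X_1, X_2, ... are numbered from 0. *)
Definition exchangeable (X : nat -> T -> R) : Prop :=
  forall (n : nat) (p : 'S_n) (A : set (n.-tuple R)), measurable A ->
    P [set w | A [tuple X i w | i < n]] =
    P [set w | A [tuple X (p i) w | i < n]].

Definition equally_correlated (rho : R) (X : nat -> T -> R) : Prop :=
  forall (n : nat) (t : 'I_n -> R), (0 < n)%N ->
    mean_expi (fun w => \sum_(j < n) t j * X j w) =
      (rho%:C)%C * mean_expi (fun w => X 0%N w * \sum_(j < n) t j) +
      ((1 - rho)%:C)%C * \prod_(j < n) mean_expi (fun w => t j * X j w).

(* N is independent of the sigma-algebra generated by the whole sequence X. *)
Definition independent_of_seq (N : T -> nat) (X : nat -> T -> R) : Prop :=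
  forall (B : set nat) (E : set T), measurable B ->
    <<s \bigcup_i preimage_set_system [set: T] (X i) measurable >> E ->
    P (N @^-1` B `&` E) = (P (N @^-1` B) * P E)%E.

Definition poisson_law (lambda : R) (N : T -> nat) : Prop :=
  forall k : nat, P (N @^-1` [set k]) = (poisson_pmf lambda k)%:E.

Definition Gamma (r : R) : R :=
  \int[lebesgue_measure]_(x in `]0, +oo[) (x `^ (r - 1) * expR (- x)).

Definition gamma_pdf (r s x : R) : R :=
  if 0 < x then s `^ r / Gamma r * x `^ (r - 1) * expR (- (s * x)) else 0.

Definition gamma_law (r s : R) (Z : T -> R) : Prop :=
  forall A : set R, measurable A ->
    P (Z @^-1` A) = (\int[lebesgue_measure]_(x in A) (gamma_pdf r s x)%:E)%E.

End Laws.

Section TwoSpaces.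
Context {R : realType} {d d' : measure_display}.
Context {T : measurableType d} {T' : measurableType d'}.
Variables (P : probability T R) (Q : probability T' R).

(* The two variables may live on different probability spaces: only their laws
   matter. *)
Definition stop_loss_dist (U : T -> R) (V : T' -> R) : \bar R :=
  ereal_sup [set (`| 'E_P[fun w => Num.max 0%R (U w - a)%R] -
                     'E_Q[fun w => Num.max 0%R (V w - a)%R] |)%E | a in [set: R]].

(* Xs has the size-biased law of X. Test functions on the half-line are taken
   here as functions on R; since X >= 0, only their restrictions to the
   half-line matter, and g := \1_(x < 0) forces Xs >= 0 almost surely. *)
Definition size_biased (X : T -> R) (Xs : T' -> R) : Prop :=
  forall g : R -> R, measurable_fun [set: R] g ->
    P.-integrable [set: T] (EFin \o (fun w => X w * g (X w))) ->
    ('E_Q[g \o Xs])%E = (mean P (fun w => X w * g (X w)) / mean P X)%:E.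

(* Xgz has the generalized-zero-biased law of X. A Lipschitz g is only
   differentiable almost everywhere, and derive1 g takes a default value
   elsewhere; this is harmless because the law defined here has a density with
   respect to the Lebesgue measure. *)
Definition gen_zero_biased (X : T -> R) (Xgz : T' -> R) : Prop :=
  forall g : R -> R, lipschitz g ->
    P.-integrable [set: T] (EFin \o (fun w => X w * (g (X w) - g 0))) ->
    ('E_Q[derive1 g \o Xgz])%E =
      (mean P (fun w => X w * (g (X w) - g 0)) /
       mean P (fun w => X w ^+ 2))%:E.

End TwoSpaces.

(* Main.v *)
Require Import Defs.
From HB Require Import structures.
From mathcomp Require Import all_boot all_order all_algebra all_fingroup.
From mathcomp Require Import all_classical all_reals all_analysis.
From mathcomp Require complex.
From mathcomp Require Import measurable_realfun ring lra.
Import Order.TTheory GRing.Theory Num.Theory.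
Import numFieldNormedType.Exports.

Local Open Scope classical_set_scope.
Local Open Scope ring_scope.
Set Implicit Arguments.
Unset Strict Implicit.
Unset Printing Implicit Defensive.

(** The proof is Stein's method for the gamma law, run on the squared excesses
    [pos_sqr b x] = max(0, x - b)^2 / 2 instead of the stop-loss functions
    max(0, x - a), which are recovered at the end by smoothing.

    Structure of Y.  The equally correlated model says that, for t_1 = ... = t_n,
    the characteristic function of X_1 + ... + X_n is the mixture, with weights
    rho and 1 - rho, of those of n X_1 and of a sum of n independent copies of
    X_1.  Since |x| is a positive multiple of the integral over t > 0 of
    (1 - cos (t x)) / t^2, an absolute deviation E|V - a| depends affinely on the
    characteristic function of V ([mean_abs_mixture]), so stop-loss expectations
    split in the same proportions ([integral_stop_loss_partial_sum]).  Averaging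
    over N, E max(0, Y - a) is the mixture of the values for N X_1 and for the
    compound Poisson law M of X_1.

    The Stein equation.  For b > 0 there are f and g, with g the derivative of f,
    and constants c and K such that on the half-line
      pos_sqr b x + (x / s) g x + (r / s) f x = c + x f x,
    where c is the expectation of [pos_sqr b] under the gamma law, f is convex,
    g is nondecreasing, K-Lipschitz and between 0 and 1/2, and
    K <= (s / 2) sqrt (2 / (r + 2)) ([gamma_stein_solution]).  The solution is
    explicit: on each side of b, up to an affine function, it is the expectation
    over that side of an exponential of the gamma variable with parameter x.
    Integration by parts against the gamma density gives a three-term recursion
    between these expectations and their derivatives in x, from which the equation,
    the matching at b and, with the Cauchy-Schwarz inequality, the bound on K all
    follow.

    The comparison.  The equation is integrated against M and against the law of
    N X_1.  The Poisson identity E[N a(N)] = lambda E[a(N + 1)] turns the term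
    x f x into lambda times an average of E[X_1 f(y + X_1)], respectively of
    E[X_1 f((N + 1) X_1)].  For M this is expressed through the size-biased and
    the generalized-zero-biased versions of X_1 ([weighted_smear_size_biased],
    [weighted_smear_gen_zero_biased]), whose distance in the coupling appears
    because g is K-Lipschitz.  For N X_1 the two functions f(x) - g(0) x and
    g(0) x + K x^2 / 2 - f(x) are nondecreasing, and an association inequality
    ([association]) confines the error between moments of X_1; this produces
    beta.  [mixture_stein_bound] combines these estimates into
    |E pos_sqr b - c| <= lambda (E[X_1^2] + lambda rho Var X_1) K { ... }.

    Smoothing.  (pos_sqr b - pos_sqr (b + e)) / e differs from max(0, x - b) by at
    most e, so a bound D on the squared excesses gives e + 2 D / e on the stop-loss
    functions; the choice of e that balances the terms yields the square root. *)

(** * The absolute value as a superposition of cosines *)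

Section AbsoluteValueKernel.
Context {R : realType}.
Local Notation mu := (@lebesgue_measure R).

Lemma lebesgue_measure_dilation (k : R) (k0 : 0 < k) (A : set R) :
  measurable A ->
  (k%:E * pushforward mu (fun t : R => (k * t)%R : measurableTypeR R) A = mu A)%E.
Proof.
move=> mA.
have mk : measurable_fun setT (fun t : R => k * t : measurableTypeR R).
  exact: measurable_funM.
pose kn : {nonneg R} := NngNum (ltW k0).
have [nu nuE] : exists nu : {measure set (measurableTypeR R) -> \bar R},
    forall B, nu B = (k%:E * pushforward mu (fun t : R => (k * t)%R : measurableTypeR R) B)%E.
  unshelve eexists (mscale kn (pushforward mu (fun t : R => k * t : measurableTypeR R))).
    exact: mk.
  by [].
rewrite -nuE; apply/esym.
apply: (@lebesgue_measure_unique _ nu) => // X [[a b]] _ <-.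
rewrite nuE /pushforward.
rewrite (_ : _ @^-1` _ = `]a / k, b / k]%classic); last first.
  apply/seteqP; split=> x /=; rewrite !in_itv/= ltr_pdivrMr// ler_pdivlMr// mulrC//.
rewrite !lebesgue_measure_itv/= !lte_fin ltr_pM2r ?invr_gt0//.
case: ifPn => ab; last by rewrite mule0.
rewrite -!EFinD -EFinM; congr EFin; field; exact: lt0r_neq0.
Qed.

Lemma ge0_integral_dilation (k : R) (f : R -> \bar R) : 0 < k ->
  measurable_fun setT f -> (forall x, 0 <= f x)%E ->
  (k%:E * \int[mu]_(t in `]0%R, +oo[) f (k * t)%R = \int[mu]_(t in `]0%R, +oo[) f t)%E.
Proof.
move=> k0 mf f0.
have mk : measurable_fun setT (fun t : measurableTypeR R => k * (t : R) : measurableTypeR R).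
  exact: measurable_funM.
pose kn : {nonneg R} := NngNum (ltW k0).
rewrite -[k]/(kn%:num) -ge0_integral_mscale//=; last first.
  apply: (measurable_funS measurableT) => //.
  exact: (measurableT_comp mf).
have pre : (fun t : measurableTypeR R => k * (t : R) : measurableTypeR R) @^-1` `]0%R, +oo[%classic
    = `]0%R, +oo[%classic.
  by apply/seteqP; split=> x /=; rewrite !in_itv/= !andbT pmulr_rgt0.
have := @ge0_integral_pushforward _ _ _ _ _ _ mk (mscale kn mu) `]0%R, +oo[%classic f.
rewrite pre => <- //; last exact: measurable_funS mf.
apply: eq_measure_integral => A mA _ /=; rewrite /mscale/=.
exact: lebesgue_measure_dilation.
Qed.

Lemma sin_le_id (x : R) : 0 < x -> sin x <= x.
Proof.
move=> x0; have [|c /[!in_itv]/= /andP[c0 cx]] := @MVT R sin cos 0 x x0.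
  by apply: continuous_subspaceT; exact: continuous_sin.
by rewrite sin0 !subr0 => ->; rewrite ler_piMl ?cos_le1// ltW.
Qed.

(** Makes the kernel below bounded near 0. *)
Lemma one_sub_cos_le_sqr (x : R) : 0 < x -> 1 - cos x <= x ^+ 2.
Proof.
move=> x0; have [|c /[!in_itv]/= /andP[c0 cx]] := @MVT R cos (fun y => - sin y) 0 x x0.
  by apply: continuous_subspaceT; exact: continuous_cos.
rewrite cos0 subr0 => h; have := sin_le_id c0; nra.
Qed.

Lemma measurable_invr : measurable_fun setT (fun x : R => x^-1).
Proof.
rewrite (_ : (fun x => _) =
    fun x : R => if 0 < x then x `^ (-1) else - ((- x) `^ (-1))); last first.
  apply/funext => x; case: ltP => x0; first by rewrite powR_inv1// ltW.
  by rewrite powR_inv1 ?oppr_ge0// invrN opprK.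
apply: measurable_fun_ifT => //; first exact: measurable_fun_ltr.
apply: measurableT_comp => //.
exact: (measurableT_comp (measurable_powR (-1))).
Qed.

Definition cos_kernel (t : R) : R := (1 - cos t) / t ^+ 2.

Lemma cos_kernel_ge0 t : 0 <= cos_kernel t.
Proof. by rewrite divr_ge0 ?sqr_ge0// subr_ge0 cos_le1. Qed.

Lemma measurable_cos_kernel : measurable_fun setT cos_kernel.
Proof.
apply: measurable_funM.
  apply: measurable_funB => //; exact: (continuous_measurable_fun (@continuous_cos R)).
rewrite (_ : (fun x => _) = (fun x : R => (x ^-1) ^+ 2)); last first.
  by apply/funext => x; rewrite exprVn.
by apply: measurable_funX; exact: measurable_invr.
Qed.

(** The majorant of the tails, here of the cosine kernel and later of the
    moments of the gamma law. *)
Lemma inv_sqr_integral_lty :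
  (\int[mu]_(t in `[1%R, +oo[) (2 * t ^- 2)%:E < +oo)%E.
Proof.
have cinv (x : R) : 0 < x -> is_derive x 1 (fun t : R => - 2 * t^-1) (2 * x ^- 2).
  move=> x0; have x1 : x != 0 by exact: lt0r_neq0.
  have dV : is_derive x 1 (fun t : R => t^-1) (- x ^- 2 *: 1).
    exact: (@is_deriveV _ id).
  have := is_deriveZ (- 2) dV; rewrite (_ : (- 2) *: _ = 2 * x ^- 2) //.
  by rewrite /GRing.scale/=; ring.
rewrite (@ge0_continuous_FTC2y _ _ (fun t : R => - 2 * t^-1) _ 0)//.
- exact: ltry.
- by move=> x x1; rewrite mulr_ge0// invr_ge0 sqr_ge0.
- apply/continuous_within_itvcyP; split.
    move=> x; rewrite in_itv/= andbT => x1.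
    have x0 : x != 0 by apply: lt0r_neq0; exact: lt_trans x1.
    apply: cvgM; first exact: cvg_cst.
    apply: cvgV; first by rewrite expf_neq0.
    exact: exprn_continuous.
  apply: cvg_at_right_filter.
  apply: cvgM; first exact: cvg_cst.
  apply: cvgV; first by rewrite expf_neq0// oner_eq0.
  exact: exprn_continuous.
- rewrite -[X in _ --> X](mulr0 (-2)); apply: cvgM; first exact: cvg_cst.
  by apply/gtr0_cvgV0; [near=> x; near: x; exact: nbhs_pinfty_gt | exact: cvg_id].
- by move=> x x1; apply: ex_derive; apply: cinv; exact: lt_trans x1.
- apply: cvg_at_right_filter; apply: cvgM; first exact: cvg_cst.
  by apply: cvgV; [exact: oner_neq0|exact: cvg_id].
- move=> x; rewrite in_itv/= andbT => x1; rewrite derive1E.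
  by have := cinv x (lt_trans ltr01 x1) => ?; rewrite derive_val.
Unshelve. all: by end_near. Qed.

(** A positive finite constant, which cancels in [mean_abs_mixture]. *)
Lemma cos_kernel_integral :
  exists2 c : R, 0 < c & (\int[mu]_(t in `]0%R, +oo[) (cos_kernel t)%:E = c%:E)%E.
Proof.
have mk D : measurable D -> measurable_fun D (EFin \o cos_kernel).
  move=> mD; apply/measurable_EFinP; exact: measurable_funS measurable_cos_kernel.
pose I := (\int[mu]_(t in `]0%R, +oo[) (cos_kernel t)%:E)%E.
have Ilt : (I < +oo)%E.
  rewrite /I (@itv_bndbnd_setU _ _ (BRight 0) (BRight 1) +oo%O) ?bnd_simp//=.
  rewrite ge0_integral_setU//=; last 3 first.
  - by apply: mk; exact: measurableU.
  - by move=> x _; rewrite lee_fin cos_kernel_ge0.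
  - rewrite disj_set2E; apply/eqP/seteqP; split=> x //= [].
    by rewrite !in_itv/= andbT => /andP[_ x1]; rewrite ltNge x1.
  apply: lte_add_pinfty.
    apply: (@le_lt_trans _ _ (\int[mu]_(t in `]0%R, 1%R]) (cst 1 t))%E).
      apply: ge0_le_integral => //=.
      - by move=> x _; rewrite lee_fin cos_kernel_ge0.
      - exact: mk.
      - move=> x; rewrite in_itv/= lee_fin => /andP[x0 x1].
        by rewrite ler_pdivrMr ?mul1r ?one_sub_cos_le_sqr// exprn_gt0.
    by rewrite integral_cst//= lebesgue_measure_itv/= lte_fin ltr01 mul1e -EFinB ltry.
  apply: (@le_lt_trans _ _ (\int[mu]_(t in `[1%R, +oo[) (2 * t ^- 2)%:E)%E).
    apply: (@le_trans _ _ (\int[mu]_(t in `[1%R, +oo[) (cos_kernel t)%:E)%E).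
      apply: ge0_subset_integral => //.
      - exact: mk.
      - by move=> x _; rewrite lee_fin cos_kernel_ge0.
      - by apply: subset_itvr; rewrite bnd_simp.
    apply: ge0_le_integral => //=.
    - by move=> x _; rewrite lee_fin cos_kernel_ge0.
    - exact: mk.
    - apply/measurable_EFinP; apply: (measurable_funS measurableT) => //.
      rewrite (_ : (fun x => _) = (fun x : R => 2 * (x ^-1) ^+ 2)); last first.
        by apply/funext => x; rewrite exprVn.
      by apply: measurable_funM => //; apply: measurable_funX; exact: measurable_invr.
    - move=> x; rewrite in_itv/= andbT lee_fin => x1.
      rewrite /cos_kernel ler_wpM2r ?invr_ge0 ?sqr_ge0//.
      have := cos_geN1 x; lra.
  exact: inv_sqr_integral_lty.
have pi2 := @pi_ge2 R.
have cos1 : cos 1 < 1 :> R.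
  by rewrite -[ltRHS]cos0 ltr_cos ?ltr01// in_itv/=; apply/andP; split; lra.
have Igt : (0 < I)%E.
  apply: (@lt_le_trans _ _ (\int[mu]_(t in `[1%R, 2%R]) (cst ((1 - cos 1) / 4)%:E t))%E).
    rewrite integral_cst//= lebesgue_measure_itv/= lte_fin ltr1n.
    rewrite -EFinD -EFinM lte_fin; apply: mulr_gt0; last by lra.
    by rewrite divr_gt0// subr_gt0.
  apply: (@le_trans _ _ (\int[mu]_(t in `[1%R, 2%R]) (cos_kernel t)%:E)%E).
    apply: ge0_le_integral => //=.
    - exact: mk.
    - move=> x; rewrite in_itv/= lee_fin => /andP[x1 x2].
      rewrite /cos_kernel ler_pdivrMr// mulrAC ler_pdivlMr ?exprn_gt0//; last by lra.
      have cx : cos x <= cos 1.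
        have [->//|xn1] := eqVneq x 1.
        rewrite ltW// ltr_cos ?in_itv/=; last 2 first.
        - by apply/andP; split; lra.
        - by apply/andP; split; lra.
        by rewrite lt_neqAle eq_sym xn1 x1.
      have x4 : x ^+ 2 <= 4 by nra.
      have : (1 - cos 1) * x ^+ 2 <= (1 - cos 1) * 4 by rewrite ler_wpM2l// subr_ge0 ltW.
      move=> h; apply: le_trans h _; rewrite ler_wpM2r//; lra.
  apply: ge0_subset_integral => //.
  - exact: mk.
  - by move=> x _; rewrite lee_fin cos_kernel_ge0.
  - by move=> x /=; rewrite !in_itv/= andbT => /andP[x1 _]; exact: lt_le_trans x1.
exists (fine I); first by apply: fine_gt0; rewrite Igt.
by rewrite -/I fineK// ge0_fin_numE// ltW.
Qed.

(** Dilating the variable of integration by [`|x|] multiplies the integral of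
    the kernel by [`|x|]. *)
Lemma abs_cos_integral : exists2 c : R, 0 < c & forall x : R,
  (\int[mu]_(t in `]0%R, +oo[) ((1 - cos (t * x)) / t ^+ 2)%:E = (c * `|x|)%:E)%E.
Proof.
have [c c0 cE] := cos_kernel_integral.
exists c => // x.
have [->|x0] := eqVneq x 0.
  by rewrite normr0 mulr0 integral0_eq// => t _; rewrite mulr0 cos0 subrr mul0r.
have nx0 : 0 < `|x| by rewrite normr_gt0.
rewrite [RHS]EFinM -cE muleC -(@ge0_integral_dilation _ (fun t => (cos_kernel t)%:E) nx0); last 2 first.
- by apply/measurable_EFinP; exact: measurable_cos_kernel.
- by move=> t; rewrite lee_fin cos_kernel_ge0.
rewrite muleA -ge0_integralZl//=; last 2 first.
- apply/measurable_EFinP; apply: (measurable_funS measurableT) => //.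
  apply: (measurableT_comp measurable_cos_kernel); exact: measurable_funM.
- by move=> t _; rewrite lee_fin cos_kernel_ge0.
apply: eq_integral => t; rewrite inE/= in_itv/= andbT => t0.
rewrite /cos_kernel -!EFinM; congr EFin.
have -> : cos (`|x| * t) = cos (t * x).
  by rewrite -[RHS]cos_norm normrM (gtr0_norm t0) mulrC.
field.
by rewrite (lt0r_neq0 t0)/= (lt0r_neq0 nx0).
Qed.

End AbsoluteValueKernel.

(** * Real-valued expectations *)

Section MeanFacts.
Context {R : realType} {d : measure_display} {T : measurableType d}.
Variable P : probability T R.

Lemma expectationE (f : T -> R) : ('E_P[f] = \int[P]_w (f w)%:E)%E.
Proof. by rewrite unlock. Qed.

Lemma integral_prob_cst (c : \bar R) : (\int[P]_w c = c)%E.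
Proof. by have /= -> := integral_cst P (@measurableT _ T) c; rewrite probability_setT mule1. Qed.

Lemma mean_Rintegral (f : T -> R) : mean P f = \int[P]_w f w.
Proof. by rewrite /mean expectationE. Qed.

Lemma integral_mean (f : T -> R) : P.-integrable setT (EFin \o f) ->
  (\int[P]_w (f w)%:E = (mean P f)%:E)%E.
Proof. by move=> fi; rewrite /mean expectationE fineK//; exact: integrable_fin_num. Qed.

Lemma integrable_dominated (f g : T -> R) : measurable_fun setT f ->
  (forall w, `|f w| <= g w) -> P.-integrable setT (EFin \o g) ->
  P.-integrable setT (EFin \o f).
Proof.
move=> mf fg; apply: le_integrable => //; first exact/measurable_EFinP.
by move=> w _ /=; rewrite lee_fin (le_trans (fg w))// ler_norm.
Qed.

Lemma integrable_bounded (f : T -> R) (M : R) : measurable_fun setT f ->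
  (forall w, `|f w| <= M) -> P.-integrable setT (EFin \o f).
Proof.
move=> mf fM; apply: (integrable_dominated mf fM).
exact: finite_measure_integrable_cst.
Qed.

Lemma mean_cst (c : R) : mean P (fun=> c) = c.
Proof.
by rewrite mean_Rintegral Rintegral_cst//= probability_setT mulr1.
Qed.

Lemma meanD (f g : T -> R) : P.-integrable setT (EFin \o f) ->
  P.-integrable setT (EFin \o g) -> mean P (fun w => f w + g w) = mean P f + mean P g.
Proof. by move=> fi gi; rewrite !mean_Rintegral RintegralD. Qed.

Lemma meanB (f g : T -> R) : P.-integrable setT (EFin \o f) ->
  P.-integrable setT (EFin \o g) -> mean P (fun w => f w - g w) = mean P f - mean P g.
Proof. by move=> fi gi; rewrite !mean_Rintegral RintegralB. Qed.

Lemma meanZl (c : R) (f : T -> R) : P.-integrable setT (EFin \o f) ->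
  mean P (fun w => c * f w) = c * mean P f.
Proof. by move=> fi; rewrite !mean_Rintegral RintegralZl. Qed.

Lemma integrableD_real (f g : T -> R) : P.-integrable setT (EFin \o f) ->
  P.-integrable setT (EFin \o g) -> P.-integrable setT (EFin \o (fun w => f w + g w)).
Proof. by move=> fi gi; have := integrableD measurableT fi gi. Qed.

Lemma integrableB_real (f g : T -> R) : P.-integrable setT (EFin \o f) ->
  P.-integrable setT (EFin \o g) -> P.-integrable setT (EFin \o (fun w => f w - g w)).
Proof. by move=> fi gi; have := integrableB measurableT fi gi. Qed.

Lemma integrableZl_real (c : R) (f : T -> R) : P.-integrable setT (EFin \o f) ->
  P.-integrable setT (EFin \o (fun w => c * f w)).
Proof. by move=> fi; have := integrableZl measurableT c fi. Qed.

Lemma le_mean (f g : T -> R) : P.-integrable setT (EFin \o f) ->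
  P.-integrable setT (EFin \o g) -> (forall w, f w <= g w) -> mean P f <= mean P g.
Proof.
by move=> fi gi fg; rewrite !mean_Rintegral; apply: le_Rintegral.
Qed.

Lemma mean_ge0 (f : T -> R) : (forall w, 0 <= f w) -> 0 <= mean P f.
Proof. by move=> f0; rewrite mean_Rintegral Rintegral_ge0. Qed.

End MeanFacts.

(** * Mean absolute deviations and characteristic functions *)

Section MeanAbsoluteDeviation.
Context {R : realType} {d : measure_display} {T : measurableType d}.
Variable P : probability T R.
Variable V : T -> R.
Hypothesis mV : measurable_fun setT V.
Local Notation mu := (@lebesgue_measure R).

Lemma measurable_cosM (t : R) : measurable_fun setT (fun w => cos (t * V w)).
Proof.
apply: (measurableT_comp (continuous_measurable_fun (@continuous_cos R))).
exact: measurable_funM.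
Qed.

Lemma measurable_sinM (t : R) : measurable_fun setT (fun w => sin (t * V w)).
Proof.
apply: (measurableT_comp (continuous_measurable_fun (@continuous_sin R))).
exact: measurable_funM.
Qed.

Lemma integrable_cosM (t : R) : P.-integrable setT (EFin \o (fun w => cos (t * V w))).
Proof.
by apply: (integrable_bounded P (measurable_cosM t)) => w; exact: cos_max.
Qed.

Lemma integrable_sinM (t : R) : P.-integrable setT (EFin \o (fun w => sin (t * V w))).
Proof.
by apply: (integrable_bounded P (measurable_sinM t)) => w; exact: sin_max.
Qed.

(** The expectation of (1 - cos (t (V - a))) / t^2, expanded so that V enters
    only through the real and imaginary parts of its characteristic function. *)
Definition chf_kernel (a t : R) : R :=
  (1 - (cos (t * a) * mean P (fun w => cos (t * V w))
        + sin (t * a) * mean P (fun w => sin (t * V w)))) / t ^+ 2.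

Lemma chf_kernelE (a t : R) :
  (\int[P]_w ((1 - cos (t * (V w - a))) / t ^+ 2)%:E = (chf_kernel a t)%:E)%E.
Proof.
have E : (fun w => (1 - cos (t * (V w - a))) / t ^+ 2) =
  (fun w => (t ^+ 2)^-1 * (1 - (cos (t * a) * cos (t * V w) + sin (t * a) * sin (t * V w)))).
  by apply/funext => w; rewrite mulrBr cosB mulrC; congr (_ * (1 - _)); ring.
have i1 := integrableZl_real (cos (t * a)) (integrable_cosM t).
have i2 := integrableZl_real (sin (t * a)) (integrable_sinM t).
have i3 := integrableD_real i1 i2.
have i0 : P.-integrable setT (EFin \o (fun _ : T => 1%R : R)).
  exact: finite_measure_integrable_cst.
have i4 := integrableB_real i0 i3.
have i5 := integrableZl_real (t ^+ 2)^-1 i4.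
rewrite (eq_integral (fun w => ((t ^+ 2)^-1 * (1 - (cos (t * a) * cos (t * V w) + sin (t * a) * sin (t * V w))))%:E)); last first.
  by move=> w _; have := congr1 (fun f => f w) E => /= ->.
rewrite (integral_mean i5) meanZl// meanB// mean_cst meanD// !meanZl//.
- by rewrite /chf_kernel mulrC.
- exact: integrable_sinM.
- exact: integrable_cosM.
Qed.

Lemma chf_kernel_ge0 (a t : R) : 0 <= chf_kernel a t.
Proof.
rewrite -lee_fin -chf_kernelE; apply: integral_ge0 => w _.
by rewrite lee_fin divr_ge0 ?sqr_ge0// subr_ge0 cos_le1.
Qed.

Let F (a : R) (p : R * T) : \bar R :=
  ((\1_(`]0%R, +oo[ : set R) p.1 * ((1 - cos (p.1 * (V p.2 - a))) / p.1 ^+ 2))%R)%:E.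

Let F_ge0 a p : (0 <= F a p)%E.
Proof.
rewrite lee_fin mulr_ge0// divr_ge0 ?sqr_ge0// subr_ge0; exact: cos_le1.
Qed.

Let mF a : measurable_fun setT (F a).
Proof.
apply/measurable_EFinP; apply: measurable_funM.
  apply: measurableT_comp => //; exact: measurable_indic.
apply: measurable_funM.
  apply: measurable_funB => //.
  apply: (measurableT_comp (continuous_measurable_fun (@continuous_cos R))).
  apply: measurable_funM => //; apply: measurable_funB => //.
  exact: (measurableT_comp mV).
apply: (measurableT_comp (measurable_invr (R:=R))).
exact: measurable_funX.
Qed.

Lemma measurable_chf_kernel (a : R) :
  measurable_fun (`]0%R, +oo[%classic : set R) (fun t => (chf_kernel a t)%:E).
Proof.
have := @measurable_fun_fubini_tonelli_F _ _ _ _ _ P _ (mF a) (F_ge0 a).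
move=> /(measurable_funS measurableT (@subsetT R (`]0%R, +oo[%classic : set R))).
apply: eq_measurable_fun => t; rewrite inE/= => t0.
rewrite -chf_kernelE; apply: eq_integral => w _.
by rewrite /F/= indicE mem_set// mul1r.
Qed.

(** Tonelli's theorem brings the expectation inside [abs_cos_integral].  Thus a
    mean absolute deviation is read off the characteristic function directly,
    without inverting it. *)
Lemma mean_abs_chf (a c : R) :
  (forall x : R, \int[mu]_(t in `]0%R, +oo[) ((1 - cos (t * x)) / t ^+ 2)%:E = (c * `|x|)%:E)%E ->
  (c%:E * \int[P]_w (`|V w - a|)%:E = \int[mu]_(t in `]0%R, +oo[) (chf_kernel a t)%:E)%E.
Proof.
move=> cE.
have c0 : 0 <= c.
  have := cE 1; rewrite normr1 mulr1 => E; rewrite -lee_fin -E.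
  apply: integral_ge0 => t _.
  by rewrite lee_fin divr_ge0 ?sqr_ge0// subr_ge0 cos_le1.
have mabs : measurable_fun setT (fun w => (`|V w - a|)%:E).
  apply/measurable_EFinP; apply: measurableT_comp => //; exact: measurable_funB.
rewrite -ge0_integralZl//.
have step (t : R) : (\int[P]_w F a (t, w) = (\1_(`]0%R, +oo[ : set R) t * chf_kernel a t)%:E)%E.
  have [t0|t0] := boolP (t \in (`]0%R, +oo[%classic : set R)).
    rewrite indicE t0 mul1r -chf_kernelE; apply: eq_integral => w _.
    by rewrite /F/= indicE t0 mul1r.
  rewrite indicE (negbTE t0) mul0r; apply: integral0_eq => w _.
  by rewrite /F/= indicE (negbTE t0) mul0r.
transitivity (\int[P]_w \int[mu]_t F a (t, w))%E.
  apply: eq_integral => w _; rewrite -EFinM -cE integral_mkcond.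
  apply: eq_integral => t _; rewrite /F/= patchE indicE.
  by case: ifP; rewrite ?mul1r ?mul0r.
rewrite -(@fubini_tonelli _ _ _ _ _ mu P _ (mF a) (F_ge0 a))/=.
rewrite [RHS]integral_mkcond; apply: eq_integral => t _.
rewrite step patchE indicE.
by case: ifP; rewrite ?mul1r ?mul0r.
Qed.

End MeanAbsoluteDeviation.

Section MixtureOfCharacteristicFunctions.
Context {R : realType}.
Context {d1 d2 d3 : measure_display} {T1 : measurableType d1}
  {T2 : measurableType d2} {T3 : measurableType d3}.
Variables (P1 : probability T1 R) (P2 : probability T2 R) (P3 : probability T3 R).
Variables (V1 : T1 -> R) (V2 : T2 -> R) (V3 : T3 -> R) (rho : R).
Hypotheses (mV1 : measurable_fun setT V1) (mV2 : measurable_fun setT V2)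
  (mV3 : measurable_fun setT V3).
Hypothesis rho01 : 0 <= rho <= 1.
Hypothesis cosE : forall t, mean P1 (fun w => cos (t * V1 w)) =
  rho * mean P2 (fun w => cos (t * V2 w)) + (1 - rho) * mean P3 (fun w => cos (t * V3 w)).
Hypothesis sinE : forall t, mean P1 (fun w => sin (t * V1 w)) =
  rho * mean P2 (fun w => sin (t * V2 w)) + (1 - rho) * mean P3 (fun w => sin (t * V3 w)).

(** [chf_kernel] is affine in the characteristic function, so a mixture of
    characteristic functions gives a mixture of mean absolute deviations. *)
Lemma mean_abs_mixture (a : R) :
  (\int[P1]_w (`|V1 w - a|)%:E =
   rho%:E * \int[P2]_w (`|V2 w - a|)%:E + (1 - rho)%:E * \int[P3]_w (`|V3 w - a|)%:E)%E.
Proof.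
have /andP[rho0 rho1] := rho01.
have [c c0 cE] := @abs_cos_integral R.
have kE t : chf_kernel P1 V1 a t = rho * chf_kernel P2 V2 a t + (1 - rho) * chf_kernel P3 V3 a t.
  by rewrite /chf_kernel cosE sinE !mulrA -mulrDl; congr (_ * _); ring.
have : (c%:E * \int[P1]_w (`|V1 w - a|)%:E =
   c%:E * (rho%:E * \int[P2]_w (`|V2 w - a|)%:E + (1 - rho)%:E * \int[P3]_w (`|V3 w - a|)%:E))%E.
  rewrite [RHS]ge0_muleDr; last 2 first.
  - by rewrite mule_ge0 ?lee_fin// integral_ge0// => w _; rewrite lee_fin.
  - by rewrite mule_ge0 ?lee_fin ?subr_ge0// integral_ge0// => w _; rewrite lee_fin.
  rewrite !(muleCA c%:E) (mean_abs_chf P1 mV1 a cE) (mean_abs_chf P2 mV2 a cE) (mean_abs_chf P3 mV3 a cE).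
  have m2 := measurable_chf_kernel P2 mV2 a.
  have m3 := measurable_chf_kernel P3 mV3 a.
  have g2 t := chf_kernel_ge0 P2 mV2 a t.
  have g3 t := chf_kernel_ge0 P3 mV3 a t.
  pose D : set R := `]0%R, +oo[%classic.
  have mD : measurable D by exact: measurable_itv.
  have e2 := @ge0_integralZl_EFin _ _ _ (@lebesgue_measure R) D mD
    (fun t => (chf_kernel P2 V2 a t)%:E) (fun t _ => g2 t) m2 _ rho0.
  have r1 : 0 <= 1 - rho by rewrite subr_ge0.
  have e3 := @ge0_integralZl_EFin _ _ _ (@lebesgue_measure R) D mD
    (fun t => (chf_kernel P3 V3 a t)%:E) (fun t _ => g3 t) m3 _ r1.
  rewrite -e2 -e3 -ge0_integralD//; first last.
  - exact: measurable_funeM.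
  - by move=> t _; rewrite -EFinM lee_fin mulr_ge0.
  - exact: measurable_funeM.
  - by move=> t _; rewrite -EFinM lee_fin mulr_ge0.
  by apply: eq_integral => t _; rewrite kE.
move/(congr1 (fun x => (c^-1)%:E * x)%E).
by rewrite !muleA -EFinM mulVf ?lt0r_neq0// !mul1e.
Qed.

End MixtureOfCharacteristicFunctions.

(** * Sums of independent copies *)

Section ConvolutionPowers.
Import complex.
Context {R : realType} {d : measure_display} {T : measurableType d}.
Variables (P : probability T R) (X : {RV P >-> R}).

Definition add_sample (p : R * T) : R := p.1 + X p.2.

Lemma measurable_add_sample : measurable_fun setT add_sample.
Proof.
apply: measurable_funD => //.
exact: (measurableT_comp (measurable_funPT X)).
Qed.

HB.instance Definition _ := isMeasurableFun.Build _ _ _ _ add_sample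
  measurable_add_sample.

(** The law of the sum of n independent copies of X, adding one copy at a time
    to avoid n-fold product spaces. *)
Fixpoint convpow (n : nat) : probability R R :=
  if n is n'.+1 then distribution (convpow n' \x P)%E add_sample else \d_(0 : R).

Lemma ge0_integral_convpow0 (f : R -> \bar R) : measurable_fun setT f ->
  (\int[convpow 0]_x f x = f 0%R)%E.
Proof. by move=> mf; rewrite integral_dirac// diracT mul1e. Qed.

Lemma ge0_integral_convpowS n (f : R -> \bar R) : measurable_fun setT f ->
  (forall x, 0 <= f x)%E ->
  (\int[convpow n.+1]_x f x = \int[convpow n]_x \int[P]_w f (x + X w)%R)%E.
Proof.
move=> mf f0 /=; rewrite ge0_integral_distribution//.
rewrite fubini_tonelli1//; last by move=> p; exact: f0.
exact: (measurableT_comp mf measurable_add_sample).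
Qed.

Lemma measurable_smear (f : R -> \bar R) : measurable_fun setT f ->
  (forall x, 0 <= f x)%E ->
  measurable_fun setT (fun x : R => \int[P]_w f (x + X w)%R)%E.
Proof.
move=> mf f0.
apply: (@measurable_fun_fubini_tonelli_F _ _ _ _ _ P (f \o add_sample)).
  exact: (measurableT_comp mf measurable_add_sample).
by move=> p; exact: f0.
Qed.

Hypothesis X0 : forall w, 0 <= X w.

(** As a law on the whole line, [convpow n] carries the sign of X only almost
    surely, which is why later identities compare functions on the half-line. *)
Lemma convpow_lt0 n : convpow n [set x | x < 0] = 0%E.
Proof.
have mneg : measurable [set x : R | x < 0].
  by rewrite -set_itvNyo; exact: measurable_itv.
elim: n => [|n IH]; first by rewrite /= diracE memNset//= ltxx.
pose ind : R -> \bar R := fun x => (\1_[set x : R | x < 0] x)%:E.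
have mi : measurable_fun setT ind.
  by apply/measurable_EFinP; exact: measurable_indic.
have i0 x : (0 <= ind x)%E by rewrite lee_fin.
have := ge0_integral_convpowS n mi i0.
rewrite {1}/ind integral_indic// setIT => ->.
apply/eqP; rewrite eq_le integral_ge0 ?andbT; last first.
  by move=> x _; apply: integral_ge0 => w _; exact: i0.
rewrite -IH -[Z in (_ <= convpow n Z)%E]setIT -integral_indic// -/ind.
apply: ge0_le_integral => //.
- by move=> x _; apply: integral_ge0 => w _; exact: i0.
- exact: measurable_smear.
move=> x _; rewrite -[leRHS]/(ind x) [leRHS]/ind indicE; case: (boolP (x \in _)) => x0.
  apply: (@le_trans _ _ (\int[P]_w (cst 1 w))%E).
    apply: ge0_le_integral => //.
    - apply: (measurableT_comp mi); exact: measurable_funD.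
    - by move=> w _; rewrite /= lee_fin indicE lern1 leq_b1.
  by rewrite integral_cst//= probability_setT mule1.
rewrite integral0_eq// => w _; rewrite /ind indicE memNset//=.
apply/negP; rewrite -leNgt addr_ge0//.
by move: x0; rewrite notin_setE/= => /negP; rewrite -leNgt.
Qed.

Lemma eq_integral_convpow n (f g : R -> \bar R) :
  measurable_fun setT f -> measurable_fun setT g ->
  (forall x : R, 0 <= x -> f x = g x) ->
  (\int[convpow n]_x f x = \int[convpow n]_x g x)%E.
Proof.
move=> mf mg fg; apply: ae_eq_integral => //.
exists [set x | x < 0]; split.
- by rewrite -set_itvNyo; exact: measurable_itv.
- exact: convpow_lt0.
move=> x /= /not_implyP[_ fgx]; rewrite ltNge; apply/negP => x0.
by apply: fgx; exact: fg.
Qed.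

Let ca t := mean P (fun w => cos (t * X w)).
Let sa t := mean P (fun w => sin (t * X w)).
Let icos t : P.-integrable setT (EFin \o (fun w => cos (t * X w))).
Proof. by apply: integrable_cosM; exact: measurable_funPT. Qed.
Let isin t : P.-integrable setT (EFin \o (fun w => sin (t * X w))).
Proof. by apply: integrable_sinM; exact: measurable_funPT. Qed.
Let cicos n t : (convpow n).-integrable setT (EFin \o (fun x : R => cos (t * x))).
Proof. by apply: (@integrable_cosM _ _ _ (convpow n) id); exact: measurable_id. Qed.
Let cisin n t : (convpow n).-integrable setT (EFin \o (fun x : R => sin (t * x))).
Proof. by apply: (@integrable_sinM _ _ _ (convpow n) id); exact: measurable_id. Qed.

Lemma mean_convpowS n (f : R -> R) : measurable_fun setT f -> (forall x, `|f x| <= 1) ->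
  mean (convpow n.+1) f = mean (convpow n) (fun x => mean P (fun w => f (x + X w))).
Proof.
move=> mf f1.
have fb x : -1 <= f x <= 1 by rewrite -ler_norml.
have ione (d' : measure_display) (T' : measurableType d') (Q : probability T' R) :
    Q.-integrable setT (EFin \o (fun _ : T' => 1%R : R)).
  exact: finite_measure_integrable_cst.
have iconv k (h : R -> R) : measurable_fun setT h -> (forall x, `|h x| <= 1) ->
    (convpow k).-integrable setT (EFin \o h).
  by move=> mh h1; exact: integrable_bounded h1.
have ish x : P.-integrable setT (EFin \o (fun w => f (x + X w))).
  apply: (@integrable_bounded _ _ _ P _ 1) => //.
  by apply: (measurableT_comp mf); exact: measurable_funD.
have i1 x := integrableD_real (ione _ _ P) (ish x).
have mf1 : measurable_fun setT (EFin \o (fun x : R => 1 + f x)).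
  by apply/measurable_EFinP; exact: measurable_funD.
have f10 (x : R) : (0 <= (1 + f x)%:E)%E by rewrite lee_fin; have := fb x; lra.
have inner x : (\int[P]_w (1 + f (x + X w))%:E = (1 + mean P (fun w => f (x + X w)))%:E)%E.
  by rewrite (integral_mean (i1 x)) meanD// mean_cst.
have msm : measurable_fun setT (fun x : R => mean P (fun w => f (x + X w))).
  have := measurable_smear mf1 f10; rewrite (_ : (fun x => _) =
    EFin \o (fun x : R => 1 + mean P (fun w => f (x + X w)))); last exact/funext.
  move=> /measurable_EFinP mh.
  rewrite (_ : (fun x => _) = fun x : R => 1 + mean P (fun w => f (x + X w)) - 1).
    exact: measurable_funB.
  by apply/funext => x; rewrite addrC addKr.
have sm1 x : `|mean P (fun w => f (x + X w))| <= 1.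
  rewrite ler_norml; apply/andP; split; rewrite -[X in X <= _](mean_cst P) ?[X in _ <= X](mean_cst P).
    apply: le_mean => //; first exact: finite_measure_integrable_cst.
    by move=> w; have /andP[] := fb (x + X w).
  rewrite mean_cst -[leRHS](mean_cst P); apply: le_mean => //.
  by move=> w; have /andP[] := fb (x + X w).
(* Tonelli applies to nonnegative functions, hence the shift by 1 *)
have := ge0_integral_convpowS n mf1 f10.
under [in RHS]eq_integral do rewrite /= inner.
have j1 := iconv n.+1 f mf f1; have j2 := iconv n _ msm sm1.
rewrite (integral_mean (integrableD_real (ione _ _ _) j1)).
rewrite (integral_mean (integrableD_real (ione _ _ _) j2)).
by rewrite !meanD// !mean_cst => -[] /addrI.
Qed.

Lemma mean_cos_convpowS n t :
  mean (convpow n.+1) (fun x => cos (t * x)) =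
  mean (convpow n) (fun x => cos (t * x)) * ca t -
  mean (convpow n) (fun x => sin (t * x)) * sa t.
Proof.
rewrite mean_convpowS; first last.
- by move=> x; exact: cos_max.
- by apply: (@measurable_cosM _ _ _ id); exact: measurable_id.
rewrite ![_ * _ t]mulrC -!meanZl// -meanB//; try exact: integrableZl_real.
congr (mean _ _); apply/funext => x.
rewrite [_ * cos _]mulrC [_ * sin _]mulrC -!meanZl// -meanB//; try exact: integrableZl_real.
by congr (mean P _); apply/funext => w; rewrite mulrDr cosD.
Qed.

Lemma mean_sin_convpowS n t :
  mean (convpow n.+1) (fun x => sin (t * x)) =
  mean (convpow n) (fun x => cos (t * x)) * sa t +
  mean (convpow n) (fun x => sin (t * x)) * ca t.
Proof.
rewrite mean_convpowS; first last.
- by move=> x; exact: sin_max.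
- by apply: (@measurable_sinM _ _ _ id); exact: measurable_id.
rewrite ![_ * _ t]mulrC -!meanZl// -meanD//; try exact: integrableZl_real.
congr (mean _ _); apply/funext => x.
rewrite [_ * cos _]mulrC [_ * sin _]mulrC -!meanZl// -meanD//; try exact: integrableZl_real.
by congr (mean P _); apply/funext => w; rewrite mulrDr sinD addrC.
Qed.

Lemma mean_expi_convpow n t :
  mean_expi (convpow n) (fun x => t * x) = mean_expi P (fun w => t * X w) ^+ n.
Proof.
elim: n => [|n IH].
  rewrite expr0 /mean_expi; congr (complex.Complex _ _).
    rewrite /mean expectationE ge0_integral_convpow0 /= ?mulr0 ?cos0//.
    by apply/measurable_EFinP; apply: (@measurable_cosM _ _ _ id); exact: measurable_id.
  rewrite /mean expectationE ge0_integral_convpow0 /= ?mulr0 ?sin0//.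
  by apply/measurable_EFinP; apply: (@measurable_sinM _ _ _ id); exact: measurable_id.
rewrite exprS mulrC -IH /mean_expi.
rewrite [LHS](_ : _ = complex.Complex
  (mean (convpow n.+1) (fun x => cos (t * x))) (mean (convpow n.+1) (fun x => sin (t * x)))) //.
rewrite mean_cos_convpowS mean_sin_convpowS.
by [].
Qed.

Lemma integral_id_convpow n :
  (\int[convpow n]_x `|x|%:E = n%:R%:E * \int[P]_w (X w)%:E)%E.
Proof.
have mn : measurable_fun setT (fun x : R => `|x|%:E).
  by apply/measurable_EFinP.
have mX : measurable_fun setT (fun w => (X w)%:E).
  by apply/measurable_EFinP.
elim: n => [|n IH].
  by rewrite ge0_integral_convpow0// normr0 mul0e.
rewrite ge0_integral_convpowS//.
rewrite (@eq_integral_convpow _ _ (fun x : R => `|x|%:E + \int[P]_w (X w)%:E)%E); first last.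
- move=> x x0; rewrite (eq_integral (fun w => (x%:E + (X w)%:E)%E)); last first.
    by move=> w _; rewrite ger0_norm ?addr_ge0.
  rewrite ge0_integralD//; last by move=> w _; rewrite lee_fin.
  by rewrite integral_prob_cst ger0_norm.
- exact: emeasurable_funD.
- exact: (@measurable_smear (fun x : R => `|x|%:E)%E).
rewrite ge0_integralD//; last first.
  by move=> x _; apply: integral_ge0 => w _; rewrite lee_fin.
rewrite IH integral_prob_cst -[in RHS]natr1 EFinD.
by rewrite ge0_muleDl// ?lee_fin// mul1e.
Qed.

End ConvolutionPowers.

(** * Poisson averages *)

Section PoissonAverage.
Context {R : realType}.
Variable lambda : R.
Hypothesis lambda0 : 0 < lambda.

Definition pois_avg (a : nat -> \bar R) : \bar R :=
  (\sum_(n <oo) (poisson_pmf lambda n)%:E * a n)%E.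

Let term_ge0 (x : \bar R) n : (0 <= x -> 0 <= (poisson_pmf lambda n)%:E * x)%E.
Proof. by move=> an; rewrite mule_ge0// lee_fin poisson_pmf_ge0. Qed.

Lemma eq_pois_avg a b : (forall n, a n = b n) -> pois_avg a = pois_avg b.
Proof. by move=> ab; congr pois_avg; apply/funext. Qed.

Lemma pois_avgD a b : (forall n, 0 <= a n)%E -> (forall n, 0 <= b n)%E ->
  (pois_avg (fun n => a n + b n) = pois_avg a + pois_avg b)%E.
Proof.
move=> a0 b0; rewrite /pois_avg -nneseriesD; last 2 first.
- by move=> n _ _; exact: term_ge0.
- by move=> n _ _; exact: term_ge0.
by apply: eq_eseriesr => n _; rewrite ge0_muleDr.
Qed.

Lemma pois_avgZl (k : R) a : (forall n, 0 <= a n)%E ->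
  (pois_avg (fun n => k%:E * a n) = k%:E * pois_avg a)%E.
Proof.
move=> a0; rewrite /pois_avg -nneseriesZl; last by move=> n _; exact: term_ge0.
by apply: eq_eseriesr => n _; rewrite muleCA.
Qed.

Lemma le_pois_avg a b : (forall n, 0 <= a n)%E -> (forall n, a n <= b n)%E ->
  (pois_avg a <= pois_avg b)%E.
Proof.
move=> a0 ab; apply: lee_nneseries => n _; first by move=> _; exact: term_ge0.
by rewrite lee_wpmul2l// lee_fin poisson_pmf_ge0.
Qed.

(** The weights satisfy n p_n = lambda p_(n-1). *)
Lemma pois_avg_size_bias a : (forall n, 0 <= a n)%E ->
  (pois_avg (fun n => n%:R%:E * a n) = lambda%:E * pois_avg (fun n => a n.+1))%E.
Proof.
move=> a0; rewrite /pois_avg nneseries_recl//; last first.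
  by move=> n _; rewrite term_ge0// mule_ge0// lee_fin.
rewrite mul0e mule0 add0e -nneseries_addn; last first.
  by move=> n; rewrite term_ge0// mule_ge0// lee_fin.
rewrite -nneseriesZl; last by move=> n _; exact: term_ge0.
apply: eq_eseriesr => n _; rewrite addn1 !muleA -!EFinM; congr (_%:E * _)%E.
rewrite /poisson_pmf lambda0 factS exprS natrM.
have n0 : (n.+1%:R : R) != 0 by rewrite pnatr_eq0.
have f0 : (n`!%:R : R) != 0 by rewrite pnatr_eq0 -lt0n fact_gt0.
by field; rewrite f0 addrC natr1 n0.
Qed.

End PoissonAverage.

(** * Stop-loss expectations of the random sum *)

Section RandomSum.
Import complex.
Context {R : realType} {d : measure_display} {T : measurableType d}.
Variables (P : probability T R) (lambda rho : R) (N : {RV P >-> nat})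
  (X : nat -> {RV P >-> R}).
Hypothesis lambda0 : 0 < lambda.
Hypothesis PN : poisson_law P lambda N.
Hypothesis X0 : forall i w, 0 <= X i w.
Hypothesis exchX : exchangeable P X.
Hypothesis indepNX : independent_of_seq P N X.
Hypothesis rho01 : 0 <= rho <= 1.
Hypothesis corrX : equally_correlated P rho X.
Hypothesis X1fin : P.-integrable setT (EFin \o X 0%N).

Definition partial_sum (n : nat) (w : T) : R := \sum_(i < n) X i w.

Lemma measurable_partial_sum n : measurable_fun setT (partial_sum n).
Proof. by apply: measurable_sum => i; exact: measurable_funPT. Qed.

Definition sequence_event : set (set T) :=
  <<s \bigcup_i preimage_set_system [set: T] (X i) measurable >>.

Lemma sequence_event_X i (B : set R) : measurable B -> sequence_event (X i @^-1` B).
Proof.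
move=> mB; apply: sub_sigma_algebra; exists i => //.
by exists B => //; rewrite setTI.
Qed.

(** Measurability for the sigma-algebra of the whole sequence is what the
    independence of N and the sequence is stated with. *)
Lemma sequence_event_partial_sum n (B : set R) : measurable B ->
  sequence_event (partial_sum n @^-1` B).
Proof.
pose G := \bigcup_i preimage_set_system [set: T] (X i) measurable.
move=> mB; have mX i : measurable_fun setT (X i : g_sigma_algebraType G -> R).
  move=> _ A mA; apply: sub_sigma_algebra; exists i => //.
  by exists A.
have ms : measurable_fun setT (partial_sum n : g_sigma_algebraType G -> R).
  by apply: measurable_sum => i; exact: mX.
by have := ms measurableT B mB; rewrite setTI.
Qed.

(** Independence makes the joint law of N and U a product, on which Tonelli's
    theorem separates the two factors. *)
Lemma integral_on_count n (U : T -> R) (f : R -> \bar R) :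
  measurable_fun setT U ->
  (forall B, measurable B -> sequence_event (U @^-1` B)) ->
  measurable_fun setT f -> (forall x, 0 <= f x)%E ->
  (\int[P]_w ((N w == n)%:R%:E * f (U w)) =
   (poisson_pmf lambda n)%:E * \int[P]_w f (U w))%E.
Proof.
move=> mU sU mf f0.
pose V : {mfun T >-> R} := HB.pack U (isMeasurableFun.Build _ _ _ _ _ mU).
have mNV : measurable_fun setT (fun w => (N w, V w)).
  by apply: measurable_fun_pair; exact: measurable_funPT.
pose NV : {mfun T >-> (nat * R)%type} := HB.pack (fun w => (N w, V w))
  (isMeasurableFun.Build _ _ _ _ _ mNV).
pose F (p : (nat * R)%type) : \bar R := ((p.1 == n)%:R%:E * f p.2)%E.
have F0 p : (0 <= F p)%E by rewrite mule_ge0.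
have mF : measurable_fun setT F.
  apply: emeasurable_funM; last by apply: measurableT_comp => //; exact: measurable_snd.
  apply/measurable_EFinP.
  by apply: (@measurableT_comp _ _ _ _ _ _ (fun m : nat => (m == n)%:R : R)).
pose c := (\int[P]_w f (U w))%E.
have c0 : (0 <= c)%E by apply: integral_ge0 => w _; exact: f0.
transitivity (\int[P]_w (F \o NV) w)%E; first by [].
rewrite -ge0_integral_distribution//.
transitivity (\int[(distribution P N \x distribution P V)%E]_p F p)%E.
  apply: eq_measure_integral => A mA _; apply/esym.
  apply: product_measure_unique => // B1 B2 mB1 mB2.
  rewrite /= /pushforward.
  rewrite -indepNX//; exact: sU.
rewrite fubini_tonelli1//.
have inner m : fubini_F (distribution P V) F m = ((\1_[set n] m)%:E * c)%E.
  rewrite /fubini_F/= ge0_integralZl_EFin// ge0_integral_distribution// indicE.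
  by have -> : (m \in [set n]) = (m == n) by apply/idP/eqP => [/set_mem//|->]; exact: mem_set.
under eq_integral do rewrite inner.
rewrite ge0_integralZr//.
rewrite integral_indic// setIT; congr (_ * _)%E.
exact: PN.
Qed.

(** The sample space is partitioned by the values of N. *)
Lemma integral_at_count (U : nat -> T -> R) (f : nat -> R -> \bar R) :
  (forall n, measurable_fun setT (U n)) ->
  (forall n B, measurable B -> sequence_event (U n @^-1` B)) ->
  (forall n, measurable_fun setT (f n)) -> (forall n x, 0 <= f n x)%E ->
  (\int[P]_w f (N w) (U (N w) w) =
   pois_avg lambda (fun n => \int[P]_w f n (U n w)))%E.
Proof.
move=> mU sU mf f0.
under eq_integral => w _.
  rewrite (_ : f _ _ = \sum_(n <oo) ((N w == n)%:R%:E * f n (U n w)))%E; last first.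
    rewrite (@nneseriesD1 _ _ (N w))//; last by move=> n _; rewrite mule_ge0.
    rewrite eqxx mul1e eseries0 ?adde0// => n _ /=; rewrite eq_sym => /negbTE ->.
    by rewrite mul0e.
  over.
rewrite integral_nneseries//; last 2 first.
- move=> n; apply: emeasurable_funM; last exact: (measurableT_comp (mf n) (mU n)).
  apply/measurable_EFinP.
  by apply: (@measurableT_comp _ _ _ _ _ _ (fun m : nat => (m == n)%:R : R)).
- by move=> n w _; rewrite mule_ge0.
by apply: eq_eseriesr => n _; exact: (integral_on_count n (mU n) (sU n) (mf n) (f0 n)).
Qed.

Lemma integral_random_sum (f : R -> \bar R) :
  measurable_fun setT f -> (forall x, 0 <= f x)%E ->
  (\int[P]_w f (\sum_(i < N w) X i w)%R =
   pois_avg lambda (fun n => \int[P]_w f (partial_sum n w)))%E.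
Proof.
move=> mf f0; apply: (@integral_at_count partial_sum (fun=> f)) => //.
- exact: measurable_partial_sum.
- exact: sequence_event_partial_sum.
Qed.

Lemma integral_count_multiple (f : nat -> R -> \bar R) :
  (forall n, measurable_fun setT (f n)) -> (forall n x, 0 <= f n x)%E ->
  (\int[P]_w f (N w) (X 0%N w) =
   pois_avg lambda (fun n => \int[P]_w f n (X 0%N w)))%E.
Proof.
move=> mf f0; apply: (@integral_at_count (fun=> X 0%N) f) => //.
by move=> _; exact: sequence_event_X.
Qed.

Lemma exch_law i (B : set R) : measurable B -> P (X i @^-1` B) = P (X 0%N @^-1` B).
Proof.
move=> mB.
pose A := [set t : (i.+1).-tuple R | B (tnth t ord_max)].
have mA : measurable A.
  by have := measurable_tnth (@ord_max i) measurableT mB; rewrite setTI.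
have := exchX (tperm ord0 (@ord_max i)) mA.
rewrite (_ : [set w | A _] = X i @^-1` B); last first.
  by apply/seteqP; split=> w /=; rewrite /A/= tnth_mktuple.
move=> ->; congr (P _).
by apply/seteqP; split=> w /=; rewrite /A/= tnth_mktuple tpermR.
Qed.

Lemma exch_integral i (f : R -> \bar R) : measurable_fun setT f ->
  (forall x, 0 <= f x)%E -> (\int[P]_w f (X i w) = \int[P]_w f (X 0%N w))%E.
Proof.
move=> mf f0.
have E j : (\int[P]_w f (X j w) = \int[distribution P (X j)]_x f x)%E.
  by rewrite ge0_integral_distribution.
by rewrite !E; apply: eq_measure_integral => A mA _; exact: exch_law.
Qed.

Lemma exch_mean_bounded i (f : R -> R) : measurable_fun setT f ->
  (forall x, `|f x| <= 1) -> mean P (f \o X i) = mean P (f \o X 0%N).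
Proof.
move=> mf f1.
have int j : P.-integrable setT (EFin \o (f \o X j)).
  apply: (@integrable_bounded _ _ _ P _ 1); last by move=> w; exact: f1.
  by apply: measurableT_comp => //; exact: measurable_funPT.
have i1 : P.-integrable setT (EFin \o (fun _ : T => 1%R : R)).
  exact: finite_measure_integrable_cst.
have E := @exch_integral i (fun x => (1 + f x)%:E).
have {E} : (\int[P]_w (1 + f (X i w))%:E = \int[P]_w (1 + f (X 0%N w))%:E)%E.
  apply: E; first by apply/measurable_EFinP; exact: measurable_funD.
  by move=> x; rewrite lee_fin; have := f1 x; rewrite ler_norml; lra.
have e j := integral_mean (integrableD_real i1 (int j)).
by rewrite (e i) (e 0%N) !meanD// => -[] /addrI.
Qed.

Local Notation m1 := (mean P (X 0%N)).

Lemma integrable_X i : P.-integrable setT (EFin \o X i).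
Proof.
apply/integrableP; split; first by apply/measurable_EFinP; exact: measurable_funPT.
rewrite (@exch_integral i (fun x => `|x|%:E))//; first by case/integrableP: X1fin.
by apply/measurable_EFinP.
Qed.

Lemma integrable_partial_sum n : P.-integrable setT (EFin \o partial_sum n).
Proof.
rewrite /partial_sum; apply: (@eq_integrable _ _ _ P _ measurableT
  (fun w => \sum_(i < n) (X i w)%:E)%E).
  by move=> w _ /=; rewrite sumEFin.
by apply: integrable_sum => // i _; exact: integrable_X.
Qed.

Lemma mean_X i : mean P (X i) = m1.
Proof.
have := @exch_integral i (fun x => `|x|%:E).
have -> j : (\int[P]_w `|X j w|%:E = \int[P]_w (X j w)%:E)%E.
  by apply: eq_integral => w _; rewrite ger0_norm.
have -> : (\int[P]_w `|X 0%N w|%:E = \int[P]_w (X 0%N w)%:E)%E.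
  by apply: eq_integral => w _; rewrite ger0_norm.
rewrite !integral_mean//; last exact: integrable_X.
move=> H; have : (mean P (X i))%:E = m1%:E by apply: H => //; apply/measurable_EFinP.
by case.
Qed.

Lemma mean_partial_sum n : mean P (partial_sum n) = n%:R * m1.
Proof.
elim: n => [|n IH].
  rewrite mul0r -[RHS](mean_cst P); congr (mean P _).
  by apply/funext => w; rewrite /partial_sum big_ord0.
rewrite (_ : partial_sum n.+1 = fun w => partial_sum n w + X n w); last first.
  by apply/funext => w; rewrite /partial_sum big_ord_recr.
rewrite meanD; [|exact: integrable_partial_sum|exact: integrable_X].
by rewrite IH mean_X -natr1; ring.
Qed.

(** The model with all parameters equal to t: by exchangeability the n factors
    of the product coincide.  The model says nothing for n = 0, where both sides
    are 1. *)
Lemma mean_expi_partial_sum n t :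
  mean_expi P (fun w => t * partial_sum n w) =
  complex.real_complex R rho * mean_expi P (fun w => t * (n%:R * X 0%N w)) +
  complex.real_complex R (1 - rho) * mean_expi (convpow (X 0%N) n) (fun x => t * x).
Proof.
rewrite mean_expi_convpow.
have rhoE : complex.real_complex R rho + complex.real_complex R (1 - rho) = 1.
  by rewrite -rmorphD/= subrKC.
case: n => [|n].
  have one (f : T -> R) : (forall w, f w = 0) -> mean_expi P f = 1.
    move=> f0; rewrite /mean_expi (_ : f = fun=> 0); last exact/funext.
    have -> : mean P (cos \o (fun=> 0 : R)) = 1.
      by rewrite -[RHS](mean_cst P) -cos0.
    have -> // : mean P (sin \o (fun=> 0 : R)) = 0.
    by rewrite -[RHS](mean_cst P) -[in RHS]sin0.
  rewrite expr0 !one ?mulr1 ?rhoE// => w; first by rewrite mul0r mulr0.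
  by rewrite /partial_sum big_ord0 mulr0.
have := corrX (fun _ : 'I_n.+1 => t) isT.
rewrite (_ : (fun w => \sum_(j < n.+1) t * X j w) = (fun w => t * partial_sum n.+1 w)); last first.
  by apply/funext => w; rewrite /partial_sum mulr_sumr.
rewrite (_ : (fun w => X 0%N w * \sum_(j < n.+1) t) = (fun w => t * (n.+1%:R * X 0%N w))); last first.
  by apply/funext => w; rewrite sumr_const card_ord -mulr_natr; ring.
move=> ->; congr (_ + _ * _).
rewrite (eq_bigr (fun=> mean_expi P (fun w => t * X 0%N w))); last first.
  move=> j _; rewrite /mean_expi; congr (complex.Complex _ _).
    apply: (@exch_mean_bounded j (fun x => cos (t * x))); last by move=> x; exact: cos_max.
    by apply: (@measurable_cosM _ _ _ id); exact: measurable_id.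
  apply: (@exch_mean_bounded j (fun x => sin (t * x))); last by move=> x; exact: sin_max.
  by apply: (@measurable_sinM _ _ _ id); exact: measurable_id.
by rewrite prodr_const card_ord.
Qed.

Let mixture_step n t :
  mean P (fun w => cos (t * partial_sum n w)) =
    rho * mean P (fun w => cos (t * (n%:R * X 0%N w)))
    + (1 - rho) * mean (convpow (X 0%N) n) (fun x => cos (t * x)) /\
  mean P (fun w => sin (t * partial_sum n w)) =
    rho * mean P (fun w => sin (t * (n%:R * X 0%N w)))
    + (1 - rho) * mean (convpow (X 0%N) n) (fun x => sin (t * x)).
Proof.
have := mean_expi_partial_sum n t; rewrite /mean_expi.
move=> /eqP; rewrite eq_complex/= => /andP[/eqP c1 /eqP c2]; split.
  by move: c1; rewrite !mul0r !subr0.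
by move: c2; rewrite !mul0r !addr0.
Qed.

Lemma stop_loss_abs (a x : R) : Num.max 0 (x - a) = (`|x - a| + (x - a)) / 2.
Proof. by case: (ler0P (x - a)) => h; lra. Qed.

(** A stop-loss function is the half-sum of an absolute deviation and of an
    affine function, and the three laws have the same mean n E[X_1]. *)
Lemma integral_stop_loss_partial_sum (a : R) n :
  (\int[P]_w (Num.max 0 (partial_sum n w - a))%:E =
   rho%:E * \int[P]_w (Num.max 0 (n%:R * X 0%N w - a))%:E +
   (1 - rho)%:E * \int[convpow (X 0%N) n]_x (Num.max 0 (x - a))%:E)%E.
Proof.
have sl (d' : measure_display) (T' : measurableType d') (Q : probability T' R) (V : T' -> R) (m : R) :
    Q.-integrable setT (EFin \o V) -> mean Q V = m ->
    (\int[Q]_w (`|V w - a|)%:E = (mean Q (fun w => `|V w - a|))%:E /\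
     \int[Q]_w (Num.max 0 (V w - a)%R)%:E =
     ((mean Q (fun w => (`|V w - a|)%R) + (m - a)) / 2)%:E)%E.
  move=> iV mV.
  have ia : Q.-integrable setT (EFin \o (fun w => V w - a)).
    by apply: integrableB_real => //; exact: finite_measure_integrable_cst.
  have iabs : Q.-integrable setT (EFin \o (fun w => `|V w - a|)).
    by have := integrable_norm ia.
  have isum := integrableD_real iabs ia.
  have i2 := integrableZl_real 2^-1 isum.
  split; first by rewrite integral_mean.
  transitivity (\int[Q]_w (2^-1 * (`|V w - a| + (V w - a)))%:E)%E.
    by apply: eq_integral => w _; rewrite stop_loss_abs mulrC.
  rewrite (integral_mean i2) meanZl// meanD// meanB ?mean_cst ?mV 1?mulrC//.
  exact: finite_measure_integrable_cst.
have [a1 s1] := sl _ _ P _ _ (integrable_partial_sum n) (mean_partial_sum n).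
have inX : P.-integrable setT (EFin \o (fun w => n%:R * X 0%N w)).
  by apply: integrableZl_real; exact: integrable_X.
have [a2 s2] := sl _ _ P _ (n%:R * m1) inX (meanZl _ (integrable_X 0)).
have conv : (convpow (X 0%N) n).-integrable setT (EFin \o id).
  apply/integrableP; split; first by apply/measurable_EFinP.
  rewrite integral_id_convpow// (integral_mean (integrable_X 0)) -EFinM; exact: ltry.
have convm : mean (convpow (X 0%N) n) id = n%:R * m1.
  have : ((mean (convpow (X 0%N) n) id)%:E = (n%:R * m1)%:E)%E; last by case.
  rewrite -integral_mean// EFinM -(integral_mean (integrable_X 0)) -integral_id_convpow//.
  apply: eq_integral_convpow => //; try exact/measurable_EFinP.
  by move=> x x0; rewrite ger0_norm.
have [a3 s3] := sl _ _ (convpow (X 0%N) n) id _ conv convm.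
have := @mean_abs_mixture R _ _ _ _ _ _ P P (convpow (X 0%N) n)
  (partial_sum n) (fun w => n%:R * X 0%N w) id rho
  (measurable_partial_sum n) _ _ rho01 (fun t => (mixture_step n t).1)
  (fun t => (mixture_step n t).2) a.
move=> /(_ _ _)/wrap[].
- by apply: measurable_funM => //; exact: measurable_funPT.
- exact: measurable_id.
rewrite a1 a2 a3 s1 s2 s3 -!EFinM -!EFinD => -[->].
by congr EFin; field.
Qed.

End RandomSum.

(** * Laws with a density and the gamma law *)

Section Density.
Context {R : realType} {d : measure_display} {T : measurableType d}.
Variables (nu : {finite_measure set T -> \bar R})
  (mu : {sigma_finite_measure set T -> \bar R}) (p : T -> R).
Hypothesis p0 : forall x, 0 <= p x.
Hypothesis mp : measurable_fun setT p.
Hypothesis nuE : forall A, measurable A -> (nu A = \int[mu]_(x in A) (p x)%:E)%E.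

Lemma density_dominates : nu `<< mu.
Proof.
apply/null_content_dominatesP => A mA muA0; rewrite nuE//.
by apply: null_set_integral => //; apply/measurable_EFinP; exact: measurable_funTS.
Qed.

(** The density coincides almost everywhere with the Radon-Nikodym derivative,
    for which the change of variables is known. *)
Lemma ge0_integral_density (f : T -> \bar R) : measurable_fun setT f ->
  (forall x, 0 <= f x)%E -> (\int[nu]_x f x = \int[mu]_x (f x * (p x)%:E))%E.
Proof.
move=> mf f0.
have numu := density_dominates.
have fi := Radon_Nikodym_SigmaFinite.f_integrable numu.
rewrite -(Radon_Nikodym_SigmaFinite.change_of_variables numu f0 measurableT mf).
have mp' : measurable_fun setT (fun x => (p x)%:E) by apply/measurable_EFinP.
apply: ae_eq_integral => //.
- by apply: emeasurable_funM => //; exact: measurable_int fi.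
- exact: emeasurable_funM.
apply: ae_eqe_mul2l; apply: integral_ae_eq => //.
by move=> E _ mE; rewrite -Radon_Nikodym_SigmaFinite.f_integral// nuE.
Qed.

Lemma integral_density (f : T -> R) : measurable_fun setT f ->
  (\int[nu]_x (f x)%:E = \int[mu]_x (f x * p x)%:E)%E.
Proof.
move=> mf; rewrite integralE [RHS]integralE.
have mf' : measurable_fun setT (EFin \o f) by apply/measurable_EFinP.
rewrite !ge0_integral_density//; last 2 first.
- exact: measurable_funeneg.
- exact: measurable_funepos.
congr (_ - _)%E; apply: eq_integral => x _.
  by rewrite !funeposE EFinM maxe_pMl ?mul0e ?lee_fin.
by rewrite !funenegE EFinM -mulNe maxe_pMl ?mul0e ?lee_fin.
Qed.

End Density.

Section GammaLaw.
Context {R : realType} {d : measure_display} {T : measurableType d}.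
Variables (Q : probability T R) (r s : R) (Z : {RV Q >-> R}).
Hypotheses (r0 : 0 < r) (s0 : 0 < s).
Hypothesis Zlaw : gamma_law Q r s Z.
Local Notation mu := (@lebesgue_measure R).

Definition gamma_weight (z : R) : R := z `^ (r - 1) * expR (- (s * z)).
Definition gamma_norm : R := s `^ r / Gamma r.

Lemma Gamma_ge0 : 0 <= Gamma r.
Proof. by apply: Rintegral_ge0 => x _; rewrite mulr_ge0 ?powR_ge0 ?expR_ge0. Qed.

Lemma gamma_norm_ge0 : 0 <= gamma_norm.
Proof. by rewrite divr_ge0 ?powR_ge0 ?Gamma_ge0. Qed.

Lemma gamma_weight_ge0 z : 0 <= gamma_weight z.
Proof. by rewrite mulr_ge0 ?powR_ge0 ?expR_ge0. Qed.

Lemma measurable_gamma_weight : measurable_fun setT gamma_weight.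
Proof.
apply: measurable_funM; first exact: measurable_powR.
apply: measurableT_comp => //; apply: measurableT_comp => //.
Qed.

Lemma gamma_pdfE z : gamma_pdf r s z = if 0 < z then gamma_norm * gamma_weight z else 0.
Proof. by rewrite /gamma_pdf /gamma_norm /gamma_weight; case: ifP; rewrite ?mulrA. Qed.

Lemma gamma_pdf_ge0 z : 0 <= gamma_pdf r s z.
Proof.
by rewrite gamma_pdfE; case: ifP => // _; rewrite mulr_ge0 ?gamma_norm_ge0 ?gamma_weight_ge0.
Qed.

Lemma measurable_gamma_pdf : measurable_fun setT (gamma_pdf r s).
Proof.
rewrite (_ : gamma_pdf r s = fun z => if 0 < z then gamma_norm * gamma_weight z else 0).
  apply: measurable_fun_ifT => //; first exact: measurable_fun_ltr.
  by apply: measurable_funM => //; exact: measurable_gamma_weight.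
by apply/funext => z; rewrite gamma_pdfE.
Qed.

Lemma gamma_ge0_integral (f : R -> \bar R) : measurable_fun setT f ->
  (forall x, 0 <= f x)%E ->
  (\int[Q]_w f (Z w) = \int[mu]_x (f x * (gamma_pdf r s x)%:E))%E.
Proof.
move=> mf f0.
have mZ : measurable_fun setT (Z : T -> measurableTypeR R).
  exact: (@measurable_funPT _ _ _ _ Z).
pose Zm : {mfun T >-> measurableTypeR R} := HB.pack (Z : T -> measurableTypeR R)
  (isMeasurableFun.Build _ _ _ _ _ mZ).
rewrite -(@ge0_integral_density R _ (measurableTypeR R)
  (distribution Q Zm) mu _
  measurable_gamma_pdf Zlaw _ mf f0).
by rewrite ge0_integral_distribution.
Qed.

Lemma gamma_integral (f : R -> R) : measurable_fun setT f ->
  Q.-integrable setT (EFin \o (f \o Z)) ->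
  (\int[Q]_w (f (Z w))%:E = \int[mu]_x (f x * gamma_pdf r s x)%:E)%E.
Proof.
move=> mf fi.
have mZ : measurable_fun setT (Z : T -> measurableTypeR R).
  exact: (@measurable_funPT _ _ _ _ Z).
pose Zm : {mfun T >-> measurableTypeR R} := HB.pack (Z : T -> measurableTypeR R)
  (isMeasurableFun.Build _ _ _ _ _ mZ).
rewrite -(@integral_density R _ (measurableTypeR R)
  (distribution Q Zm) mu _ gamma_pdf_ge0
  measurable_gamma_pdf Zlaw _ mf).
by rewrite integral_distribution//; exact/measurable_EFinP.
Qed.

(** A priori the integral [Gamma r] could be infinite, hence 0 as a real number;
    the total mass 1 of the law excludes it. *)
Lemma gamma_norm_gt0 : 0 < gamma_norm.
Proof.
rewrite lt_neqAle gamma_norm_ge0 andbT; apply/negP => /eqP q0.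
have := Zlaw (@measurableT _ R).
rewrite preimage_setT probability_setT integral0_eq => [/eqP|x _].
  by rewrite onee_eq0.
by rewrite gamma_pdfE -q0 mul0r if_same.
Qed.

Lemma gamma_gt0_ae : {ae Q, forall t, 0 < Z t}.
Proof.
have mneg : measurable [set z : R | z <= 0] by rewrite -set_itvNyc; exact: measurable_itv.
exists (Z @^-1` [set z | z <= 0]); split.
- by rewrite -[X in measurable X]setTI; exact: measurable_funPT.
- by rewrite Zlaw//; apply: integral0_eq => x /= x0; rewrite gamma_pdfE ltNge x0.
by move=> t /= /negP; rewrite -leNgt.
Qed.

(** The exponential dominates one term of its power series, of degree above
    a + 2. *)
Lemma powR_exp_bound (a : R) : exists2 C : R, 0 <= C & forall z : R, 1 <= z ->
  z `^ a * expR (- (s * z)) <= C * z ^- 2.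
Proof.
have [m am] : exists m : nat, a + 2 <= m.+1%:R.
  exists (Num.truncn `|a + 2|); apply: (le_trans (ler_norm _)); apply: ltW.
  exact: truncnS_gt.
exists ((m.+1)`!%:R / s ^+ m.+1).
  by rewrite divr_ge0// exprn_ge0// ltW.
move=> z z1; have z0 : 0 < z by exact: lt_le_trans z1.
rewrite expRN ler_pdivrMr ?expR_gt0// mulrAC ler_pdivlMr ?exprn_gt0//.
apply: (@le_trans _ _ (z ^+ m.+1)).
  rewrite -(powR_mulrn m.+1 (ltW z0)) -(powR_mulrn 2 (ltW z0)).
  have -> : z `^ a * z `^ 2%:R = z `^ (a + 2).
    by rewrite powRD// (lt0r_neq0 z0) implybT.
  exact: ler_powR.
have := expR_ge1Dxn m (mulr_ge0 (ltW s0) (ltW z0)).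
rewrite exprMn => h.
have sm : 0 < s ^+ m.+1 by rewrite exprn_gt0.
have fm : 0 < (m.+1)`!%:R :> R by rewrite ltr0n fact_gt0.
have -> : z ^+ m.+1 = (m.+1)`!%:R / s ^+ m.+1 * (s ^+ m.+1 * z ^+ m.+1 / (m.+1)`!%:R).
  by field; rewrite (lt0r_neq0 sm) (lt0r_neq0 fm).
rewrite ler_wpM2l ?divr_ge0 ?ltW//.
by apply: lt_le_trans h; rewrite ltrDr.
Qed.

End GammaLaw.

(** * Integration by parts for the gamma law *)

Section GammaStein.
Context {R : realType} {d : measure_display} {T : measurableType d}.
Variables (Q : probability T R) (r s : R) (Z : {RV Q >-> R}).
Hypotheses (r0 : 0 < r) (s0 : 0 < s).
Hypothesis Zlaw : gamma_law Q r s Z.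
Local Notation mu := (@lebesgue_measure R).
Local Notation q := (gamma_norm r s).
Local Notation w := (gamma_weight r s).

(** On ]0, 1] the power is at most 1 and the density has mass at most 1; on
    [1, +oo[ the exponential leaves an integrable 2 / z^2. *)
Lemma gamma_moment n : Q.-integrable setT (EFin \o (fun t => Z t ^+ n)).
Proof.
apply/integrableP; split.
  by apply/measurable_EFinP; apply: measurable_funX; exact: measurable_funPT.
have [C C0 CE] := powR_exp_bound s0 (n%:R + (r - 1)).
have q0 := gamma_norm_ge0 r s.
have mn : measurable_fun setT (fun x : R => (`|x ^+ n|)%:E).
  apply/measurable_EFinP; apply: measurableT_comp => //; exact: measurable_funX.
rewrite (eq_integral (fun t => (fun x : R => (`|x ^+ n|)%:E) (Z t)))//.
rewrite (gamma_ge0_integral Zlaw mn)//.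
pose D : set R := `[1%R, +oo[%classic.
have mD : measurable D by exact: measurable_itv.
have minv : measurable_fun setT (fun x : R => 2 * x ^- 2).
  rewrite (_ : (fun x => _) = (fun x : R => 2 * (x ^-1) ^+ 2)); last first.
    by apply/funext => x; rewrite exprVn.
  by apply: measurable_funM => //; apply: measurable_funX; exact: measurable_invr.
have m1 : measurable_fun setT (fun x : R => (gamma_pdf r s x)%:E).
  by apply/measurable_EFinP; exact: measurable_gamma_pdf.
have m3 : measurable_fun setT (fun x : R => (\1_D x * (2 * x ^- 2))%:E).
  by apply/measurable_EFinP; apply: measurable_funM => //; exact: measurable_indic.
have m2 : measurable_fun setT (fun x : R => (q * C)%:E * (\1_D x * (2 * x ^- 2))%:E)%E.
  exact: measurable_funeM.
have g2 (x : R) : (0 <= (\1_D x * (2 * x ^- 2))%:E)%E.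
  by rewrite lee_fin mulr_ge0// mulr_ge0// invr_ge0 sqr_ge0.
apply: (@le_lt_trans _ _ (\int[mu]_x ((gamma_pdf r s x)%:E + (q * C)%:E * (\1_D x * (2 * x ^- 2))%:E))%E).
  apply: ge0_le_integral => //.
  - by move=> x _; rewrite mule_ge0// lee_fin gamma_pdf_ge0.
  - exact: emeasurable_funM.
  - exact: emeasurable_funD.
  move=> x _; rewrite -!EFinM -EFinD lee_fin gamma_pdfE.
  have [x0|x0] := ltP 0 x; last first.
    by rewrite mulr0 add0r; apply: mulr_ge0; [exact: mulr_ge0 | rewrite -lee_fin; exact: g2].
  have wx := gamma_weight_ge0 r s x.
  rewrite (ger0_norm (exprn_ge0 n (ltW x0))).
  have [x1|x1] := leP 1 x.
    have -> : \1_D x = 1 :> R by rewrite indicE mem_set// /D/= in_itv/= x1.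
    rewrite mul1r.
    have := CE x x1; rewrite powRD; last by rewrite (lt0r_neq0 x0) implybT.
    rewrite (powR_mulrn n (ltW x0)) -mulrA -/(w x) => h.
    have h2 : 0 <= C * x ^- 2 by rewrite mulr_ge0// invr_ge0 sqr_ge0.
    apply: (@le_trans _ _ (q * (C * x ^- 2))).
      by rewrite mulrCA; exact: ler_wpM2l.
    have -> : q * C * (2 * x ^- 2) = 2 * (q * (C * x ^- 2)) by ring.
    have := mulr_ge0 q0 h2; have := mulr_ge0 q0 wx; lra.
  have -> : \1_D x = 0 :> R.
    by rewrite indicE memNset// /D/= in_itv/= andbT; apply/negP; rewrite -ltNge.
  rewrite mul0r mulr0 addr0.
  by apply: ler_piMl; [exact: mulr_ge0 | rewrite exprn_ile1 ?(ltW x0) ?(ltW x1)].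
rewrite ge0_integralD//; last 2 first.
- by move=> x _; rewrite lee_fin gamma_pdf_ge0.
- by move=> x _; rewrite mule_ge0// lee_fin mulr_ge0.
apply: lte_add_pinfty.
  rewrite -(Zlaw (@measurableT _ R)) preimage_setT probability_setT; exact: ltry.
rewrite ge0_integralZl_EFin//; last exact: mulr_ge0.
apply: lte_mul_pinfty => //; first by rewrite lee_fin mulr_ge0.
apply: le_lt_trans (@inv_sqr_integral_lty R); rewrite [leRHS]integral_mkcond.
rewrite le_eqVlt; apply/orP; left; apply/eqP; apply: eq_integral => x _.
by rewrite patchE indicE; case: ifP; rewrite ?mul1r ?mul0r.
Qed.

Variables b x : R.
Hypothesis b0 : 0 < b.

(** Functions of z with a parameter x.  Differentiating in x multiplies by s and
    raises k by one, while [stein_op] below lowers or raises k by at most one: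
    this is how gamma expectations of these tests become solutions, in x, of a
    second-order equation. *)
Definition stein_test (k : nat) (z : R) : R :=
  (1 - z / b) ^+ k * expR (s * (x - b) * (1 - z / b)).

(** The gamma operator z h'(z) + (r - s z) h(z) applied to h = [stein_test k]. *)
Definition stein_op (k : nat) (z : R) : R :=
  ((r - s * b + s * b * (1 - z / b)) * (1 - z / b) ^+ k
   - z / b * (k%:R * (1 - z / b) ^+ k.-1 + s * (x - b) * (1 - z / b) ^+ k))
  * expR (s * (x - b) * (1 - z / b)).

(** A primitive of the gamma weight times [stein_op]. *)
Definition stein_prim (k : nat) (z : R) : R :=
  z `^ r * (expR (- (s * z)) * stein_test k z).

Lemma is_derive_stein_prim (k : nat) (z : R) : 0 < z ->
  is_derive z 1 (stein_prim k) (w z * stein_op k z).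
Proof.
move=> z0.
have dr := is_derive1_powR r z0.
have de : is_derive z 1 (fun z => expR (- (s * z))) (expR (- (s * z)) * (- s)).
  apply: (@is_derive1_comp _ expR (fun z => - (s * z))).
  by apply: is_derive_eq; rewrite /GRing.scale/=; ring.
have dv : is_derive z 1 (fun z => 1 - z / b) (- b^-1).
  by apply: is_derive_eq; rewrite /GRing.scale/=; ring.
have dk : is_derive z 1 (fun z => (1 - z / b) ^+ k) (k%:R * (1 - z / b) ^+ k.-1 * - b^-1).
  have := is_deriveX k dv.
  rewrite (_ : (fun z => 1 - z / b) ^+ k = (fun z => (1 - z / b) ^+ k)) //.
  by apply/funext => y; elim: k => [|k IH]; rewrite ?expr0// !exprS /= -IH.
have dx : is_derive z 1 (fun z => expR (s * (x - b) * (1 - z / b)))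
    (expR (s * (x - b) * (1 - z / b)) * (s * (x - b) * - b^-1)).
  apply: (@is_derive1_comp _ expR (fun z => s * (x - b) * (1 - z / b))).
have d1 := is_deriveM dk dx.
have d2 := is_deriveM de d1.
have d3 := is_deriveM dr d2.
apply: (is_derive_eq d3).
rewrite /GRing.scale/= !mulrfctE /= /stein_test /gamma_weight /stein_op -(mulr_powRB1 (ltW z0) r0).
have bn : b != 0 by exact: lt0r_neq0.
move: (_ ^+ k) (_ ^+ k.-1) (expR (- (s * z))) (expR (s * (x - b) * _)) (z `^ (r - 1)) => V V' e1 e2 p.
by field.
Qed.

Lemma stein_prim_end k : stein_prim k b = b `^ r * expR (- (s * b)) * (k == 0)%:R.
Proof.
rewrite /stein_prim /stein_test divff ?lt0r_neq0// subrr mulr0 expR0 mulr1.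
by rewrite mulrA expr0n.
Qed.

Lemma continuous_stein_op k : continuous (stein_op k).
Proof.
have cv : continuous (fun z : R => 1 - z / b).
  move=> z; apply: cvgB; first exact: cvg_cst.
  by apply: cvgM; [exact: cvg_id|exact: cvg_cst].
have ck n : continuous (fun z : R => (1 - z / b) ^+ n).
  move=> z; have : {for z, continuous ((fun y : R => y ^+ n) \o (fun z => 1 - z / b))}.
    by apply: continuous_comp; [exact: cv|exact: exprn_continuous].
  by [].
have ce : continuous (fun z : R => expR (s * (x - b) * (1 - z / b))).
  move=> z; have cl : (fun z : R => s * (x - b) * (1 - z / b)) @ z --> s * (x - b) * (1 - z / b).
    by apply: cvgM; [exact: cvg_cst|exact: cv].
  have : {for z, continuous (expR \o (fun z : R => s * (x - b) * (1 - z / b)))}.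
    by apply: continuous_comp; [exact: cl|exact: continuous_expR].
  by [].
move=> z; apply: cvgM; last exact: ce.
apply: cvgB.
  apply: cvgM; last exact: ck.
  by apply: cvgD; [exact: cvg_cst|apply: cvgM; [exact: cvg_cst|exact: cv]].
apply: cvgM; first by apply: cvgM; [exact: cvg_id|exact: cvg_cst].
by apply: cvgD; apply: cvgM; [exact: cvg_cst|exact: ck|exact: cvg_cst|exact: ck].
Qed.

Lemma continuous_gamma_weight (z : R) : 0 < z -> {for z, continuous w}.
Proof.
move=> z0; apply: cvgM.
  have : {for z, continuous (fun y : R => y `^ (r - 1))}.
    apply/differentiable_continuous/derivable1_diffP.
    by apply: ex_derive; exact: is_derive1_powR.
  by [].
have cl : (fun z : R => - (s * z)) @ z --> - (s * z).
  by apply: cvgN; apply: cvgM; [exact: cvg_cst|exact: cvg_id].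
have : {for z, continuous (expR \o (fun z : R => - (s * z)))}.
  by apply: continuous_comp; [exact: cl|exact: continuous_expR].
by [].
Qed.

Lemma measurable_stein_op k : measurable_fun setT (stein_op k).
Proof. by apply: continuous_measurable_fun; exact: continuous_stein_op. Qed.

(** Up to a polynomial factor the tests are bounded on the side where
    (x - b) (1 - z / b) is bounded above. *)
Definition stein_dom (k : nat) (z : R) : R :=
  (r + 2 * (s * b) + k%:R + s * `|x - b|) * expR (s * `|x - b|) * (1 + `|z| / b) ^+ k.+1.

Lemma stein_dom_ge0 k z : 0 <= stein_dom k z.
Proof.
apply: mulr_ge0; last by rewrite exprn_ge0// addr_ge0// divr_ge0// ltW.
apply: mulr_ge0; last exact: expR_ge0.
have := mulr_ge0 (ltW s0) (ltW b0); have := mulr_ge0 (ltW s0) (normr_ge0 (x - b)).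
by have := ler0n R k; have := ltW r0; lra.
Qed.

Lemma stein_exp_bound (z : R) : 0 <= z -> (z <= b) || (b <= x) ->
  expR (s * (x - b) * (1 - z / b)) <= expR (s * `|x - b|).
Proof.
move=> z0 zbx; rewrite ler_expR -mulrA ler_wpM2l ?(ltW s0)//.
have u0 : 0 <= z / b by rewrite divr_ge0// ltW.
case/orP: zbx => [zb|bx].
  have u1 : z / b <= 1 by rewrite ler_pdivrMr ?mul1r.
  apply: (le_trans (ler_norm _)); rewrite normrM ler_piMr//.
  by rewrite ger0_norm; lra.
have : 0 <= x - b by rewrite subr_ge0.
by move=> h; rewrite ger0_norm//; nra.
Qed.

Lemma stein_var_bound (z : R) : 0 <= z -> `|1 - z / b| <= 1 + `|z| / b.
Proof.
move=> z0; rewrite (ger0_norm z0); have u0 : 0 <= z / b by rewrite divr_ge0// ltW.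
by rewrite ler_norml; apply/andP; split; lra.
Qed.

Lemma stein_test_bound (k : nat) (z : R) : 0 <= z -> (z <= b) || (b <= x) ->
  `|stein_test k z| <= expR (s * `|x - b|) * (1 + `|z| / b) ^+ k.
Proof.
move=> z0 zbx; rewrite normrM normrX (ger0_norm (expR_ge0 _)) mulrC.
apply: ler_pM; rewrite ?expR_ge0 ?exprn_ge0//; first exact: stein_exp_bound.
by apply: lerXn2r; rewrite ?nnegrE ?addr_ge0 ?divr_ge0 ?(ltW b0)//; exact: stein_var_bound.
Qed.

Lemma stein_op_bound (k : nat) (z : R) : 0 <= z -> (z <= b) || (b <= x) ->
  `|stein_op k z| <= stein_dom k z.
Proof.
move=> z0 zbx; rewrite normrM (ger0_norm (expR_ge0 _)) /stein_dom [leRHS]mulrAC.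
apply: ler_pM; rewrite ?expR_ge0//; last exact: stein_exp_bound.
have u0 : 0 <= z / b by rewrite divr_ge0// ltW.
have vt := stein_var_bound z0.
rewrite (ger0_norm z0) in vt *.
set u := z / b in u0 vt *; set v := 1 - u in vt *; set t := 1 + u in vt *.
have t1 : 1 <= t by rewrite lerDl.
have t0 : 0 <= t by exact: le_trans t1.
have vk n : `|v| ^+ n <= t ^+ n by apply: lerXn2r; rewrite ?nnegrE.
have vk1 : `|v| ^+ k.-1 <= t ^+ k.
  by apply: (le_trans (vk _)); apply: ler_weXn2l => //; exact: leq_pred.
have tk0 : 0 <= t ^+ k by exact: exprn_ge0.
have sb0 : 0 <= s * b by rewrite mulr_ge0// ltW.
have sx0 : 0 <= s * `|x - b| by rewrite mulr_ge0// ltW.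
have vk0 n : 0 <= `|v| ^+ n by exact: exprn_ge0.
apply: (le_trans (ler_normB _ _)); rewrite !normrM normrX.
have a1 : `|r - s * b + s * b * v| <= (r + s * b) * t.
  have ru := mulr_ge0 (ltW r0) u0; have sbu := mulr_ge0 sb0 u0.
  by rewrite ler_norml /v /t; move: (r) (s * b) (u) ru sbu sb0 r0 => ? ? ? ? ? ? ?; apply/andP; split; lra.
have a2 : `|k%:R * v ^+ k.-1 + s * (x - b) * v ^+ k| <= (k%:R + s * `|x - b|) * t ^+ k.
  apply: (le_trans (ler_normD _ _)); rewrite !normrM !normrX normr_nat (gtr0_norm s0) mulrDl.
  by apply: lerD; apply: ler_wpM2l => //; rewrite ler0n.
have b1 : `|r - s * b + s * b * v| * `|v| ^+ k <= (r + s * b) * t * t ^+ k.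
  by apply: ler_pM.
have b2 : `|u| * `|k%:R * v ^+ k.-1 + s * (x - b) * v ^+ k| <= t * ((k%:R + s * `|x - b|) * t ^+ k).
  by apply: ler_pM => //; rewrite ger0_norm// /t; lra.
have -> : `|z| * `|b^-1| = `|u| by rewrite -normrM.
apply: (le_trans (lerD b1 b2)); rewrite exprS.
have : 0 <= s * b * (t * t ^+ k) by rewrite mulr_ge0// mulr_ge0.
by lra.
Qed.

Lemma integrable_stein_dom k : Q.-integrable setT (EFin \o (fun t => stein_dom k (Z t))).
Proof.
apply: integrableZl_real.
pose c := (1 + b^-1) ^+ k.+1.
apply: (@integrable_dominated _ _ _ Q _ (fun t => c * (1 + `|Z t ^+ k.+1|))).
- apply: measurable_funX; apply: measurable_funD => //; apply: measurable_funM => //.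
  by apply: measurableT_comp => //; exact: measurable_funPT.
- move=> t; rewrite normrX ger0_norm; last by rewrite addr_ge0// divr_ge0// ltW.
  have ib : 0 <= b^-1 by rewrite invr_ge0 ltW.
  have c0 : 0 <= c by rewrite exprn_ge0// addr_ge0.
  have [z1|z1] := leP `|Z t| 1.
    apply: (@le_trans _ _ c); last first.
      by rewrite ler_peMr// lerDl.
    apply: lerXn2r; rewrite ?nnegrE ?addr_ge0 ?mulr_ge0//.
    by rewrite lerD2l ler_piMl.
  apply: (@le_trans _ _ (c * `|Z t ^+ k.+1|)); last first.
    by rewrite ler_wpM2l// lerDr.
  rewrite normrX -exprMn; apply: lerXn2r; rewrite ?nnegrE ?addr_ge0 ?mulr_ge0// ?addr_ge0//.
  have := mulr_ge0 ib (normr_ge0 (Z t)); nra.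
apply: integrableZl_real; apply: integrableD_real.
  exact: finite_measure_integrable_cst.
by have := integrable_norm (gamma_moment k.+1).
Qed.

(** The fundamental theorem of calculus away from the singularities at 0 and
    infinity. *)
Lemma stein_truncated (k : nat) (a m : R) : 0 < a -> a < m -> (m <= b) || (b <= x) ->
  (\int[Q]_t ((a < Z t <= m)%R%:R * stein_op k (Z t))%:E =
   (q * (stein_prim k m - stein_prim k a))%:E)%E.
Proof.
move=> a0 am mbx.
pose D : set R := `]a, m]%classic.
have mD : measurable D by exact: measurable_itv.
pose f z : R := \1_D z * stein_op k z.
have mf : measurable_fun setT f.
  apply: measurable_funM; [exact: measurable_indic|exact: measurable_stein_op].
have fE t : (a < Z t <= m)%R%:R * stein_op k (Z t) = f (Z t).
  congr (_ * _); rewrite indicE; congr (nat_of_bool _)%:R.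
  by apply/idP/idP => [h|/set_mem]; [apply/mem_set|]; rewrite /D/= in_itv.
under eq_integral do rewrite fE.
rewrite (gamma_integral Zlaw mf); last first.
  apply: (@integrable_dominated _ _ _ Q _ (fun t => stein_dom k (Z t))).
  - by apply: measurableT_comp => //; exact: measurable_funPT.
  - move=> t /=; rewrite /f indicE; case: (boolP (_ \in _)) => [/set_mem|_].
      rewrite /D/= in_itv/= mul1r => /andP[h1 h2]; apply: stein_op_bound.
        by rewrite ltW// (lt_trans a0).
      by case/orP: mbx => [mb|->]; rewrite ?orbT// (le_trans h2 mb).
    by rewrite mul0r normr0 stein_dom_ge0.
  - exact: integrable_stein_dom.
transitivity (\int[mu]_(z in D) (q * (w z * stein_op k z))%:E)%E.
  rewrite [RHS]integral_mkcond; apply: eq_integral => z _.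
  rewrite patchE /f indicE; case: (boolP (_ \in _)) => [/set_mem|_]; last by rewrite !mul0r.
  rewrite /D/= in_itv/= => /andP[az _]; rewrite gamma_pdfE (lt_trans a0 az).
  by congr EFin; ring.
have dG (z : R) : a <= z -> is_derive z 1 (stein_prim k) (w z * stein_op k z).
  by move=> az; apply: is_derive_stein_prim; exact: lt_le_trans az.
have cz (z : R) : 0 < z -> {for z, continuous (fun z => q * (w z * stein_op k z))}.
  move=> z0; apply: cvgM; first exact: cvg_cst.
  by apply: cvgM; [exact: continuous_gamma_weight|exact: continuous_stein_op].
have cf : {within `[a, m], continuous (fun z => q * (w z * stein_op k z))}.
  apply: continuous_in_subspaceT => z; rewrite inE/= in_itv/= => /andP[az _].
  by apply: cz; exact: lt_le_trans az.
rewrite integral_itv_obnd_cbnd; last first.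
  apply/measurable_EFinP; apply: (measurable_funS measurableT) => //.
  apply: measurable_funM => //; apply: measurable_funM; last exact: measurable_stein_op.
  exact: measurable_gamma_weight.
rewrite (@continuous_FTC2 _ _ (fun z => q * stein_prim k z) a m am cf).
- by rewrite -EFinB mulrBr.
- have dq (z : R) : a <= z -> is_derive z 1 (fun z => q * stein_prim k z) (q * (w z * stein_op k z)).
    by move=> az; have := is_deriveZ q (dG z az).
  have cq (z : R) : a <= z -> {for z, continuous (fun z => q * stein_prim k z)}.
    move=> az; apply: differentiable_continuous; apply/derivable1_diffP.
    by have := dq z az => ?; exact: ex_derive.
  split.
  + by move=> z; rewrite in_itv/= => /andP[/ltW az _]; have := dq z az => ?; exact: ex_derive.
  + by apply: cvg_at_right_filter; apply: cq.
  + by apply: cvg_at_left_filter; apply: cq; exact: ltW.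
- move=> z; rewrite in_itv/= => /andP[/ltW az _]; rewrite derive1E.
  have dz : is_derive z 1 (fun z => q * stein_prim k z) (q * (w z * stein_op k z)).
    by have := is_deriveZ q (dG z az).
  by rewrite derive_val.
Qed.

End GammaStein.

(** * Integration by parts up to the level b *)

Section ExpTaylor.
Context {R : realType}.

Lemma expR_increment (p p' : R) : p <= p' -> p' <= 0 -> 0 <= expR p' - expR p <= p' - p.
Proof.
move=> pp p0; rewrite subr_ge0 ler_expR pp/=.
have e : expR p = expR p' * expR (p - p') by rewrite -expRD; congr expR; ring.
have h1 := expR_ge1Dx (p - p').
have h2 : expR (p - p') <= 1 by rewrite expR_le1; lra.
have h3 : expR p' <= 1 by rewrite expR_le1.
have h4 := expR_ge0 p'.
by rewrite e; nra.
Qed.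

(** The second derivative of the exponential is between 0 and 1 on the negative
    half-line. *)
Lemma expR_taylor2 (p p' : R) : p <= 0 -> p' <= 0 ->
  0 <= expR p' - expR p - (p' - p) * expR p <= (p' - p) ^+ 2 / 2.
Proof.
move=> p0 p0'; apply/andP; split.
  have e : expR p' = expR p * expR (p' - p) by rewrite -expRD; congr expR; ring.
  have h1 := expR_ge1Dx (p' - p).
  by have h4 := expR_ge0 p; rewrite e; nra.
pose psi (y : R) := expR y - (y * expR p + (y - p) * (y - p) / 2).
have dpsi (y : R) : is_derive y 1 psi (expR y - (expR p + (y - p))).
  by apply: is_derive_eq; rewrite /GRing.scale/=; field.
have cpsi A : {within A, continuous psi}.
  apply: continuous_subspaceT => y.
  apply/differentiable_continuous/derivable1_diffP.
  by have := dpsi y => ?; exact: ex_derive.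
have main : psi p' <= psi p.
  have [pp|pp|->//] := ltgtP p p'.
    have [c /[!in_itv]/= /andP[c1 c2] E] := MVT pp (fun y _ => dpsi y) (cpsi _).
    have := expR_increment (ltW c1) (le_trans (ltW c2) p0') => /andP[_ h].
    by rewrite -subr_le0 E; nra.
  have [c /[!in_itv]/= /andP[c1 c2] E] := MVT pp (fun y _ => dpsi y) (cpsi _).
  have := expR_increment (ltW c2) p0 => /andP[_ h].
  by rewrite -subr_ge0 E; nra.
by move: main; rewrite /psi subrr !mul0r addr0; lra.
Qed.

End ExpTaylor.

Section GammaSteinIdentities.
Context {R : realType} {d : measure_display} {T : measurableType d}.
Variables (Q : probability T R) (r s : R) (Z : {RV Q >-> R}).
Hypotheses (r0 : 0 < r) (s0 : 0 < s).
Hypothesis Zlaw : gamma_law Q r s Z.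
Variable b : R.
Hypothesis b0 : 0 < b.
Local Notation q := (gamma_norm r s).

(** The value at b of the gamma density times z, the only boundary term that
    survives below. *)
Definition stein_boundary : R := q * (b `^ r * expR (- (s * b))).
Local Notation theta := stein_boundary.

Lemma stein_boundary_gt0 : 0 < theta.
Proof. by rewrite mulr_gt0 ?(gamma_norm_gt0 Zlaw)// mulr_gt0 ?expR_gt0// powR_gt0. Qed.

Lemma dominated_eventually (F : nat -> T -> R) (f g : T -> R) :
  (forall n, measurable_fun setT (F n)) -> measurable_fun setT f ->
  (forall t, \forall n \near \oo, F n t = f t) ->
  Q.-integrable setT (EFin \o g) -> (forall n t, `|F n t| <= g t) ->
  (\int[Q]_t (F n t)%:E)%E @[n --> \oo] --> (\int[Q]_t (f t)%:E)%E.
Proof.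
move=> mF mf Ff gi Fg.
have [] := @dominated_convergence _ _ _ Q setT measurableT (fun n t => (F n t)%:E)
  (fun t => (f t)%:E) (EFin \o g).
- by move=> n; apply/measurable_EFinP.
- by apply/measurable_EFinP.
- apply: aeW => t _; apply: cvg_near_cst.
  by apply: filterS (Ff t) => n ->.
- exact: gi.
- by apply: aeW => t n _; rewrite /= lee_fin.
by [].
Qed.

Lemma vanish_le (u v : nat -> R) (C : R) : (forall n, `|u n| <= C * v n) ->
  v @ \oo --> (0 : R) -> u @ \oo --> (0 : R).
Proof.
move=> uC v0.
apply: (@squeeze_cvgr _ _ _ _ (fun n => - (C * v n)) (fun n => C * v n) u).
- by apply: nearW => n; rewrite -ler_norml.
- rewrite -[X in _ --> X]oppr0 -[X in - X](mulr0 C); apply: cvgN.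
  by apply: cvgM; [exact: cvg_cst|exact: v0].
- rewrite -[X in _ --> X](mulr0 C).
  by apply: cvgM; [exact: cvg_cst|exact: v0].
Qed.

Lemma measurable_Z_itv (a m : R) : measurable_fun setT (fun t => (a < Z t <= m)%R%:R : R).
Proof.
rewrite (_ : (fun t => _) = (\1_(`]a, m]%classic : set R) : R -> R) \o Z).
  by apply: measurableT_comp => //; exact: measurable_indic.
apply/funext => t /=; rewrite indicE; congr (nat_of_bool _)%:R.
by apply/idP/idP => [h|/set_mem]; [apply/mem_set|]; rewrite /= in_itv.
Qed.

Lemma measurable_Z_gt (a : R) : measurable_fun setT (fun t => (a < Z t)%R%:R : R).
Proof.
rewrite (_ : (fun t => _) = (\1_(`]a, +oo[%classic : set R) : R -> R) \o Z).
  by apply: measurableT_comp => //; exact: measurable_indic.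
apply/funext => t /=; rewrite indicE; congr (nat_of_bool _)%:R.
by apply/idP/idP => [h|/set_mem]; [apply/mem_set|]; rewrite /= in_itv/= andbT.
Qed.

Lemma measurable_op_Z x k : measurable_fun setT (fun t => stein_op r s b x k (Z t)).
Proof. by apply: measurableT_comp => //; exact: measurable_stein_op. Qed.

(** At 0 the primitive vanishes since r > 0; at b it vanishes unless k = 0,
    because 1 - z / b does. *)
Lemma stein_left x k :
  (\int[Q]_t ((0 < Z t <= b)%R%:R * stein_op r s b x k (Z t))%:E =
   (theta * (k == 0%N)%:R)%:E)%E.
Proof.
pose a n : R := b / 2 * (n.+1%:R)^-1.
have a0 n : 0 < a n by rewrite mulr_gt0 ?divr_gt0 ?invr_gt0.
have ab n : a n < b.
  have : (n.+1%:R)^-1 <= 1 :> R by rewrite invf_le1 ?ler1n// ltr0n.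
  move=> h; apply: (@le_lt_trans _ _ (b / 2 * 1)); last by have := b0; lra.
  by rewrite ler_wpM2l// divr_ge0// ltW.
have acvg : a @ \oo --> (0 : R).
  rewrite -[X in _ --> X](mulr0 (b / 2)).
  by apply: cvgM; [exact: cvg_cst|exact: cvg_harmonic].
have lim1 : (\int[Q]_t ((a n < Z t <= b)%R%:R * stein_op r s b x k (Z t))%:E)%E @[n --> \oo] -->
  (\int[Q]_t ((0 < Z t <= b)%R%:R * stein_op r s b x k (Z t))%:E)%E.
  apply: (@dominated_eventually _ _ (fun t => stein_dom r s b x k (Z t))).
  - by move=> n; apply: measurable_funM; [exact: measurable_Z_itv|exact: measurable_op_Z].
  - by apply: measurable_funM; [exact: measurable_Z_itv|exact: measurable_op_Z].
  - move=> t; have [Zt|Zt] := ltP 0 (Z t); last first.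
      apply: nearW => n /=; have -> // : (a n < Z t) = false.
      by apply/negbTE; rewrite -leNgt (le_trans Zt (ltW (a0 n))).
    near=> n; have -> // : a n < Z t.
    by near: n; exact: (cvgr_lt _ acvg).
  - exact: integrable_stein_dom.
  - move=> n t; case: (boolP (_ < Z t <= b)) => [/andP[h1 h2]|_].
      by rewrite mul1r; apply: stein_op_bound; rewrite ?h2// ltW// (lt_trans (a0 n)).
    by rewrite mul0r normr0 stein_dom_ge0.
have prim0 : (fun n => stein_prim r s b x k (a n)) @ \oo --> (0 : R).
  apply: (@vanish_le _ (fun n => a n `^ r) (expR (s * `|x - b|) * 2 ^+ k)).
    move=> n; rewrite normrM ger0_norm ?powR_ge0// mulrC ler_wpM2r ?powR_ge0//.
    rewrite normrM ger0_norm ?expR_ge0// -[leRHS]mul1r.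
    apply: ler_pM; rewrite ?expR_ge0//.
      by rewrite expR_le1 oppr_le0 mulr_ge0// ltW.
    apply: (le_trans (stein_test_bound s0 b0 k (ltW (a0 n)) _)); first by rewrite (ltW (ab n)).
    rewrite ler_wpM2l ?expR_ge0//; apply: lerXn2r; rewrite ?nnegrE ?addr_ge0 ?divr_ge0 ?(ltW b0)//.
    have : a n / b <= 1 by rewrite ler_pdivrMr// mul1r ltW.
    by rewrite gtr0_norm//; lra.
  have /cvg_at_rightP := powR_cvg0 r0; apply.
  by split.
have lim2 : (\int[Q]_t ((a n < Z t <= b)%R%:R * stein_op r s b x k (Z t))%:E)%E @[n --> \oo] -->
  ((theta * (k == 0%N)%:R)%:E)%E.
  under eq_fun => n do rewrite (stein_truncated r0 s0 Zlaw b0 k (a0 n) (ab n)) ?lexx//.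
  apply/fine_cvgP; split; first exact: nearW.
  rewrite stein_prim_end// /theta.
  have -> : q * (b `^ r * expR (- (s * b))) * (k == 0%N)%:R =
    q * (b `^ r * expR (- (s * b)) * (k == 0%N)%:R - 0) by ring.
  apply: cvgM; first exact: cvg_cst.
  by apply: cvgB; [exact: cvg_cst|exact: prim0].
exact: (cvg_unique _ lim1 lim2).
Unshelve. all: by end_near. Qed.

(** At infinity the primitive is killed by the exponential since x >= b does not
    tilt it upwards. *)
Lemma stein_right x k : b <= x ->
  (\int[Q]_t ((b < Z t)%R%:R * stein_op r s b x k (Z t))%:E =
   (- theta * (k == 0%N)%:R)%:E)%E.
Proof.
move=> bx; pose m n : R := b + n.+1%:R.
have n0 n : 0 < n.+1%:R :> R by rewrite ltr0n.
have n1 n : 1 <= n.+1%:R :> R by rewrite ler1n.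
have bm n : b < m n by rewrite ltrDl.
have m1 n : 1 <= m n by apply: (le_trans (n1 n)); rewrite /m lerDr ltW.
have m0 n : 0 < m n by exact: lt_le_trans (m1 n).
have lim1 : (\int[Q]_t ((b < Z t <= m n)%R%:R * stein_op r s b x k (Z t))%:E)%E @[n --> \oo] -->
  (\int[Q]_t ((b < Z t)%R%:R * stein_op r s b x k (Z t))%:E)%E.
  apply: (@dominated_eventually _ _ (fun t => stein_dom r s b x k (Z t))).
  - by move=> n; apply: measurable_funM; [exact: measurable_Z_itv|exact: measurable_op_Z].
  - by apply: measurable_funM; [exact: measurable_Z_gt|exact: measurable_op_Z].
  - move=> t; near=> n.
    suff -> : Z t <= m n by rewrite andbT.
    have nn : (n%:R : R) <= n.+1%:R by rewrite ler_nat.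
    apply: (@le_trans _ _ n%:R); first by near: n; exact: nbhs_infty_ger.
    by apply: (le_trans nn); rewrite /m lerDr ltW.
  - exact: integrable_stein_dom.
  - move=> n t; case: (boolP (_ < Z t <= _)) => [/andP[h1 h2]|_].
      by rewrite mul1r; apply: stein_op_bound; rewrite ?bx ?orbT// ltW// (lt_trans b0).
    by rewrite mul0r normr0 stein_dom_ge0.
have prim0 : (fun n => stein_prim r s b x k (m n)) @ \oo --> (0 : R).
  have [C C0 CE] := powR_exp_bound s0 (r + k%:R).
  apply: (@vanish_le _ (fun n => (n.+1%:R)^-1) (expR (s * `|x - b|) * (1 + b^-1) ^+ k * C)); last exact: cvg_harmonic.
  move=> n.
  have ib : 0 <= b^-1 by rewrite invr_ge0 ltW.
  have h1 : `|stein_test s b x k (m n)| <= expR (s * `|x - b|) * (1 + b^-1) ^+ k * m n ^+ k.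
    apply: (le_trans (stein_test_bound s0 b0 k (ltW (m0 n)) _)); first by rewrite bx orbT.
    rewrite -mulrA ler_wpM2l ?expR_ge0// -exprMn; apply: lerXn2r.
    - by rewrite nnegrE addr_ge0 ?divr_ge0 ?(ltW b0).
    - by rewrite nnegrE mulr_ge0 ?addr_ge0// ltW.
    - by rewrite gtr0_norm//; have := m1 n; have := m0 n; nra.
  have h2 := CE _ (m1 n).
  rewrite normrM ger0_norm ?powR_ge0// normrM ger0_norm ?expR_ge0//.
  apply: (@le_trans _ _ (expR (s * `|x - b|) * (1 + b^-1) ^+ k * (m n `^ (r + k%:R) * expR (- (s * m n))))).
    rewrite powRD; last by rewrite (lt0r_neq0 (m0 n)) implybT.
    rewrite (powR_mulrn k (ltW (m0 n))).
    have := ler_wpM2l (expR_ge0 (- (s * m n))) h1.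
    move=> /(ler_wpM2l (powR_ge0 (m n) r)) h3.
    by apply: (le_trans h3); rewrite le_eqVlt; apply/orP; left; apply/eqP; ring.
  rewrite -[leRHS]mulrA ler_wpM2l ?mulr_ge0 ?expR_ge0 ?exprn_ge0 ?addr_ge0//.
  apply: (le_trans h2); rewrite ler_wpM2l//.
  rewrite lef_pV2 ?posrE ?exprn_gt0//.
  apply: (@le_trans _ _ (m n)); first by rewrite lerDr ltW.
  by rewrite expr2 ler_peMr// ltW.
have lim2 : (\int[Q]_t ((b < Z t <= m n)%R%:R * stein_op r s b x k (Z t))%:E)%E @[n --> \oo] -->
  ((- theta * (k == 0%N)%:R)%:E)%E.
  under eq_fun => n do rewrite (stein_truncated r0 s0 Zlaw b0 k b0 (bm n)) ?bx ?orbT//.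
  apply/fine_cvgP; split; first exact: nearW.
  rewrite stein_prim_end// /theta.
  have -> : - (q * (b `^ r * expR (- (s * b)))) * (k == 0%N)%:R =
    q * (0 - b `^ r * expR (- (s * b)) * (k == 0%N)%:R) by ring.
  apply: cvgM; first exact: cvg_cst.
  by apply: cvgB; [exact: prim0|exact: cvg_cst].
exact: (cvg_unique _ lim1 lim2).
Unshelve. all: by end_near. Qed.

End GammaSteinIdentities.

(** * Moments restricted to one side of the level b *)

Section SteinTestPointwise.
Context {R : realType}.
Variables (r s b : R).
Hypotheses (s0 : 0 < s) (b0 : 0 < b).

(** The gamma operator acts on the tests by a three-term recursion in k. *)
Lemma stein_opE (x : R) (k : nat) (z : R) : stein_op r s b x k z =
  (r + k%:R - s * x) * stein_test s b x k z + s * x * stein_test s b x k.+1 z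
  - k%:R * stein_test s b x k.-1 z.
Proof.
rewrite /stein_op /stein_test; move: (expR _) => e.
have bn := lt0r_neq0 b0.
case: k => [|k]; first by rewrite /= !expr0 expr1; ring.
rewrite !exprS /=; move: (_ ^+ k) => V.
by rewrite -[k.+1%:R]natr1; field.
Qed.

(** The hypotheses keep the exponents nonpositive, and the exponential is
    convex with second derivative at most 1 there. *)
Lemma stein_test_taylor (x y z : R) :
  (x - b) * (1 - z / b) <= 0 -> (y - b) * (1 - z / b) <= 0 ->
  0 <= stein_test s b y 0 z - stein_test s b x 0 z - s * (y - x) * stein_test s b x 1 z
    <= (s * (y - x)) ^+ 2 / 2 * stein_test s b b 2 z.
Proof.
move=> xv yv.
have px : s * (x - b) * (1 - z / b) <= 0 by rewrite -mulrA pmulr_rle0.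
have py : s * (y - b) * (1 - z / b) <= 0 by rewrite -mulrA pmulr_rle0.
have := expR_taylor2 px py.
rewrite /stein_test !expr0 expr1 subrr mulr0 mul0r expR0 !mul1r mulr1.
set e := expR _; set e' := expR _; set v := 1 - z / b.
have -> : s * (y - b) * v - s * (x - b) * v = s * (y - x) * v by ring.
by move=> /andP[h1 h2]; apply/andP; split; [move: h1|move: h2]; rewrite ?exprMn; lra.
Qed.

Lemma stein_test_increment (x y z : R) : x <= y ->
  (x - b) * (1 - z / b) <= 0 -> (y - b) * (1 - z / b) <= 0 ->
  0 <= stein_test s b y 1 z - stein_test s b x 1 z
    <= s * (y - x) * stein_test s b b 2 z.
Proof.
move=> xy xv yv.
have px : s * (x - b) * (1 - z / b) <= 0 by rewrite -mulrA pmulr_rle0.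
have py : s * (y - b) * (1 - z / b) <= 0 by rewrite -mulrA pmulr_rle0.
rewrite /stein_test !expr1 subrr mulr0 mul0r expR0 mulr1.
have sxy : 0 <= s * (y - x) by rewrite mulr_ge0 ?subr_ge0// ltW.
have E : s * (y - b) * (1 - z / b) - s * (x - b) * (1 - z / b) = s * (y - x) * (1 - z / b) by ring.
have [v0|v0] := leP 0 (1 - z / b).
  have h : s * (x - b) * (1 - z / b) <= s * (y - b) * (1 - z / b).
    have := mulr_ge0 sxy v0; rewrite -E; lra.
  have := expR_increment h py.
rewrite E.
  move: (expR _) (expR _) => e1 e2; move: (1 - z / b) v0 => v v0 /andP[h1 h2].
  by apply/andP; split; rewrite -mulrBr; nra.
have h : s * (y - b) * (1 - z / b) <= s * (x - b) * (1 - z / b).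
  have := mulr_ge0_le0 sxy (ltW v0); rewrite -E; lra.
have := expR_increment h px.
have -> : s * (x - b) * (1 - z / b) - s * (y - b) * (1 - z / b) = - (s * (y - x) * (1 - z / b)) by ring.
move: (expR _) (expR _) => e1 e2; move: (1 - z / b) v0 => v v0 /andP[h1 h2].
by apply/andP; split; rewrite -mulrBr; nra.
Qed.

End SteinTestPointwise.

Section SteinSide.
Context {R : realType} {d : measure_display} {T : measurableType d}.
Variables (Q : probability T R) (r s : R) (Z : {RV Q >-> R}).
Hypotheses (r0 : 0 < r) (s0 : 0 < s).
Hypothesis Zlaw : gamma_law Q r s Z.
Variable b : R.
Hypothesis b0 : 0 < b.
Variable side : R -> bool.
Hypothesis mside : measurable_fun setT (fun t => (side (Z t))%:R : R).
Hypothesis side_ge0 : forall z, side z -> 0 <= z.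

(** The point x is on the same side of b as the values z of the side, so the
    tests stay bounded. *)
Definition side_ok (x : R) : Prop := forall z, side z -> (x - b) * (1 - z / b) <= 0.

Definition side_moment (k : nat) (x : R) : R :=
  mean Q (fun t => (side (Z t))%:R * stein_test s b x k (Z t)).

Lemma side_ok_b : side_ok b.
Proof. by move=> z _; rewrite subrr mul0r. Qed.

Lemma measurable_stein_test x k : measurable_fun setT (stein_test s b x k).
Proof.
have mv : measurable_fun setT (fun z : R => 1 - z / b).
  by apply: measurable_funB => //; exact: measurable_funM.
apply: measurable_funM; first exact: measurable_funX.
by apply: measurableT_comp => //; exact: measurable_funM.
Qed.

Lemma integrable_side x k : side_ok x ->
  Q.-integrable setT (EFin \o (fun t => (side (Z t))%:R * stein_test s b x k (Z t))).
Proof.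
move=> okx.
pose c := r + 2 * (s * b) + k%:R.
have c0 : 0 < c.
  have := mulr_gt0 s0 b0; have := ler0n R k; have := r0; rewrite /c; lra.
apply: (@integrable_dominated _ _ _ Q _ (fun t => c^-1 * stein_dom r s b b k (Z t))).
- apply: measurable_funM => //.
  by apply: measurableT_comp; [exact: measurable_stein_test|exact: measurable_funPT].
- move=> t.
  have -> : c^-1 * stein_dom r s b b k (Z t) = (1 + `|Z t| / b) ^+ k.+1.
    rewrite /stein_dom subrr normr0 mulr0 expR0 mulr1 addr0 -/c mulrA mulVf ?mul1r//.
    exact: lt0r_neq0.
  have t1 : 1 <= 1 + `|Z t| / b by rewrite lerDl divr_ge0// ltW.
  case: (boolP (side (Z t))) => [sZ|_]; last first.
    by rewrite mul0r normr0 exprn_ge0// (le_trans ler01).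
  rewrite mul1r normrM normrX (ger0_norm (expR_ge0 _)).
  have e1 : expR (s * (x - b) * (1 - Z t / b)) <= 1.
    by rewrite expR_le1 -mulrA pmulr_rle0// okx.
  apply: (@le_trans _ _ (`|1 - Z t / b| ^+ k)); first by rewrite ler_piMr// exprn_ge0.
  apply: (@le_trans _ _ ((1 + `|Z t| / b) ^+ k)).
    apply: lerXn2r; rewrite ?nnegrE//; first exact: le_trans t1.
    by have := stein_var_bound b0 (side_ge0 sZ).
  exact: ler_weXn2l.
by apply: integrableZl_real; exact: integrable_stein_dom.
Qed.

Lemma side_recursion x k : side_ok x ->
  (\int[Q]_t ((side (Z t))%:R * stein_op r s b x k (Z t))%:E)%E =
  ((r + k%:R - s * x) * side_moment k x + s * x * side_moment k.+1 x
   - k%:R * side_moment k.-1 x)%:E.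
Proof.
move=> okx.
have i1 := integrableZl_real (r + k%:R - s * x) (integrable_side k okx).
have i2 := integrableZl_real (s * x) (integrable_side k.+1 okx).
have i3 := integrableZl_real k%:R (integrable_side k.-1 okx).
have i12 := integrableD_real i1 i2.
have i := integrableB_real i12 i3.
transitivity (\int[Q]_t ((r + k%:R - s * x) * ((side (Z t))%:R * stein_test s b x k (Z t))
  + s * x * ((side (Z t))%:R * stein_test s b x k.+1 (Z t))
  - k%:R * ((side (Z t))%:R * stein_test s b x k.-1 (Z t)))%:E)%E.
  by apply: eq_integral => t _; rewrite (stein_opE _ _ b0); congr EFin; ring.
rewrite (integral_mean i) meanB// meanD// !meanZl//; exact: integrable_side.
Qed.

Lemma side_taylor x y : side_ok x -> side_ok y ->
  0 <= side_moment 0 y - side_moment 0 x - s * (y - x) * side_moment 1 x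
    <= (s * (y - x)) ^+ 2 / 2 * side_moment 2 b.
Proof.
move=> okx oky.
have iy := integrable_side 0 oky; have ix := integrable_side 0 okx.
have ix1 := integrableZl_real (s * (y - x)) (integrable_side 1 okx).
have ib := integrableZl_real ((s * (y - x)) ^+ 2 / 2) (integrable_side 2 side_ok_b).
have iyx := integrableB_real iy ix.
have i := integrableB_real iyx ix1.
rewrite /side_moment -!meanZl//; last exact: integrable_side.
  rewrite -meanB// -meanB//.
  apply/andP; split.
    apply: mean_ge0 => t; case: (boolP (side (Z t))) => [sZ|_].
      by rewrite !mul1r; have /andP[] := stein_test_taylor s0 (okx _ sZ) (oky _ sZ).
    by rewrite !mul0r mulr0 !subrr.
  apply: le_mean => // t; case: (boolP (side (Z t))) => [sZ|_].
    by rewrite !mul1r; have /andP[] := stein_test_taylor s0 (okx _ sZ) (oky _ sZ).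
  by rewrite !mul0r !mulr0 !subrr.
by apply: integrable_side; exact: side_ok_b.
Qed.

Lemma side_increment x y : x <= y -> side_ok x -> side_ok y ->
  0 <= side_moment 1 y - side_moment 1 x <= s * (y - x) * side_moment 2 b.
Proof.
move=> xy okx oky.
have iy := integrable_side 1 oky; have ix := integrable_side 1 okx.
have ib := integrableZl_real (s * (y - x)) (integrable_side 2 side_ok_b).
have iyx := integrableB_real iy ix.
rewrite /side_moment -!meanZl//; last by apply: integrable_side; exact: side_ok_b.
rewrite -meanB//; apply/andP; split.
  apply: mean_ge0 => t; case: (boolP (side (Z t))) => [sZ|_].
    by rewrite !mul1r; have /andP[] := stein_test_increment s0 xy (okx _ sZ) (oky _ sZ).
  by rewrite !mul0r !subrr.
apply: le_mean => // t; case: (boolP (side (Z t))) => [sZ|_].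
  by rewrite !mul1r; have /andP[] := stein_test_increment s0 xy (okx _ sZ) (oky _ sZ).
by rewrite !mul0r !mulr0 !subrr.
Qed.

(** On a side 1 - Z / b has the constant sign [eps]; the quadratic form
    E[eps (1 - Z / b) (l - (1 - Z / b))^2] in l is nonnegative. *)
Lemma side_cauchy_schwarz (eps : R) : eps ^+ 2 = 1 ->
  (forall z, side z -> 0 <= eps * (1 - z / b)) ->
  side_moment 2 b ^+ 2 <= side_moment 1 b * side_moment 3 b.
Proof.
move=> eps1 sgn.
have i1 := integrable_side 1 side_ok_b.
have i2 := integrable_side 2 side_ok_b.
have i3 := integrable_side 3 side_ok_b.
have quad l : 0 <= eps * (l ^+ 2 * side_moment 1 b - 2 * l * side_moment 2 b + side_moment 3 b).
  have j1 := integrableZl_real (l ^+ 2) i1.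
  have j2 := integrableZl_real (2 * l) i2.
  have j12 := integrableB_real j1 j2.
  have j := integrableD_real j12 i3.
  rewrite /side_moment -!meanZl// -meanB// -meanD// -meanZl//.
  apply: mean_ge0 => t; rewrite /stein_test subrr mulr0 mul0r expR0.
  case: (boolP (side (Z t))) => [sZ|_]; last by rewrite !mul0r !mulr0 subrr addr0 mulr0.
  have := sgn _ sZ; set v := 1 - _ => h.
  have -> : eps * (l ^+ 2 * (1 * (v ^+ 1 * 1)) - 2 * l * (1 * (v ^+ 2 * 1)) + 1 * (v ^+ 3 * 1)) = eps * v * (l - v) ^+ 2 by ring.
  by rewrite mulr_ge0// sqr_ge0.
have m1 : 0 <= eps * side_moment 1 b.
  rewrite /side_moment -meanZl//; apply: mean_ge0 => t.
  rewrite /stein_test subrr mulr0 mul0r expR0 mulr1 expr1.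
  by case: (boolP (side (Z t))) => [sZ|_]; rewrite ?mul0r ?mulr0// mul1r sgn.
move: (side_moment 1 b) (side_moment 2 b) (side_moment 3 b) quad m1 => I1 I2 I3 quad m1.
have [I10|I10] := eqVneq I1 0.
  suff -> : I2 = 0 by rewrite I10 expr0n mul0r.
  apply/eqP/negPn/negP => I20.
  have e0 : eps != 0 by apply/eqP => e0; move/eqP: eps1; rewrite e0 expr0n eq_sym oner_eq0.
  have := quad ((eps * I3 + 1) / (2 * eps * I2)).
  have -> : eps * (((eps * I3 + 1) / (2 * eps * I2)) ^+ 2 * I1 -
    2 * ((eps * I3 + 1) / (2 * eps * I2)) * I2 + I3) = -1.
    by rewrite I10; field; rewrite I20 e0.
  by lra.
have := mulr_ge0 (quad (I2 / I1)) m1.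
have -> : eps * ((I2 / I1) ^+ 2 * I1 - 2 * (I2 / I1) * I2 + I3) * (eps * I1) =
  eps ^+ 2 * (I1 * I3 - I2 ^+ 2) by field.
by rewrite eps1 mul1r subr_ge0.
Qed.

End SteinSide.

(** * The Stein equation for squared excesses *)

Section Gluing.
Context {R : realType}.
Variables (f g : R -> R) (K b : R).

(** This and [taylor_bound] say that g is the derivative of f and that the
    second derivative is between 0 and K, in a form that passes to averages and
    glues along b. *)
Definition increment_bound (D : R -> Prop) : Prop :=
  forall x y, D x -> D y -> x <= y -> 0 <= g y - g x <= K * (y - x).

Definition taylor_bound (D : R -> Prop) : Prop :=
  forall x y, D x -> D y ->
    0 <= f y - f x - g x * (y - x) <= K / 2 * (y - x) ^+ 2.

Lemma increment_bound_glue : increment_bound (fun x => x <= b) ->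
  increment_bound (fun x => b <= x) -> increment_bound (fun=> True).
Proof.
move=> gl gr x y _ _ xy; have [xb|/ltW bx] := leP x b; last first.
  by apply: gr => //; exact: le_trans xy.
have [yb|/ltW yb] := leP y b; first exact: gl.
have /andP[h1 h2] := gl x b xb (lexx b) xb.
have /andP[h3 h4] := gr b y (lexx b) yb yb.
by apply/andP; split; lra.
Qed.

Lemma taylor_bound_glue :
  increment_bound (fun x => x <= b) -> increment_bound (fun x => b <= x) ->
  taylor_bound (fun x => x <= b) -> taylor_bound (fun x => b <= x) ->
  taylor_bound (fun=> True).
Proof.
move=> gl gr fl fr x y _ _.
have [xb|/ltW bx] := leP x b; have [yb|/ltW yb] := leP y b.
- exact: fl.
- have /andP[h1 h2] := fl x b xb (lexx b).
  have /andP[h3 h4] := fr b y (lexx b) yb.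
  have /andP[h5 h6] := gl x b xb (lexx b) xb.
  have /andP[e1 e2] : 0 <= (g b - g x) * (y - b) <= K * (b - x) * (y - b).
    by apply/andP; split; [apply: mulr_ge0|apply: ler_wpM2r]; rewrite // subr_ge0.
  by apply/andP; split; lra.
- have /andP[h1 h2] := fr x b bx (lexx b).
  have /andP[h3 h4] := fl b y (lexx b) yb.
  have /andP[h5 h6] := gr b x (lexx b) bx bx.
  have /andP[e1 e2] : 0 <= (g x - g b) * (b - y) <= K * (x - b) * (b - y).
    by apply/andP; split; [apply: mulr_ge0|apply: ler_wpM2r]; rewrite // subr_ge0.
  by apply/andP; split; lra.
- exact: fr.
Qed.

End Gluing.

Definition pos_sqr {R : realType} (b x : R) : R := Num.max 0 (x - b) ^+ 2 / 2.

Section GammaSolution.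
Context {R : realType} {d : measure_display} {T : measurableType d}.
Variables (Q : probability T R) (r s : R) (Z : {RV Q >-> R}).
Hypotheses (r0 : 0 < r) (s0 : 0 < s).
Hypothesis Zlaw : gamma_law Q r s Z.
Variable b : R.
Hypothesis b0 : 0 < b.
Local Notation theta := (stein_boundary r s b).

Definition below (z : R) : bool := 0 < z <= b.
Definition above (z : R) : bool := b < z.
Local Notation L := (side_moment s Z b below).
Local Notation J := (side_moment s Z b above).

Let mL : measurable_fun setT (fun t => (below (Z t))%:R : R).
Proof. exact: measurable_Z_itv. Qed.

Let mJ : measurable_fun setT (fun t => (above (Z t))%:R : R).
Proof. exact: measurable_Z_gt. Qed.

Let below_ge0 z : below z -> 0 <= z.
Proof. by move=> /andP[/ltW]. Qed.

Let above_ge0 z : above z -> 0 <= z.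
Proof. by move=> bz; rewrite ltW// (lt_trans b0). Qed.

Let below_var z : below z -> 0 <= 1 - z / b.
Proof. by move=> /andP[_ zb]; rewrite subr_ge0 ler_pdivrMr ?mul1r. Qed.

Let above_var z : above z -> 1 - z / b <= 0.
Proof. by move=> bz; rewrite subr_le0 ler_pdivlMr ?mul1r// ltW. Qed.

Let okL x : x <= b -> side_ok b below x.
Proof. by move=> xb z /below_var v0; rewrite mulr_le0_ge0// subr_le0. Qed.

Let okJ x : b <= x -> side_ok b above x.
Proof. by move=> xb z /above_var v0; rewrite mulr_ge0_le0// subr_ge0. Qed.

Lemma below_recursion x k : x <= b ->
  (r + k%:R - s * x) * L k x + s * x * L k.+1 x - k%:R * L k.-1 x
  = theta * (k == 0%N)%:R.
Proof.
move=> xb; apply: EFin_inj.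
rewrite -(side_recursion r0 s0 Zlaw b0 mL below_ge0 k (okL xb)).
exact: stein_left.
Qed.

Lemma above_recursion x k : b <= x ->
  (r + k%:R - s * x) * J k x + s * x * J k.+1 x - k%:R * J k.-1 x
  = - theta * (k == 0%N)%:R.
Proof.
move=> xb; apply: EFin_inj.
rewrite -(side_recursion r0 s0 Zlaw b0 mJ above_ge0 k (okJ xb)).
exact: stein_right.
Qed.

Lemma sides_total : L 0 b + J 0 b = 1.
Proof.
have i1 := integrable_side r0 s0 Zlaw b0 mL below_ge0 0 (okL (lexx b)).
have i2 := integrable_side r0 s0 Zlaw b0 mJ above_ge0 0 (okJ (lexx b)).
rewrite /side_moment -meanD//; apply: EFin_inj.
rewrite -integral_mean; last exact: integrableD_real.
transitivity (\int[Q]_t (1%R)%:E)%E; last by rewrite integral_prob_cst.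
apply: ae_eq_integral => //.
- apply/measurable_EFinP; apply: measurable_funD; apply: measurable_funM => //;
  by apply: measurableT_comp => //; exact: measurable_stein_test.
apply: filterS (gamma_gt0_ae Zlaw) => t Zt _; congr EFin.
rewrite /stein_test subrr mulr0 mul0r expR0 expr0 !mulr1 /below /above Zt/=.
by case: (leP (Z t) b) => _; rewrite ?addr0 ?add0r.
Qed.

Lemma below_moment_ge0 k x : 0 <= L k x.
Proof.
apply: mean_ge0 => t; case: (boolP (below (Z t))) => [/below_var v0|_]; last by rewrite mul0r.
by rewrite mul1r mulr_ge0 ?expR_ge0// exprn_ge0.
Qed.

Lemma above_moment1_le0 x : b <= x -> J 1 x <= 0.
Proof.
move=> bx; have i := integrable_side r0 s0 Zlaw b0 mJ above_ge0 1 (okJ bx).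
rewrite -(mean_cst Q 0); apply: le_mean => //.
  exact: finite_measure_integrable_cst.
move=> t; case: (boolP (above (Z t))) => [/above_var v0|_]; last by rewrite mul0r.
by rewrite mul1r /stein_test expr1 mulr_le0_ge0 ?expR_ge0.
Qed.

Lemma above_moment2_ge0 : 0 <= J 2 b.
Proof.
by apply: mean_ge0 => t; rewrite mulr_ge0// mulr_ge0 ?expR_ge0 ?sqr_ge0.
Qed.

Lemma below_moment_le : L 2 b <= L 1 b.
Proof.
apply: le_mean.
- exact: (integrable_side r0 s0 Zlaw b0 mL below_ge0 2 (okL (lexx b))).
- exact: (integrable_side r0 s0 Zlaw b0 mL below_ge0 1 (okL (lexx b))).
move=> t; case: (boolP (below (Z t))) => [zb|_]; last by rewrite !mul0r.
rewrite !mul1r /stein_test ler_wpM2r ?expR_ge0// expr1 expr2.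
have v0 := below_var zb; rewrite ler_piMl// lerBlDr lerDl.
by rewrite divr_ge0 ?(ltW b0)// below_ge0.
Qed.

(** The Wronskian at b of the two solutions [L 0] and [J 0] of the homogeneous
    equation, up to a constant factor. *)
Definition wronskian : R := L 1 b * J 2 b - J 1 b * L 2 b.
Local Notation w0 := wronskian.
Local Notation y := (s * b)%R (only parsing).

(** The recursions for k = 0 and k = 1 on both sides, with the total mass 1,
    form a linear system for the moments of order at most 2. *)
Lemma wronskian_boundary : (theta = y ^+ 2 * w0) /\ y ^+ 2 * (L 2 b + J 2 b) = (y - r) ^+ 2 + r.
Proof.
have /= := below_recursion 0 (lexx b); have /= := below_recursion 1 (lexx b).
have /= := above_recursion 0 (lexx b); have /= := above_recursion 1 (lexx b).
have := sides_total; rewrite /wronskian.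
move: (L 0 b) (L 1 b) (L 2 b) (J 0 b) (J 1 b) (J 2 b) => A0 A1 A2 B0 B1 B2.
rewrite !mulr0 !mul0r !addr0 !subr0 !mulr1 !mul1r => h e1 e2 e3 e4.
have p0 : (y - r) ^+ 2 + r != 0.
  by rewrite lt0r_neq0// ltr_wpDl// sqr_ge0.
have a0 : A0 = (r + 1 - y) * A1 + y * A2 by lra.
have b0' : B0 = (r + 1 - y) * B1 + y * B2 by lra.
rewrite a0 in e4 h; rewrite b0' in e2 h.
set p := (y - r) ^+ 2 + r in p0 *.
have u1 : p * (A1 + B1) = (y - r) * y * (A2 + B2).
  suff : p * (A1 + B1) - (y - r) * y * (A2 + B2) = 0 by lra.
  transitivity (((r - y) * ((r + 1 - y) * A1 + y * A2) + y * A1)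
    + ((r - y) * ((r + 1 - y) * B1 + y * B2) + y * B1)).
    by rewrite /p; ring.
  by rewrite e4 e2; ring.
have u2 : p = y ^+ 2 * (A2 + B2).
  transitivity (p * ((r + 1 - y) * A1 + y * A2 + ((r + 1 - y) * B1 + y * B2))).
    by rewrite h mulr1.
  transitivity ((r + 1 - y) * (p * (A1 + B1)) + y * p * (A2 + B2)); first by ring.
  by rewrite u1 /p; ring.
split; last by [].
apply: (mulfI p0).
transitivity (y ^+ 2 * ((A2 + B2) * theta)); first by rewrite {1}u2; ring.
transitivity (y ^+ 2 * (B2 * theta - A2 * (- theta))); first by ring.
by rewrite -e2 -e4 /p; ring.
Qed.

Lemma wronskian_gt0 : 0 < w0.
Proof.
have [h _] := wronskian_boundary; have := stein_boundary_gt0 Zlaw b0.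
by rewrite h pmulr_rgt0// exprn_gt0// mulr_gt0.
Qed.

(** If s b <= r + 2 the recursion for k = 2 below b, Cauchy-Schwarz and
    [below_moment_le] give (r + 2) (L 2)^2 <= 2 (L 1)^2; otherwise the same recursion
    above b gives (r + 2) (J 2)^2 <= 2 (J 1)^2.  Both products in the Wronskian are
    nonnegative, so one of them suffices. *)
Lemma second_moments_le : (L 2 b * J 2 b) ^+ 2 * (r + 2) <= 2 * w0 ^+ 2.
Proof.
have /= eL := below_recursion 2 (lexx b); have /= eJ := above_recursion 2 (lexx b).
have csL := side_cauchy_schwarz r0 s0 Zlaw b0 mL below_ge0 (expr1n _ 2)
  (fun z h => eq_ind_r (fun u => 0 <= u) (below_var h) (mul1r _)).
have csJ : J 2 b ^+ 2 <= J 1 b * J 3 b.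
  apply: (side_cauchy_schwarz r0 s0 Zlaw b0 mJ above_ge0 (eps := -1)).
    by rewrite sqrrN expr1n.
  by move=> z h; rewrite mulN1r oppr_ge0 above_var.
have L1 := below_moment_ge0 1 b; have L2 := below_moment_ge0 2 b.
have J1 := above_moment1_le0 (lexx b); have J2 := above_moment2_ge0.
have L21 := below_moment_le.
have y0 : 0 < y by rewrite mulr_gt0.
rewrite /wronskian; move: (L 1 b) (L 2 b) (L 3 b) (J 1 b) (J 2 b) (J 3 b) eL eJ csL csJ L1 L2 J1 J2 L21 => A1 A2 A3 B1 B2 B3.
rewrite !mulr0 => eL eJ csL csJ L1 L2 J1 J2 L21.
have c1 : 0 <= A1 * B2 by exact: mulr_ge0.
have c2 : 0 <= - (B1 * A2) by rewrite oppr_ge0 mulr_le0_ge0.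
have [yk|yk] := leP y (r + 2).
  have h : (r + 2) * A2 ^+ 2 <= 2 * A1 ^+ 2.
    have -> : 2 * A1 ^+ 2 = (r + 2 - y) * (A2 * A1) + y * (A1 * A3).
      have e : 2 * A1 = (r + 2 - y) * A2 + y * A3 by lra.
      by transitivity (A1 * (2 * A1)); [ring|rewrite e; ring].
    have k1 : (r + 2 - y) * A2 ^+ 2 <= (r + 2 - y) * (A2 * A1).
      by rewrite ler_wpM2l ?subr_ge0// expr2 ler_wpM2l.
    have k2 : y * A2 ^+ 2 <= y * (A1 * A3) by rewrite ler_wpM2l// ltW.
    by lra.
  apply: (@le_trans _ _ (2 * (A1 * B2) ^+ 2)).
    have := ler_wpM2r (sqr_ge0 B2) h; rewrite !exprMn; lra.
  rewrite ler_wpM2l//; apply: lerXn2r; rewrite ?nnegrE//; lra.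
have h : (r + 2) * B2 ^+ 2 <= 2 * B1 ^+ 2.
  have -> : 2 * B1 ^+ 2 = (y - (r + 2)) * (- B1 * B2) + y * (B1 * B3).
    have e : 2 * B1 = (r + 2 - y) * B2 + y * B3 by lra.
    by transitivity (B1 * (2 * B1)); [ring|rewrite e; ring].
  have k1 : 0 <= (y - (r + 2)) * (- B1 * B2).
    by rewrite mulr_ge0 ?subr_ge0 ?(ltW yk)// mulr_ge0// oppr_ge0.
  have k2 : y * B2 ^+ 2 <= y * (B1 * B3) by rewrite ler_wpM2l// ltW.
  have k3 : (r + 2) * B2 ^+ 2 <= y * B2 ^+ 2 by rewrite ler_wpM2r ?sqr_ge0// ltW.
  by lra.
apply: (@le_trans _ _ (2 * (- (B1 * A2)) ^+ 2)).
  have := ler_wpM2r (sqr_ge0 A2) h; rewrite sqrrN !exprMn; lra.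
rewrite ler_wpM2l//; apply: lerXn2r; rewrite ?nnegrE//; lra.
Qed.

(** The second derivative of the solution at b, where it is largest. *)
Definition stein_curvature : R := s * (L 2 b * J 2 b) / (2 * w0).
Local Notation K := stein_curvature.

Lemma stein_curvature_bound : 0 <= K <= s / 2 * Num.sqrt (2 / (r + 2)).
Proof.
have w_gt0 := wronskian_gt0.
have LJ : 0 <= L 2 b * J 2 b by rewrite mulr_ge0 ?below_moment_ge0 ?above_moment2_ge0.
apply/andP; split; first by rewrite divr_ge0// mulr_ge0// ltW.
rewrite /K ler_pdivrMr ?mulr_gt0//.
have -> : s / 2 * Num.sqrt (2 / (r + 2)) * (2 * w0) = s * (Num.sqrt (2 / (r + 2)) * w0) by field.
rewrite ler_wpM2l ?(ltW s0)//.
rewrite -[leLHS]ger0_norm// -sqrtr_sqr -[X in _ <= _ * X](ger0_norm (ltW w_gt0)) -sqrtr_sqr.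
have k0 : 0 < r + 2 by have := r0; lra.
rewrite -sqrtrM ?divr_ge0 ?(ltW k0)// ler_wsqrtr//.
rewrite mulrAC ler_pdivlMr//; exact: second_moments_le.
Qed.

(** A multiple of the solution [L 0] that is regular at 0, and a particular
    solution plus a multiple of the solution [J 0] that is regular at infinity;
    the multiples are the ones for which f and g are continuous at b. *)
Definition stein_sol (x : R) : R :=
  if x <= b then J 2 b * L 0 x / (2 * s * w0)
  else x / 2 - b + (r + 1) / (2 * s) + L 2 b * J 0 x / (2 * s * w0).

Definition stein_sol_deriv (x : R) : R :=
  if x <= b then J 2 b * L 1 x / (2 * w0) else 1 / 2 + L 2 b * J 1 x / (2 * w0).
Local Notation f := stein_sol.
Local Notation g := stein_sol_deriv.

(** At b this is the recursion for k = 1, which expresses [L 0] and [J 0] with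
    the same coefficients in terms of the moments of order 1 and 2. *)
Lemma stein_sol_above x : b <= x ->
  f x = x / 2 - b + (r + 1) / (2 * s) + L 2 b * J 0 x / (2 * s * w0).
Proof.
rewrite le_eqVlt /f => /predU1P[<-|]; last by rewrite ltNge => /negbTE ->.
rewrite lexx; have w_gt0 := wronskian_gt0; have sn := lt0r_neq0 s0.
have wn := lt0r_neq0 w_gt0; move: wn.
have /= := below_recursion 1 (lexx b); have /= := above_recursion 1 (lexx b).
rewrite /wronskian.
move: (L 0 b) (L 1 b) (L 2 b) (J 0 b) (J 1 b) (J 2 b) => A0 A1 A2 B0 B1 B2 eJ eL wn.
have -> : A0 = (r + 1 - y) * A1 + y * A2 by lra.
have -> : B0 = (r + 1 - y) * B1 + y * B2 by lra.
by field; rewrite wn sn.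
Qed.

Lemma stein_sol_deriv_above x : b <= x ->
  g x = 1 / 2 + L 2 b * J 1 x / (2 * w0).
Proof.
rewrite le_eqVlt /g => /predU1P[<-|]; last by rewrite ltNge => /negbTE ->.
rewrite lexx; have wn := lt0r_neq0 wronskian_gt0; move: wn; rewrite /wronskian => wn.
by field.
Qed.

Lemma stein_sol_increment : increment_bound g K (fun=> True).
Proof.
have w_gt0 := wronskian_gt0; have wn := lt0r_neq0 w_gt0.
have J2 := above_moment2_ge0; have L2 := below_moment_ge0 2 b.
have iw : 0 <= (2 * w0)^-1 by rewrite invr_ge0 mulr_ge0// ltW.
apply: (@increment_bound_glue _ _ _ b) => x x' xb xb' xx.
  have := side_increment r0 s0 Zlaw b0 mL below_ge0 xx (okL xb) (okL xb').
  rewrite /g xb xb' /K => /andP[h1 h2].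
  have a0 : 0 <= J 2 b * (2 * w0)^-1 by rewrite mulr_ge0.
  have := mulr_ge0 a0 h1; have := ler_wpM2l a0 h2.
  by move=> k1 k2; apply/andP; split; lra.
have := side_increment r0 s0 Zlaw b0 mJ above_ge0 xx (okJ xb) (okJ xb').
rewrite !stein_sol_deriv_above// /K => /andP[h1 h2].
have a0 : 0 <= L 2 b * (2 * w0)^-1 by rewrite mulr_ge0.
have := mulr_ge0 a0 h1; have := ler_wpM2l a0 h2.
by move=> k1 k2; apply/andP; split; lra.
Qed.

Lemma stein_sol_taylor : taylor_bound f g K (fun=> True).
Proof.
have w_gt0 := wronskian_gt0; have wn := lt0r_neq0 w_gt0; have sn := lt0r_neq0 s0.
have J2 := above_moment2_ge0; have L2 := below_moment_ge0 2 b.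
have iw : 0 <= (2 * s * w0)^-1 by rewrite invr_ge0 mulr_ge0 ?mulr_ge0 ?(ltW s0) ?(ltW w_gt0).
apply: (@taylor_bound_glue _ _ _ _ b).
- by move=> x x' _ _; exact: stein_sol_increment.
- by move=> x x' _ _; exact: stein_sol_increment.
- move=> x x' xb xb'.
  have := side_taylor r0 s0 Zlaw b0 mL below_ge0 (okL xb) (okL xb').
  rewrite /f /g xb xb' /K => /andP[h1 h2].
  have a0 : 0 <= J 2 b * (2 * s * w0)^-1 by rewrite mulr_ge0.
  have k1 := mulr_ge0 a0 h1; have k2 := ler_wpM2l a0 h2.
  have -> : J 2 b * L 0 x' / (2 * s * w0) - J 2 b * L 0 x / (2 * s * w0) - J 2 b * L 1 x / (2 * w0) * (x' - x) =
    J 2 b / (2 * s * w0) * (L 0 x' - L 0 x - s * (x' - x) * L 1 x) by field; rewrite sn wn.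
  have -> : s * (L 2 b * J 2 b) / (2 * w0) / 2 * (x' - x) ^+ 2 =
    J 2 b / (2 * s * w0) * ((s * (x' - x)) ^+ 2 / 2 * L 2 b) by field; rewrite sn wn.
  by rewrite k1.
move=> x x' xb xb'.
have := side_taylor r0 s0 Zlaw b0 mJ above_ge0 (okJ xb) (okJ xb').
rewrite !stein_sol_above// stein_sol_deriv_above// /K => /andP[h1 h2].
have a0 : 0 <= L 2 b * (2 * s * w0)^-1 by rewrite mulr_ge0.
have k1 := mulr_ge0 a0 h1; have k2 := ler_wpM2l a0 h2.
set u := (X in 0 <= X <= _).
have -> : u = L 2 b / (2 * s * w0) * (J 0 x' - J 0 x - s * (x' - x) * J 1 x).
  by rewrite /u; field; rewrite sn wn.
have -> : s * (L 2 b * J 2 b) / (2 * w0) / 2 * (x' - x) ^+ 2 =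
  L 2 b / (2 * s * w0) * ((s * (x' - x)) ^+ 2 / 2 * J 2 b) by field; rewrite sn wn.
by rewrite k1.
Qed.

Lemma stein_sol_deriv_itv x : 0 <= g x <= 1 / 2.
Proof.
have w_gt0 := wronskian_gt0.
have iw : 0 <= (2 * w0)^-1 by rewrite invr_ge0 mulr_ge0// ltW.
have gL z : z <= b -> 0 <= g z.
  by move=> zb; rewrite /g zb mulr_ge0// mulr_ge0 ?above_moment2_ge0 ?below_moment_ge0.
have gJ z : b <= z -> g z <= 1 / 2.
  move=> bz; rewrite stein_sol_deriv_above// gerDl mulr_le0_ge0//.
  by rewrite mulr_ge0_le0 ?below_moment_ge0 ?above_moment1_le0.
have mono z z' : z <= z' -> g z <= g z'.
  by move=> zz; have /andP[+ _] := stein_sol_increment I I zz; rewrite subr_ge0.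
have [xb|/ltW bx] := leP x b.
  by rewrite gL// (le_trans (mono _ _ xb))// gJ.
by rewrite gJ// andbT (le_trans (gL _ (lexx b)))// mono.
Qed.

Lemma stein_sol_ge0 x : 0 <= f x.
Proof.
have w_gt0 := wronskian_gt0.
have iw : 0 <= (2 * s * w0)^-1 by rewrite invr_ge0 mulr_ge0 ?mulr_ge0 ?(ltW s0) ?(ltW w_gt0).
have fL z : z <= b -> 0 <= f z.
  by move=> zb; rewrite /f zb mulr_ge0// mulr_ge0 ?above_moment2_ge0 ?below_moment_ge0.
have [xb|/ltW bx] := leP x b; first exact: fL.
have /andP[+ _] := stein_sol_taylor (x := b) (y := x) I I.
have /andP[g0 _] := stein_sol_deriv_itv b.
have h : 0 <= g b * (x - b) by rewrite mulr_ge0// subr_ge0.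
have := fL _ (lexx b); lra.
Qed.

(** On each side the recursion for k = 0 is the homogeneous equation, with the
    boundary term as right-hand side; [wronskian_boundary] identifies the two
    constants. *)
Lemma stein_sol_equation x : 0 <= x ->
  pos_sqr b x + x / s * g x + r / s * f x = b ^+ 2 * J 2 b / 2 + x * f x.
Proof.
move=> x0; rewrite /pos_sqr; have wn := lt0r_neq0 wronskian_gt0; have sn := lt0r_neq0 s0.
have [h1 h2] := wronskian_boundary.
have [xb|/ltW bx] := leP x b.
  have e : Num.max 0 (x - b) = 0 by apply/max_idPl; rewrite subr_le0.
  have := below_recursion 0 xb; rewrite /= !mul0r subr0 addr0 mulr1 h1 /f /g xb e.
  move: (L 0 x) (L 1 x) (J 2 b) => A0 A1 B2 eL.
  have eA : r * A0 - s * x * A0 + s * x * A1 = y ^+ 2 * w0 by lra.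
  apply/eqP; rewrite -subr_eq0; apply/eqP.
  transitivity (B2 / (2 * s ^+ 2 * w0) * (r * A0 - s * x * A0 + s * x * A1 - y ^+ 2 * w0)).
    by field; rewrite sn wn.
  by rewrite eA subrr mulr0.
have e : Num.max 0 (x - b) = x - b by apply/max_idPr; rewrite subr_ge0.
have := above_recursion 0 bx; rewrite /= !mul0r subr0 addr0 mulr1 h1 stein_sol_above// stein_sol_deriv_above// e.
move: h2; move: (L 2 b) (J 0 x) (J 1 x) (J 2 b) => A2 B0 B1 B2 h2 eJ.
have eA : r * B0 - s * x * B0 + s * x * B1 = - (y ^+ 2 * w0) by lra.
apply/eqP; rewrite -subr_eq0; apply/eqP.
transitivity (A2 / (2 * s ^+ 2 * w0) * (r * B0 - s * x * B0 + s * x * B1 + y ^+ 2 * w0)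
  + ((y - r) ^+ 2 + r - y ^+ 2 * (A2 + B2)) / (2 * s ^+ 2)).
  by field; rewrite sn wn.
by rewrite eA h2 addNr subrr mulr0 mul0r addr0.
Qed.

Lemma integral_square_excess :
  (\int[Q]_t (pos_sqr b (Z t))%:E = (b ^+ 2 * J 2 b / 2)%:E)%E.
Proof.
have i := integrable_side r0 s0 Zlaw b0 mJ above_ge0 2 (okJ (lexx b)).
have -> : b ^+ 2 * J 2 b / 2 = b ^+ 2 / 2 * J 2 b by ring.
rewrite /side_moment -meanZl// -integral_mean; last exact: integrableZl_real.
apply: eq_integral => t _; congr EFin.
rewrite /pos_sqr /stein_test subrr mulr0 mul0r expR0 mulr1 /above.
have [Zb|Zb] := leP (Z t) b.
  have -> : Num.max 0 (Z t - b) = 0 by apply/max_idPl; rewrite subr_le0.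
  by rewrite expr0n !mul0r mulr0.
have -> : Num.max 0 (Z t - b) = Z t - b by apply/max_idPr; rewrite subr_ge0 ltW.
have bn := lt0r_neq0 b0; by rewrite mul1r; field.
Qed.

End GammaSolution.

Lemma gamma_stein_solution (R : realType) (d : measure_display) (T : measurableType d)
  (Q : probability T R) (r s : R) (Z : {RV Q >-> R}) (b : R) :
  0 < r -> 0 < s -> gamma_law Q r s Z -> 0 < b ->
  exists f g : R -> R, exists K c : R,
  [/\ taylor_bound f g K (fun=> True), increment_bound g K (fun=> True),
    forall x, 0 <= f x /\ 0 <= g x <= 1 / 2,
    forall x, 0 <= x -> pos_sqr b x + x / s * g x + r / s * f x = c + x * f x &
    (\int[Q]_t (pos_sqr b (Z t))%:E = c%:E)%E /\
    0 <= K <= s / 2 * Num.sqrt (2 / (r + 2))].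
Proof.
move=> r0 s0 Zlaw b0.
exists (stein_sol r s Z b), (stein_sol_deriv s Z b), (stein_curvature s Z b).
exists (b ^+ 2 * side_moment s Z b (above b) 2 b / 2); split.
- exact: (stein_sol_taylor r0 s0 Zlaw b0).
- exact: (stein_sol_increment r0 s0 Zlaw b0).
- by move=> x; split; [exact: (stein_sol_ge0 r0 s0 Zlaw b0)|exact: (stein_sol_deriv_itv r0 s0 Zlaw b0)].
- exact: (stein_sol_equation r0 s0 Zlaw b0).
split; [exact: (integral_square_excess r0 s0)|exact: (stein_curvature_bound r0 s0 Zlaw b0)].
Qed.

(** * The compound Poisson law *)

Section ConvolutionSizeBias.
Context {R : realType} {d : measure_display} {T : measurableType d}.
Variables (P : probability T R) (X : {RV P >-> R}).
Hypothesis X0 : forall w, 0 <= X w.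

Definition weighted_smear (f : R -> \bar R) (y : R) : \bar R :=
  (\int[P]_w ((X w)%:E * f (y + X w)%R))%E.

Lemma weighted_smear_ge0 f y : (forall x, 0 <= f x)%E -> (0 <= weighted_smear f y)%E.
Proof. by move=> f0; apply: integral_ge0 => w _; rewrite mule_ge0// lee_fin. Qed.

Lemma measurable_weighted_smear f : measurable_fun setT f ->
  (forall x, 0 <= f x)%E -> measurable_fun setT (weighted_smear f).
Proof.
move=> mf f0.
apply: (@measurable_fun_fubini_tonelli_F _ _ _ _ _ P
  (fun p : R * T => (X p.2)%:E * f (p.1 + X p.2)%R)%E).
  apply: emeasurable_funM.
    apply/measurable_EFinP; apply: measurableT_comp => //; exact: measurable_funPT.
  exact: (measurableT_comp mf (measurable_add_sample X)).
by move=> p; rewrite mule_ge0// lee_fin.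
Qed.

(** By symmetry each summand contributes equally to |x| = x_1 + ... + x_n.  The
    induction peels off one summand and uses Tonelli's theorem to exchange it with
    the weighted one. *)
Lemma integral_convpow_size_bias n (f : R -> \bar R) : measurable_fun setT f ->
  (forall x, 0 <= f x)%E ->
  (\int[convpow X n]_x (`|x|%:E * f x) =
   n%:R%:E * \int[convpow X n.-1]_y weighted_smear f y)%E.
Proof.
move=> + +; elim: n f => [|n IH] f mf f0.
  rewrite ge0_integral_convpow0 ?normr0 ?mul0e//.
  by apply: emeasurable_funM => //; apply/measurable_EFinP.
have mxf : measurable_fun setT (fun x : R => `|x|%:E * f x)%E.
  by apply: emeasurable_funM => //; apply/measurable_EFinP.
have mX : measurable_fun setT (EFin \o X) by apply/measurable_EFinP; exact: measurable_funPT.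
have fX y : measurable_fun setT (fun w => f (y + X w)%R).
  by apply: (measurableT_comp mf); exact: measurable_funD.
rewrite ge0_integral_convpowS//; last by move=> x; rewrite mule_ge0// lee_fin.
pose h y := (\int[P]_w f (y + X w)%R)%E.
have mh : measurable_fun setT h by exact: measurable_smear.
have h0 y : (0 <= h y)%E by apply: integral_ge0.
have mw := measurable_weighted_smear mf f0.
have msm : measurable_fun setT (fun y : R => \int[P]_w (`|y + X w|%:E * f (y + X w)%R))%E.
  by apply: (@measurable_smear _ _ _ _ X (fun x : R => `|x|%:E * f x)%E) => // x; rewrite mule_ge0// lee_fin.
rewrite (@eq_integral_convpow _ _ _ _ _ X0 _ _ (fun y : R => `|y|%:E * h y + weighted_smear f y)%E)//; first last.
- move=> y y0; rewrite /h /weighted_smear -ge0_integralZl//.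
  rewrite -ge0_integralD//; first last.
  + exact: emeasurable_funM.
  + by move=> w _; rewrite mule_ge0// lee_fin.
  + exact: emeasurable_funM.
  + by move=> w _; rewrite mule_ge0// lee_fin.
  apply: eq_integral => w _; rewrite !ger0_norm ?addr_ge0// EFinD.
  by rewrite ge0_muleDl// lee_fin.
- apply: emeasurable_funD => //; apply: emeasurable_funM => //.
  by apply/measurable_EFinP.
rewrite ge0_integralD//; last 3 first.
- by move=> y _; rewrite mule_ge0// lee_fin.
- by apply: emeasurable_funM => //; apply/measurable_EFinP.
- by move=> y _; exact: weighted_smear_ge0.
rewrite IH//.
have step : (n%:R%:E * \int[convpow X n.-1]_y weighted_smear h y =
   n%:R%:E * \int[convpow X n]_y weighted_smear f y)%E.
  case: n {IH} => [|n]; first by rewrite !mul0e.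
  congr (_ * _)%E; rewrite [RHS]ge0_integral_convpowS//; last first.
    by move=> y; exact: weighted_smear_ge0.
  apply: eq_integral => y _; rewrite /weighted_smear /h.
  transitivity (\int[P]_w \int[P]_w' ((X w)%:E * f (y + X w + X w')%R))%E.
    by apply: eq_integral => w _; rewrite ge0_integralZl// lee_fin.
  pose F (p : T * T) : \bar R := ((X p.1)%:E * f (y + X p.1 + X p.2)%R)%E.
  have mF : measurable_fun setT F.
    apply: emeasurable_funM.
      by apply/measurable_EFinP; apply: measurableT_comp => //; exact: measurable_funPT.
    apply: (measurableT_comp mf); apply: measurable_funD.
      by apply: measurable_funD => //; apply: measurableT_comp => //; exact: measurable_funPT.
    by apply: measurableT_comp => //; exact: measurable_funPT.
  have F0 p : (0 <= F p)%E by rewrite mule_ge0// lee_fin.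
  have /= -> := @fubini_tonelli _ _ _ _ _ P P F mF F0.
  apply: eq_integral => w' _; apply: eq_integral => w _; rewrite /F/=.
  by congr (_ * f _)%E; ring.
rewrite step -[X in (_ + X)%E]mul1e -ge0_muleDl ?lee_fin//.
by rewrite -EFinD natr1.
Qed.

End ConvolutionSizeBias.

Section PoissonMoments.
Context {R : realType}.
Variable lambda : R.
Hypothesis lambda0 : 0 < lambda.

Lemma pois_avg1 : pois_avg lambda (fun=> 1%E) = 1%E.
Proof.
have : poisson_prob lambda 0 [set: nat] = 1%E.
  exact: (@probability_setT _ _ _ (poisson_prob lambda 0)).
rewrite /poisson_prob lambda0 -nneseries_esumT; last first.
  by move=> *; rewrite lee_fin poisson_pmf_ge0.
by move=> h; rewrite -[RHS]h; apply: eq_eseriesr => n _; rewrite mule1.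
Qed.

Lemma pois_avg_cst (c : R) : 0 <= c -> pois_avg lambda (fun=> c%:E) = c%:E.
Proof.
move=> c0; rewrite -[RHS]mule1 -pois_avg1 -pois_avgZl//.
by apply: eq_pois_avg => n; rewrite mule1.
Qed.

Lemma pois_avg_nat : pois_avg lambda (fun n => n%:R%:E) = lambda%:E.
Proof.
rewrite -[RHS]mule1 -pois_avg1 -(pois_avg_size_bias lambda0 (a := fun=> 1%E))//.
by apply: eq_pois_avg => n; rewrite mule1.
Qed.

Lemma pois_avg_succ : pois_avg lambda (fun n => n.+1%:R%:E) = (lambda + 1)%:E.
Proof.
rewrite EFinD -pois_avg_nat -[X in (_ + X)%E]pois_avg1 -pois_avgD//.
by apply: eq_pois_avg => n; rewrite -EFinD natr1.
Qed.

Lemma pois_avg_sqr : pois_avg lambda (fun n => (n%:R ^+ 2)%:E) = (lambda ^+ 2 + lambda)%:E.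
Proof.
have -> : lambda ^+ 2 + lambda = lambda * (lambda + 1) by ring.
by rewrite EFinM -pois_avg_succ -(pois_avg_size_bias lambda0 (a := fun n => n%:R%:E))//.
Qed.

Lemma pois_avg_succ_sqr :
  pois_avg lambda (fun n => (n.+1%:R ^+ 2)%:E) = (lambda ^+ 2 + 3 * lambda + 1)%:E.
Proof.
have -> : lambda ^+ 2 + 3 * lambda + 1 = lambda ^+ 2 + lambda + lambda + (lambda + 1) by ring.
rewrite 2!EFinD -pois_avg_sqr -[X in (_ + X + _)%E]pois_avg_nat -pois_avg_succ.
rewrite -!pois_avgD//; try by move=> n; rewrite -?EFinD lee_fin// addr_ge0// sqr_ge0.
by apply: eq_pois_avg => n; rewrite -!EFinD -!natr1; congr EFin; ring.
Qed.

End PoissonMoments.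

Section CompoundPoisson.
Context {R : realType} {d : measure_display} {T : measurableType d}.
Variables (P : probability T R) (lambda : R) (X : {RV P >-> R}).
Hypothesis lambda0 : 0 < lambda.

Definition cpois : set R -> \bar R :=
  mseries (fun n => mscale (NngNum (poisson_pmf_ge0 lambda n)) (convpow X n)) 0.

HB.instance Definition _ := Measure.on cpois.

Lemma ge0_integral_cpois (f : R -> \bar R) : measurable_fun setT f ->
  (forall x, 0 <= f x)%E ->
  (\int[cpois]_x f x = pois_avg lambda (fun n => \int[convpow X n]_x f x))%E.
Proof.
move=> mf f0; rewrite ge0_integral_measure_series//.
by apply: eq_eseriesr => n _; rewrite ge0_integral_mscale.
Qed.

Lemma cpois_setT : cpois setT = 1%E.
Proof.
have h : (\int[cpois]_x cst 1 x = 1 * cpois setT)%E by exact: integral_cst.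
rewrite -[LHS]mul1e -h ge0_integral_cpois// -[RHS](pois_avg1 lambda0).
by apply: eq_pois_avg => n; exact: integral_prob_cst.
Qed.

(** The law enters the sequel only through this formula. *)
Lemma compound_poisson_law : exists M : probability R R,
  forall f : R -> \bar R, measurable_fun setT f -> (forall x, 0 <= f x)%E ->
    (\int[M]_x f x = pois_avg lambda (fun n => \int[convpow X n]_x f x))%E.
Proof.
pose M : probability R R := HB.pack cpois (Measure_isProbability.Build _ _ _ cpois cpois_setT).
by exists M; exact: ge0_integral_cpois.
Qed.

End CompoundPoisson.

(** * Regularity of the Stein solution *)

Section QuadraticRemainder.
Context {R : realType}.

Lemma is_derive_quadratic_remainder (F : R -> R) (x D K : R) :
  (forall y, `|F y - F x - D * (y - x)| <= K * (y - x) ^+ 2) ->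
  is_derive x 1 F D.
Proof.
move=> FD.
have K0 : 0 <= K.
  have := FD (x + 1); have -> : x + 1 - x = 1 by ring.
  by rewrite expr1n !mulr1; apply: le_trans.
have lim : h^-1 *: ((F \o shift x) (h *: (1 : R)) - F x) @[h --> 0^'] --> D.
  apply/cvgrPdist_le => e e0; near=> h.
  have hn : h != 0 by near: h; exact: nbhs_dnbhs_neq.
  have hd : `|h| <= e / (K + 1).
    near: h; apply: dnbhs0_le; rewrite divr_gt0// ltr_wpDl//.
  have K1 : 0 < K + 1 by rewrite ltr_wpDl.
  have /= := FD (h + x); rewrite addrK => Fh.
  rewrite /= /GRing.scale/= mulr1.
  have -> : D - h^-1 * (F (h + x) - F x) = - (h^-1 * (F (h + x) - F x - D * h)).
    by field.
  rewrite normrN normrM normfV ler_pdivrMl ?normr_gt0//.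
  apply: (le_trans Fh); rewrite -[h ^+ 2]ger0_norm ?sqr_ge0// normrX.
  move: hd; rewrite ler_pdivlMr// => hd.
  by have := normr_ge0 h; nra.
have dF : derivable F x 1 by apply/cvg_ex; exists D.
by split => //; exact: cvg_lim.
Unshelve. all: by end_near. Qed.

Lemma maxr0P (x : R) : (x <= 0 /\ Num.max 0 x = 0) \/ (0 <= x /\ Num.max 0 x = x).
Proof.
by have [x0|x0] := leP x 0; [left|right]; split=> //; exact: ltW.
Qed.

Lemma is_derive_pos_sqr (b x : R) : is_derive x 1 (pos_sqr b) (Num.max 0 (x - b)).
Proof.
apply: (@is_derive_quadratic_remainder _ _ _ 1) => y; rewrite /pos_sqr.
have -> : y - x = (y - b) - (x - b) by ring.
move: (x - b) (y - b) => p q.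
have sp := sqr_ge0 p; have sq := sqr_ge0 q; have spq := sqr_ge0 (q - p).
have [[h1 ->]|[h1 ->]] := maxr0P p; have [[h2 ->]|[h2 ->]] := maxr0P q;
  rewrite ler_norml ?expr0n/=; apply/andP; split; nra.
Qed.

End QuadraticRemainder.

Section StableFunctions.
Context {R : realType}.
Variables (f g : R -> R) (K : R).
Hypothesis taylor : taylor_bound f g K (fun=> True).
Hypothesis increment : increment_bound g K (fun=> True).
Hypothesis g_itv : forall x, 0 <= g x <= 1 / 2.

Lemma taylor_lipschitz x y : `|f x - f y| <= 1 / 2 * `|x - y|.
Proof.
have /andP[h1 _] := taylor (x := x) (y := y) I I.
have /andP[h2 _] := taylor (x := y) (y := x) I I.
have /andP[gx0 gx] := g_itv x; have /andP[gy0 gy] := g_itv y.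
case: (leP y x) => xy.
  rewrite (ger0_norm (x := x - y)) ?subr_ge0// ler_norml; apply/andP; split; nra.
rewrite (ltr0_norm (x := x - y)) ?subr_lt0// ler_norml; apply/andP; split; nra.
Qed.

Lemma increment_le x y : x <= y -> g x <= g y.
Proof. by move=> xy; have /andP[+ _] := increment I I xy; rewrite subr_ge0. Qed.

Lemma taylor_le x y : x <= y -> f x <= f y.
Proof.
move=> xy; have /andP[h _] := taylor (x := x) (y := y) I I.
have /andP[g0 _] := g_itv x; have := mulr_ge0 g0 (y := y - x); rewrite subr_ge0 xy => /(_ isT).
lra.
Qed.

Lemma increment_abs x y : `|g x - g y| <= K * `|x - y|.
Proof.
have [xy|/ltW xy] := leP y x.
  by have /andP[h1 h2] := increment I I xy; rewrite !ger0_norm// subr_ge0.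
rewrite distrC (distrC x); have /andP[h1 h2] := increment I I xy.
by rewrite !ger0_norm// subr_ge0.
Qed.

Lemma measurable_sol : measurable_fun setT f.
Proof. by apply: nondecreasing_measurable => // x y; exact: taylor_le. Qed.

Lemma measurable_sol_deriv : measurable_fun setT g.
Proof. by apply: nondecreasing_measurable => // x y; exact: increment_le. Qed.

End StableFunctions.

(** * Size-biased and generalized-zero-biased versions *)

Section ClippedAbsoluteValue.
Context {R : realType}.
Implicit Types (c x y z : R).

Lemma lipschitz_of_bound (F : R -> R) (L : R) :
  (forall x y, `|F x - F y| <= L * `|x - y|) -> lipschitz F.
Proof.
move=> FL; apply: (@klipschitzW _ _ _ L).
  exact: (@globally_properfilter _ _ (0, 0)).
by move=> [x y] _ /=; exact: FL.
Qed.

(** Lipschitz test functions for the generalized-zero-biased law, whose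
    derivatives [clip_abs c] = min (|z|, c) increase to |z|. *)
Definition clip_primitive c z : R :=
  pos_sqr 0 z - pos_sqr c z - (pos_sqr 0 (- z) - pos_sqr c (- z)).

Definition clip_abs c z : R :=
  Num.max 0 z - Num.max 0 (z - c) + (Num.max 0 (- z) - Num.max 0 (- z - c)).

Lemma is_derive_clip_primitive c (z : R) :
  is_derive z 1 (clip_primitive c) (clip_abs c z).
Proof.
have d1 := is_derive_pos_sqr 0 z; have d2 := is_derive_pos_sqr c z.
have dN : is_derive z (1 : R) (fun x : R => - x) (-1).
  by apply: is_derive_eq; rewrite /GRing.scale/=; ring.
have d3 := @is_derive1_comp _ (pos_sqr 0) (fun x => - x) z _ _ (is_derive_pos_sqr 0 (- z)) dN.
have d4 := @is_derive1_comp _ (pos_sqr c) (fun x => - x) z _ _ (is_derive_pos_sqr c (- z)) dN.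
have := is_deriveB (is_deriveB d1 d2) (is_deriveB d3 d4).
by move=> h; apply: (is_derive_eq h); rewrite /clip_abs !subr0; ring.
Qed.

(** The derivative min (max (0, z), c) is between 0 and c. *)
Lemma ramp_increment c x y : 0 <= c -> x <= y ->
  0 <= (pos_sqr 0 y - pos_sqr c y) - (pos_sqr 0 x - pos_sqr c x) <= c * (y - x).
Proof.
move=> c0 xy; rewrite /pos_sqr !subr0.
have [[h1 ->]|[h1 ->]] := maxr0P x; have [[h2 ->]|[h2 ->]] := maxr0P y;
have [[h3 ->]|[h3 ->]] := maxr0P (x - c); have [[h4 ->]|[h4 ->]] := maxr0P (y - c);
  rewrite ?expr0n/=; apply/andP; split; nra.
Qed.

Lemma lipschitz_clip_primitive c : 0 <= c -> lipschitz (clip_primitive c).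
Proof.
move=> c0; apply: (@lipschitz_of_bound _ (2 * c)).
have mono x y : y <= x -> `|clip_primitive c x - clip_primitive c y| <= 2 * c * (x - y).
  move=> yx; have /andP[h1 h2] := ramp_increment c0 yx.
  have nyx : - x <= - y by rewrite lerN2.
  have /andP[h3 h4] := ramp_increment c0 nyx.
  by rewrite ler_norml /clip_primitive; apply/andP; split; lra.
move=> x y; have [yx|/ltW xy] := leP y x.
  by rewrite (ger0_norm (x := x - y)) ?subr_ge0// mono.
by rewrite distrC (distrC x) (ger0_norm (x := y - x)) ?subr_ge0// mono.
Qed.

Lemma clip_primitive_bound c x : 0 <= c -> 0 <= x ->
  0 <= clip_primitive c x - clip_primitive c 0 <= x ^+ 2 / 2.
Proof.
move=> c0 x0; rewrite /clip_primitive /pos_sqr !subr0 oppr0.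
have -> : Num.max 0 x = x by apply/max_idPr.
have -> : Num.max 0 (- x) = 0 by apply/max_idPl; rewrite oppr_le0.
have -> : Num.max 0 (- x - c) = 0 by apply/max_idPl; lra.
have -> : Num.max 0 (0 - c) = 0 by apply/max_idPl; lra.
rewrite maxxx expr0n/=.
by have [[h ->]|[h ->]] := maxr0P (x - c); rewrite ?expr0n/=; apply/andP; split; nra.
Qed.

Lemma clip_abs_ge0 c z : 0 <= c -> 0 <= clip_abs c z.
Proof.
move=> c0; rewrite /clip_abs.
have [[h1 ->]|[h1 ->]] := maxr0P z; have [[h2 ->]|[h2 ->]] := maxr0P (- z);
have [[h3 ->]|[h3 ->]] := maxr0P (z - c); have [[h4 ->]|[h4 ->]] := maxr0P (- z - c); lra.
Qed.

Lemma clip_abs_le c c' z : c <= c' -> clip_abs c z <= clip_abs c' z.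
Proof.
move=> cc; rewrite /clip_abs lerD// lerD2l lerN2.
  by rewrite ge_max !le_max lexx/=; apply/orP; right; lra.
by rewrite ge_max !le_max lexx/=; apply/orP; right; lra.
Qed.

Lemma clip_absE c z : `|z| <= c -> clip_abs c z = `|z|.
Proof.
rewrite ler_norml => /andP[h1 h2]; rewrite /clip_abs.
have -> : Num.max 0 (z - c) = 0 by apply/max_idPl; lra.
have -> : Num.max 0 (- z - c) = 0 by apply/max_idPl; lra.
have /orP[z0|z0] := le_total z 0.
  rewrite ler0_norm//; have -> : Num.max 0 z = 0 by apply/max_idPl.
  have -> : Num.max 0 (- z) = - z by apply/max_idPr; rewrite oppr_ge0.
  lra.
rewrite ger0_norm//; have -> : Num.max 0 z = z by apply/max_idPr.
have -> : Num.max 0 (- z) = 0 by apply/max_idPl; rewrite oppr_le0.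
lra.
Qed.

Lemma measurable_clip_abs c : measurable_fun setT (clip_abs c).
Proof.
have mm (h : R -> R) : measurable_fun setT h -> measurable_fun setT (fun z => Num.max 0 (h z)).
  by move=> mh; apply: measurable_maxr.
by apply: measurable_funD; apply: measurable_funB; apply: mm => //; apply: measurable_funB => //;
  exact: measurableT_comp.
Qed.

End ClippedAbsoluteValue.

Section BiasedVersions.
Context {R : realType} {d d' : measure_display} {T : measurableType d}
  {T' : measurableType d'}.
Variables (P : probability T R) (C : probability T' R).
Variables (X : {RV P >-> R}) (Xs Xgz : {RV C >-> R}).
Hypothesis X0 : forall w, 0 <= X w.
Hypothesis m1_gt0 : 0 < mean P X.
Hypothesis X3 : P.-integrable setT (EFin \o (fun w => X w ^+ 3)).
Hypothesis Xs_law : size_biased P C X Xs.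
Hypothesis Xgz_law : gen_zero_biased P C X Xgz.
Local Notation m1 := (mean P X).
Local Notation m2 := (mean P (fun w => X w ^+ 2)).
Local Notation m3 := (mean P (fun w => X w ^+ 3)).

Lemma integrable_power n : (n <= 3)%N -> P.-integrable setT (EFin \o (fun w => X w ^+ n)).
Proof.
move=> n3; apply: (@integrable_dominated _ _ _ P _ (fun w => 1 + X w ^+ 3)).
- by apply: measurable_funX; exact: measurable_funPT.
- move=> w; rewrite ger0_norm ?exprn_ge0//.
  have [x1|/ltW x1] := leP (X w) 1.
    by apply: (le_trans (exprn_ile1 _ _ _)) => //; rewrite lerDl exprn_ge0.
  by apply: (le_trans (ler_weXn2l x1 n3)); rewrite lerDr.
by apply: integrableD_real => //; exact: finite_measure_integrable_cst.
Qed.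

Lemma integrable_base : P.-integrable setT (EFin \o X).
Proof. exact: (integrable_power (n := 1)). Qed.

(** The variance is nonnegative. *)
Lemma sqr_mean_le : m1 ^+ 2 <= m2.
Proof.
have i1 := integrable_base; have i2 := integrable_power (n := 2) isT.
have ic : P.-integrable setT (EFin \o (fun=> m1 ^+ 2)) by exact: finite_measure_integrable_cst.
have j1 := integrableZl_real (2 * m1) i1.
have j2 := integrableB_real i2 j1.
rewrite -subr_ge0; have -> : m2 - m1 ^+ 2 = mean P (fun w => X w ^+ 2 - 2 * m1 * X w + m1 ^+ 2).
  by rewrite meanD// meanB// meanZl// mean_cst; ring.
apply: mean_ge0 => w; have := sqr_ge0 (X w - m1); lra.
Qed.

Lemma m2_gt0 : 0 < m2.
Proof. by apply: (lt_le_trans _ sqr_mean_le); rewrite exprn_gt0. Qed.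

Lemma integral_size_biased (h : R -> R) : measurable_fun setT h ->
  P.-integrable setT (EFin \o (fun w => X w * h (X w))) ->
  (\int[C]_w (h (Xs w))%:E = (mean P (fun w => X w * h (X w)) / m1)%:E)%E.
Proof. by move=> mh ih; rewrite -expectationE; exact: Xs_law. Qed.

Lemma integral_gen_zero_biased (F h : R -> R) : (forall x : R, is_derive x 1 F (h x)) ->
  lipschitz F -> P.-integrable setT (EFin \o (fun w => X w * (F (X w) - F 0))) ->
  (\int[C]_w (h (Xgz w))%:E = (mean P (fun w => X w * (F (X w) - F 0)) / m2)%:E)%E.
Proof.
move=> dF lF iF; rewrite -Xgz_law// expectationE; apply: eq_integral => w _ /=.
by rewrite derive1E; have := dF (Xgz w) => ?; rewrite derive_val.
Qed.

Lemma integral_abs_size_biased : (\int[C]_w (`|Xs w|)%:E = (m2 / m1)%:E)%E.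
Proof.
have E w : X w * `|X w| = X w ^+ 2 by rewrite ger0_norm.
rewrite (integral_size_biased (h := fun x => `|x|))//.
  by congr (_ / _)%:E; congr (mean P _); apply/funext.
by rewrite (_ : (fun w => _) = (fun w => X w ^+ 2)); [exact: integrable_power|exact/funext].
Qed.

Lemma integrable_size_biased : C.-integrable setT (EFin \o Xs).
Proof.
apply/integrableP; split; first by apply/measurable_EFinP; exact: measurable_funPT.
by rewrite (eq_integral (fun w => (`|Xs w|)%:E))// integral_abs_size_biased ltry.
Qed.

Lemma integral_clip_gen_zero_biased c : 0 <= c ->
  (\int[C]_w (clip_abs c (Xgz w))%:E <= (m3 / (2 * m2))%:E)%E.
Proof.
move=> c0; have bound w := clip_primitive_bound c0 (X0 w).
have i3 := integrableZl_real 2^-1 X3.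
have mF : measurable_fun setT (clip_primitive c).
  apply: continuous_measurable_fun => x.
  apply/differentiable_continuous/derivable1_diffP.
  by have := is_derive_clip_primitive c x => ?; exact: ex_derive.
have le3 w : X w * (clip_primitive c (X w) - clip_primitive c 0) <= 2^-1 * X w ^+ 3.
  by have /andP[h1 h2] := bound w; have := ler_wpM2l (X0 w) h2; lra.
have iF : P.-integrable setT (EFin \o (fun w => X w * (clip_primitive c (X w) - clip_primitive c 0))).
  apply: (integrable_dominated _ _ i3).
    apply: measurable_funM; first exact: measurable_funPT.
    by apply: measurable_funB => //; apply: measurableT_comp => //; exact: measurable_funPT.
  move=> w; rewrite ger0_norm// mulr_ge0//.
  by have /andP[] := bound w.
rewrite (integral_gen_zero_biased (is_derive_clip_primitive c) (lipschitz_clip_primitive c0))//.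
rewrite lee_fin invfM mulrA ler_pM2r ?invr_gt0 ?m2_gt0//.
by rewrite mulrC -meanZl//; exact: le_mean.
Qed.

(** Only Lipschitz test functions are available, so |z| is reached by monotone
    convergence.  Without integrability the mean distance of the coupling would take
    the default value 0. *)
Lemma integrable_gen_zero_biased : C.-integrable setT (EFin \o Xgz).
Proof.
apply/integrableP; split; first by apply/measurable_EFinP; exact: measurable_funPT.
apply: (@le_lt_trans _ _ (m3 / (2 * m2))%:E); last exact: ltry.
pose F n w : \bar R := (clip_abs n%:R (Xgz w))%:E.
have limF w : limn (F ^~ w) = (`|Xgz w|)%:E.
  apply: lim_near_cst => //; near=> n; rewrite /F clip_absE//.
  by near: n; exact: nbhs_infty_ger.
rewrite (eq_integral (fun w => limn (F ^~ w))); last by move=> w _; rewrite limF.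
have := @cvg_monotone_convergence _ _ _ C setT measurableT F.
move=> /(_ _ _ _)/wrap[].
- move=> n; apply/measurable_EFinP; apply: measurableT_comp; last exact: measurable_funPT.
  exact: measurable_clip_abs.
- by move=> n w _; rewrite lee_fin clip_abs_ge0.
- by move=> w _ n m nm; rewrite lee_fin clip_abs_le// ler_nat.
move=> h; apply: (cvge_to_le h); apply: nearW => n.
exact: integral_clip_gen_zero_biased.
Unshelve. all: by end_near. Qed.

Section Smear.
Variables (f g : R -> R) (K : R).
Hypothesis taylor : taylor_bound f g K (fun=> True).
Hypothesis increment : increment_bound g K (fun=> True).
Hypothesis g_itv : forall x, 0 <= g x <= 1 / 2.

Definition smear (V : T' -> R) (y : R) : R := mean C (fun w => g (y + V w)).

Let g_abs x : `|g x| <= 1 / 2.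
Proof. by have /andP[h1 h2] := g_itv x; rewrite ger0_norm. Qed.

Let mg := measurable_sol_deriv increment.
Let mf := measurable_sol taylor g_itv.

Let integrable_smear (V : {RV C >-> R}) y : C.-integrable setT (EFin \o (fun w => g (y + V w))).
Proof.
apply: (@integrable_bounded _ _ _ C _ (1 / 2)); last by move=> w; exact: g_abs.
apply: (measurableT_comp mg); apply: measurable_funD => //; exact: measurable_funPT.
Qed.

(** The defining property of the size-biased law for the test function
    g (y + .). *)
Lemma weighted_smear_size_biased y :
  weighted_smear X (EFin \o g) y = (m1 * smear Xs y)%:E.
Proof.
have mgy : measurable_fun setT (fun x : R => g (y + x)).
  by apply: (measurableT_comp mg); exact: measurable_funD.
have ig : P.-integrable setT (EFin \o (fun w => X w * g (y + X w))).
  apply: (@integrable_dominated _ _ _ P _ (fun w => 1 / 2 * X w)).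
  - apply: measurable_funM; first exact: measurable_funPT.
    by apply: (measurableT_comp mgy); exact: measurable_funPT.
  - by move=> w; rewrite normrM (ger0_norm (X0 w)) mulrC ler_wpM2r.
  - by apply: integrableZl_real; exact: integrable_base.
rewrite /weighted_smear (eq_integral (fun w => (X w * g (y + X w))%:E)); last by move=> w _; rewrite EFinM.
rewrite (integral_mean ig) /smear.
have := integral_size_biased mgy ig; rewrite (integral_mean (integrable_smear _ _)) => -[->].
by rewrite mulrC divfK// lt0r_neq0.
Qed.

(** The defining property of the generalized-zero-biased law for the Lipschitz
    test function f (y + .), whose derivative is g (y + .). *)
Lemma weighted_smear_gen_zero_biased y :
  weighted_smear X (EFin \o f) y = (m1 * f y + m2 * smear Xgz y)%:E.
Proof.
have mfy : measurable_fun setT (fun x : R => f (y + x)).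
  by apply: (measurableT_comp mf); exact: measurable_funD.
have lip := taylor_lipschitz taylor g_itv.
have i1 := integrable_base.
have j1 := integrableZl_real (f y) i1.
have ig : P.-integrable setT (EFin \o (fun w => X w * (f (y + X w) - f (y + 0)))).
  apply: (@integrable_dominated _ _ _ P _ (fun w => 1 / 2 * X w ^+ 2)).
  - apply: measurable_funM; first exact: measurable_funPT.
    by apply: measurable_funB => //; apply: (measurableT_comp mfy); exact: measurable_funPT.
  - move=> w; rewrite normrM (ger0_norm (X0 w)).
    have := lip (y + X w) (y + 0); have -> : y + X w - (y + 0) = X w by ring.
    by rewrite (ger0_norm (X0 w)) => /(ler_wpM2l (X0 w)); rewrite expr2; lra.
  - by apply: integrableZl_real; exact: (integrable_power (n := 2)).
have df (x : R) : is_derive x 1 (fun x => f (y + x)) (g (y + x)).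
  apply: (@is_derive_quadratic_remainder _ _ _ _ (K / 2)) => z.
  have := taylor (x := y + x) (y := y + z) I I.
  have -> : y + z - (y + x) = z - x by ring.
  by move=> /andP[h1 h2]; rewrite ger0_norm.
have lf : lipschitz (fun x => f (y + x)).
  apply: (@lipschitz_of_bound _ _ (1 / 2)) => x z.
  by have := lip (y + x) (y + z); have -> : y + x - (y + z) = x - z by ring.
have := integral_gen_zero_biased df lf ig.
rewrite (integral_mean (integrable_smear _ _)) -/(smear Xgz y) => -[->].
rewrite [m2 * _]mulrC divfK ?lt0r_neq0 ?m2_gt0// [m1 * _]mulrC -meanZl// -meanD//.
rewrite -integral_mean; last exact: integrableD_real.
by apply: eq_integral => w _; rewrite -EFinM addr0; congr EFin => /=; ring.
Qed.

Local Notation e := (mean C (fun w => `|Xs w - Xgz w|)).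

Let integrable_gap : C.-integrable setT (EFin \o (fun w => `|Xs w - Xgz w|)).
Proof.
have := integrable_norm (integrableB_real integrable_size_biased integrable_gen_zero_biased).
by [].
Qed.

Lemma smear_gap y : `|smear Xgz y - smear Xs y| <= K * e.
Proof.
have iz := integrable_smear Xgz y; have is_ := integrable_smear Xs y.
have j := integrableZl_real K integrable_gap.
have jN := integrableZl_real (-1) j.
rewrite /smear -meanB// -meanZl//.
have ptw w : `|g (y + Xgz w) - g (y + Xs w)| <= K * `|Xs w - Xgz w|.
  have := increment_abs increment (y + Xgz w) (y + Xs w).
  have -> : y + Xgz w - (y + Xs w) = - (Xs w - Xgz w) by ring.
  by rewrite normrN.
rewrite ler_norml -mulN1r -[X in X <= _]meanZl//; apply/andP; split.
  apply: le_mean => //; first exact: integrableB_real.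
  by move=> w; have := ptw w; rewrite ler_norml mulN1r => /andP[].
apply: le_mean => //; first exact: integrableB_real.
by move=> w; have := ptw w; rewrite ler_norml => /andP[].
Qed.

Lemma smear_itv (V : {RV C >-> R}) y : 0 <= smear V y <= 1 / 2.
Proof.
apply/andP; split; first by apply: mean_ge0 => w; have /andP[] := g_itv (y + V w).
rewrite -[leRHS](mean_cst C); apply: le_mean => //.
  exact: finite_measure_integrable_cst.
by move=> w; have /andP[] := g_itv (y + V w).
Qed.

Lemma measurable_smear_mono (V : {RV C >-> R}) : measurable_fun setT (smear V).
Proof.
apply: nondecreasing_measurable => // x y xy; apply: le_mean => // w.
by apply: (increment_le increment); rewrite lerD2r.
Qed.

Hypothesis K0 : 0 <= K.

Lemma smear_upper y : smear Xs y <= g 0 + K * (`|y| + m2 / m1).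
Proof.
have iX := integrable_norm integrable_size_biased.
have ia : C.-integrable setT (EFin \o (fun w => `|Xs w|)) by [].
have mXs : mean C (fun w => `|Xs w|) = m2 / m1.
  by apply: EFin_inj; rewrite -(integral_mean ia) integral_abs_size_biased.
have ic (c : R) : C.-integrable setT (EFin \o (fun=> c)) by exact: finite_measure_integrable_cst.
have j := integrableZl_real K ia.
have -> : g 0 + K * (`|y| + m2 / m1) = mean C (fun w => (g 0 + K * `|y|) + K * `|Xs w|).
  by rewrite meanD// mean_cst meanZl// mXs; ring.
apply: le_mean => //; first exact: integrableD_real.
move=> w; have := increment_abs increment (y + Xs w) 0; rewrite subr0 => h.
have := ler_normD y (Xs w) => /(ler_wpM2l K0) h2.
by move: h; rewrite ler_norml => /andP[_ h]; lra.
Qed.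

(** The size-biased variable is nonnegative only almost surely; going back to X
    avoids this. *)
Lemma smear_lower y : 0 <= y -> g 0 <= smear Xs y.
Proof.
move=> y0; rewrite -(ler_pM2l m1_gt0) -lee_fin -weighted_smear_size_biased.
have -> : m1 * g 0 = g 0 * m1 by ring.
rewrite -meanZl; last exact: integrable_base.
rewrite -integral_mean; last by apply: integrableZl_real; exact: integrable_base.
have g00 : 0 <= g 0 by have /andP[] := g_itv 0.
apply: ge0_le_integral => //.
- by move=> w _; rewrite lee_fin mulr_ge0.
- by apply/measurable_EFinP; apply: measurable_funM => //; exact: measurable_funPT.
- apply: emeasurable_funM; first by apply/measurable_EFinP; exact: measurable_funPT.
  apply/measurable_EFinP; apply: (measurableT_comp mg).
  by apply: measurable_funD => //; exact: measurable_funPT.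
move=> w _; rewrite -EFinM lee_fin mulrC ler_wpM2l//.
by apply: (increment_le increment); rewrite addr_ge0.
Qed.

End Smear.
End BiasedVersions.

(** * The Stein equation under the compound Poisson law *)

Lemma add_fin_cancel (R : realType) (x : \bar R) (a c : R) :
  (x + a%:E = c%:E)%E -> x = (c - a)%:E.
Proof. by case: x => //= x [<-]; rewrite addrK. Qed.

Lemma measurable_pos_sqr (R : realType) (b : R) : measurable_fun setT (pos_sqr b).
Proof.
apply: continuous_measurable_fun => x.
apply/differentiable_continuous/derivable1_diffP.
by have := is_derive_pos_sqr b x => ?; exact: ex_derive.
Qed.

Lemma pos_sqr_ge0 (R : realType) (b x : R) : 0 <= pos_sqr b x.
Proof. by rewrite divr_ge0// sqr_ge0. Qed.

Section CompoundPoissonPart.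
Context {R : realType} {d d' : measure_display} {T : measurableType d}
  {T' : measurableType d'}.
Variables (P : probability T R) (C : probability T' R).
Variables (X : {RV P >-> R}) (Xs Xgz : {RV C >-> R}).
Hypothesis X0 : forall w, 0 <= X w.
Hypothesis m1_gt0 : 0 < mean P X.
Hypothesis X3 : P.-integrable setT (EFin \o (fun w => X w ^+ 3)).
Hypothesis Xs_law : size_biased P C X Xs.
Hypothesis Xgz_law : gen_zero_biased P C X Xgz.
Local Notation m1 := (mean P X).
Local Notation m2 := (mean P (fun w => X w ^+ 2)).
Local Notation e := (mean C (fun w => `|Xs w - Xgz w|)).
Variable lambda : R.
Hypothesis lambda0 : 0 < lambda.
Variable M : probability R R.
Hypothesis ME : forall f : R -> \bar R, measurable_fun setT f ->
  (forall x, 0 <= f x)%E ->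
  (\int[M]_x f x = pois_avg lambda (fun n => \int[convpow X n]_x f x))%E.

Lemma cpois_ge0_ae : {ae M, forall x : R, 0 <= x}.
Proof.
exists [set x | x < 0]; split.
- by rewrite -set_itvNyo; exact: measurable_itv.
- have mneg : measurable [set x : R | x < 0] by rewrite -set_itvNyo; exact: measurable_itv.
  transitivity (\int[M]_x (\1_[set x : R | x < 0] x)%:E)%E.
    by rewrite integral_indic// setIT.
  rewrite ME//; last by apply/measurable_EFinP; exact: measurable_indic.
  rewrite -[RHS](pois_avg_cst lambda0 (lexx 0)); apply: eq_pois_avg => n.
  by rewrite integral_indic// setIT; exact: (convpow_lt0 X0).
by move=> x /= /negP; rewrite -ltNge.
Qed.

Lemma eq_integral_cpois (f g : R -> \bar R) :
  measurable_fun setT f -> measurable_fun setT g ->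
  (forall x : R, 0 <= x -> f x = g x) -> (\int[M]_x f x = \int[M]_x g x)%E.
Proof.
move=> mf mg fg; apply: ae_eq_integral => //.
by apply: filterS cpois_ge0_ae => x x0 _; exact: fg.
Qed.

(** The two size-bias identities, of the Poisson law and of the convolution
    powers, combined. *)
Lemma integral_cpois_size_bias (f : R -> \bar R) : measurable_fun setT f ->
  (forall x, 0 <= f x)%E ->
  (\int[M]_x (`|x|%:E * f x) = lambda%:E * \int[M]_y weighted_smear X f y)%E.
Proof.
move=> mf f0; rewrite ME; first last.
- by move=> x; rewrite mule_ge0// lee_fin.
- by apply: emeasurable_funM => //; apply/measurable_EFinP.
rewrite (eq_pois_avg lambda (fun n => integral_convpow_size_bias X0 n mf f0)).
rewrite (pois_avg_size_bias lambda0 (a := fun n => \int[convpow X n.-1]_y weighted_smear X f y)%E); last first.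
  by move=> n; apply: integral_ge0 => y _; exact: weighted_smear_ge0.
rewrite -ME//; first exact: measurable_weighted_smear.
by move=> y; exact: weighted_smear_ge0.
Qed.

Lemma integrable_cpois : M.-integrable setT (EFin \o id).
Proof.
apply/integrableP; split; first by apply/measurable_EFinP.
rewrite ME//; last by apply/measurable_EFinP.
rewrite (eq_pois_avg lambda (fun n => integral_id_convpow X0 n)).
rewrite (integral_mean (integrable_base X0 X3)).
rewrite (pois_avg_size_bias lambda0 (a := fun=> m1%:E)) ?pois_avg_cst -?EFinM ?ltry ?(ltW m1_gt0)//.
by move=> _; rewrite lee_fin ltW.
Qed.

Lemma mean_abs_cpois : mean M (fun x => `|x|) = lambda * m1.
Proof.
have i := integrable_norm integrable_cpois.
apply: EFin_inj; rewrite -integral_mean; last exact: i.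
rewrite ME//; last by apply/measurable_EFinP.
rewrite (eq_pois_avg lambda (fun n => integral_id_convpow X0 n)).
rewrite (integral_mean (integrable_base X0 X3)).
rewrite (pois_avg_size_bias lambda0 (a := fun=> m1%:E)) ?pois_avg_cst -?EFinM ?(ltW m1_gt0)//.
by move=> _; rewrite lee_fin ltW.
Qed.

Variables (f g : R -> R) (K r s b c : R).
Hypothesis taylor : taylor_bound f g K (fun=> True).
Hypothesis increment : increment_bound g K (fun=> True).
Hypothesis g_itv : forall x, 0 <= g x <= 1 / 2.
Hypothesis f_ge0 : forall x, 0 <= f x.
Hypothesis K0 : 0 <= K.
Hypothesis s0 : 0 < s.
Hypothesis rsE : r / s = lambda * m1.
Hypothesis c0 : 0 <= c.
Hypothesis stein_eq : forall x, 0 <= x ->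
  pos_sqr b x + x / s * g x + r / s * f x = c + x * f x.

Local Notation tau_s := (mean M (smear C g Xs)).
Local Notation tau_gz := (mean M (smear C g Xgz)).

Let mg := measurable_sol_deriv increment.
Let mf := measurable_sol taylor g_itv.
Let ms := measurable_smear_mono increment g_itv Xs.
Let mgz := measurable_smear_mono increment g_itv Xgz.

Let is_ : M.-integrable setT (EFin \o smear C g Xs).
Proof.
apply: (@integrable_bounded _ _ _ M _ (1 / 2) ms) => x.
by have /andP[h1 h2] := smear_itv increment g_itv Xs x; rewrite ger0_norm.
Qed.

Let igz : M.-integrable setT (EFin \o smear C g Xgz).
Proof.
apply: (@integrable_bounded _ _ _ M _ (1 / 2) mgz) => x.
by have /andP[h1 h2] := smear_itv increment g_itv Xgz x; rewrite ger0_norm.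
Qed.

Let iabs : M.-integrable setT (EFin \o (fun x => `|x|)).
Proof. by have := integrable_norm integrable_cpois. Qed.

Let if_ : M.-integrable setT (EFin \o f).
Proof.
apply: (@integrable_dominated _ _ _ M _ (fun x => f 0 + 1 / 2 * `|x|)) => //.
  move=> x; rewrite ger0_norm//; have := taylor_lipschitz taylor g_itv x 0.
  by rewrite subr0 ler_norml => /andP[_]; lra.
apply: integrableD_real; first exact: finite_measure_integrable_cst.
exact: integrableZl_real.
Qed.

(** In the integrated Stein equation r / s = lambda E[X] cancels the part of
    lambda E[X f(y + X)] that is proportional to f(y). *)
Lemma integral_pos_sqr_cpois :
  (\int[M]_x (pos_sqr b x)%:E = (c + lambda * (m2 * tau_gz - m1 / s * tau_s))%:E)%E.
Proof.
have sV : 0 <= s^-1 by rewrite invr_ge0 ltW.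
have lm : 0 <= lambda * m1 by rewrite mulr_ge0// ltW.
have mq := measurable_pos_sqr b.
have mabs : measurable_fun setT (fun x : R => `|x|) by [].
have mxg : measurable_fun setT (fun x : R => (`|x|)%:E * (g x)%:E)%E.
  by apply: emeasurable_funM; apply/measurable_EFinP.
have mxf : measurable_fun setT (fun x : R => (`|x|)%:E * (f x)%:E)%E.
  by apply: emeasurable_funM; apply/measurable_EFinP.
have xg0 (x : R) : (0 <= (`|x|)%:E * (g x)%:E)%E.
  by have /andP[h _] := g_itv x; rewrite mule_ge0// lee_fin.
have xf0 (x : R) : (0 <= (`|x|)%:E * (f x)%:E)%E by rewrite mule_ge0// lee_fin.
have msxg : measurable_fun setT (fun x : R => (s^-1)%:E * ((`|x|)%:E * (g x)%:E))%E.
  by apply: emeasurable_funM.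
have mlf : measurable_fun setT (fun x : R => (lambda * m1)%:E * (f x)%:E)%E.
  by apply: emeasurable_funM => //; apply/measurable_EFinP.
have meq : measurable_fun setT (fun x : R => (pos_sqr b x)%:E).
  by apply/measurable_EFinP.
have sxg0 (x : R) : (0 <= (s^-1)%:E * ((`|x|)%:E * (g x)%:E))%E by rewrite mule_ge0// lee_fin.
have lf0 (x : R) : (0 <= (lambda * m1)%:E * (f x)%:E)%E by rewrite mule_ge0// lee_fin.
have q0 (x : R) : (0 <= (pos_sqr b x)%:E)%E by rewrite lee_fin pos_sqr_ge0.
have : (\int[M]_x ((pos_sqr b x)%:E + (s^-1)%:E * ((`|x|)%:E * (g x)%:E) + (lambda * m1)%:E * (f x)%:E) =
  \int[M]_x (c%:E + (`|x|)%:E * (f x)%:E))%E.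
  apply: eq_integral_cpois => [||x x0].
  - by apply: emeasurable_funD => //; exact: emeasurable_funD.
  - exact: emeasurable_funD.
  have := stein_eq x0; rewrite rsE ger0_norm// -!EFinM -!EFinD => <-.
  by congr EFin; ring.
rewrite ge0_integralD//; last 2 first.
- by move=> x _; rewrite adde_ge0.
- exact: emeasurable_funD.
rewrite ge0_integralD// ge0_integralZl_EFin//.
rewrite (integral_cpois_size_bias (f := EFin \o g)); last 2 first.
- exact/measurable_EFinP.
- by move=> x; rewrite lee_fin; have /andP[] := g_itv x.
rewrite ge0_integralZl_EFin//; last 2 first.
- by move=> x _; rewrite lee_fin.
- exact/measurable_EFinP.
rewrite [in RHS]ge0_integralD//.
rewrite integral_prob_cst (integral_cpois_size_bias (f := EFin \o f)); last 2 first.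
- exact/measurable_EFinP.
- by move=> x; rewrite lee_fin.
have j1 := integrableZl_real m1 is_; have j2 := integrableZl_real m1 if_.
have j3 := integrableZl_real m2 igz; have j23 := integrableD_real j2 j3.
have -> : (\int[M]_y weighted_smear X (EFin \o g) y = \int[M]_y (m1 * smear C g Xs y)%:E)%E.
  by apply: eq_integral => y _;
  exact: (weighted_smear_size_biased X0 m1_gt0 X3 Xs_law increment g_itv).
have -> : (\int[M]_y weighted_smear X (EFin \o f) y =
    \int[M]_y (m1 * f y + m2 * smear C g Xgz y)%:E)%E.
  by apply: eq_integral => y _;
  exact: (weighted_smear_gen_zero_biased X0 m1_gt0 X3 Xgz_law taylor increment g_itv).
rewrite (integral_mean j1) (integral_mean if_).
rewrite (integral_mean j23) meanD// !meanZl// -!EFinM -!EFinD -addeA -EFinD.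
move=> /add_fin_cancel ->; congr EFin; ring.
Qed.

Lemma cpois_gap : `|tau_gz - tau_s| <= K * e.
Proof.
have j := integrableB_real igz is_.
rewrite -meanB//.
have gap y := smear_gap X0 m1_gt0 X3 Xs_law Xgz_law increment g_itv y.
have ic (k : R) : M.-integrable setT (EFin \o (fun=> k)) by exact: finite_measure_integrable_cst.
rewrite ler_norml; apply/andP; split.
  rewrite -[leLHS](mean_cst M); apply: le_mean => // y.
  by have := gap y; rewrite ler_norml => /andP[].
rewrite -[leRHS](mean_cst M); apply: le_mean => // y.
by have := gap y; rewrite ler_norml => /andP[].
Qed.

Lemma cpois_smear_itv : g 0 <= tau_s <= g 0 + K * (lambda * m1 + m2 / m1).
Proof.
have ic (k : R) : M.-integrable setT (EFin \o (fun=> k)) by exact: finite_measure_integrable_cst.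
apply/andP; split.
  rewrite -lee_fin -(integral_mean is_) -(integral_prob_cst M (g 0)%:E).
  have g00 : 0 <= g 0 by have /andP[] := g_itv 0.
  apply: ae_ge0_le_integral => //.
  - by move=> x _; rewrite lee_fin; have /andP[] := smear_itv increment g_itv Xs x.
  - exact/measurable_EFinP.
  apply: filterS cpois_ge0_ae => x x0 _; rewrite lee_fin.
  exact: (smear_lower X0 m1_gt0 X3 Xs_law increment g_itv).
have j := integrableZl_real K iabs.
have -> : g 0 + K * (lambda * m1 + m2 / m1) = mean M (fun x => (g 0 + K * (m2 / m1)) + K * `|x|).
  by rewrite meanD// mean_cst meanZl// mean_abs_cpois; ring.
apply: le_mean => //; first exact: integrableD_real.
move=> x; have := smear_upper X0 X3 Xs_law increment g_itv K0 x; lra.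
Qed.

End CompoundPoissonPart.

(** * The Stein equation for a Poisson multiple of X *)

Section CountMultiplePart.
Context {R : realType} {d : measure_display} {T : measurableType d}.
Variables (P : probability T R) (lambda : R) (N : {RV P >-> nat}) (X : {RV P >-> R}).
Hypothesis lambda0 : 0 < lambda.
Hypothesis X0 : forall w, 0 <= X w.
Hypothesis X3 : P.-integrable setT (EFin \o (fun w => X w ^+ 3)).
Hypothesis mixE : forall F : nat -> R -> \bar R,
  (forall n, measurable_fun setT (F n)) -> (forall n x, 0 <= F n x)%E ->
  (\int[P]_w F (N w) (X w) = pois_avg lambda (fun n => \int[P]_w F n (X w)))%E.
Local Notation m1 := (mean P X).
Local Notation m2 := (mean P (fun w => X w ^+ 2)).
Local Notation m3 := (mean P (fun w => X w ^+ 3)).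

Lemma measurable_at_count (F : nat -> R -> R) : (forall n, measurable_fun setT (F n)) ->
  measurable_fun setT (fun w => F (N w) (X w)).
Proof.
move=> mF _ B mB; rewrite setTI.
rewrite (_ : _ @^-1` B = \bigcup_n (N @^-1` [set n] `&` (F n \o X) @^-1` B)); last first.
  apply/seteqP; split=> [w Bw|w [n _ [/= <-]]] //.
  by exists (N w).
apply: bigcup_measurable => n _; apply: measurableI.
  by rewrite -[X in measurable X]setTI; exact: measurable_funPT.
rewrite -[X in measurable X]setTI.
by apply: (measurableT_comp (mF n) (measurable_funPT X)).
Qed.

Lemma integral_count_power (p : nat -> R) (j : nat) (c : R) : (forall n, 0 <= p n) ->
  (j <= 3)%N -> pois_avg lambda (fun n => (p n)%:E) = c%:E ->
  (\int[P]_w (p (N w) * X w ^+ j)%:E = (c * mean P (fun w => X w ^+ j))%:E)%E.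
Proof.
move=> p0 j3 pc.
have mj0 : 0 <= mean P (fun w => X w ^+ j) by apply: mean_ge0 => w; rewrite exprn_ge0.
transitivity (\int[P]_w (p (N w) * `|X w| ^+ j)%:E)%E.
  by apply: eq_integral => w _; rewrite ger0_norm.
rewrite (mixE (F := fun n (x : R) => (p n * `|x| ^+ j)%:E)); first last.
- by move=> n x; rewrite lee_fin mulr_ge0// exprn_ge0.
- by move=> n; apply/measurable_EFinP; apply: measurable_funM => //; apply: measurable_funX.
rewrite mulrC EFinM -pc -pois_avgZl; last by move=> n; rewrite lee_fin.
apply: eq_pois_avg => n; rewrite -EFinM mulrC -meanZl; last exact: (integrable_power X0 X3).
rewrite -integral_mean; last by apply: integrableZl_real; exact: (integrable_power X0 X3).
by apply: eq_integral => w _; rewrite ger0_norm.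
Qed.

Lemma integrable_count_power (p : nat -> R) (j : nat) (c : R) : (forall n, 0 <= p n) ->
  (j <= 3)%N -> pois_avg lambda (fun n => (p n)%:E) = c%:E ->
  P.-integrable setT (EFin \o (fun w => p (N w) * X w ^+ j)).
Proof.
move=> p0 j3 pc; apply/integrableP; split.
  apply/measurable_EFinP; apply: (@measurable_at_count (fun n x => p n * x ^+ j)) => n.
  by apply: measurable_funM => //; apply: measurable_funX.
rewrite (eq_integral (fun w => (p (N w) * X w ^+ j)%:E)).
  by rewrite (integral_count_power p0 j3 pc) ltry.
by move=> w _ /=; rewrite ger0_norm// mulr_ge0// exprn_ge0.
Qed.

Lemma mean_count_power (p : nat -> R) (j : nat) (c : R) : (forall n, 0 <= p n) ->
  (j <= 3)%N -> pois_avg lambda (fun n => (p n)%:E) = c%:E ->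
  mean P (fun w => p (N w) * X w ^+ j) = c * mean P (fun w => X w ^+ j).
Proof.
move=> p0 j3 pc; apply: EFin_inj.
by rewrite -(integral_count_power p0 j3 pc) integral_mean//; exact: (integrable_count_power p0 j3 pc).
Qed.

(** The growth for which three moments of X and two moments of N suffice. *)
Definition cubic_growth (F : nat -> R -> R) : Prop :=
  exists A, forall n x, 0 <= x -> `|F n x| <= A * (n.+1%:R ^+ 2 * (1 + x ^+ 3)).

Lemma integrable_at_count (F : nat -> R -> R) : (forall n, measurable_fun setT (F n)) ->
  cubic_growth F -> P.-integrable setT (EFin \o (fun w => F (N w) (X w))).
Proof.
move=> mF [A FA]; apply: (@integrable_dominated _ _ _ P _
  (fun w => A * ((N w).+1%:R ^+ 2 * X w ^+ 0 + (N w).+1%:R ^+ 2 * X w ^+ 3))).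
- exact: measurable_at_count.
- by move=> w; apply: (le_trans (FA _ _ (X0 w))); rewrite expr0 mulrDr mulr1.
have p2 := pois_avg_succ_sqr lambda0.
have p0 n : 0 <= (n.+1%:R : R) ^+ 2 by exact: sqr_ge0.
apply: integrableZl_real; apply: integrableD_real.
  exact: (integrable_count_power p0 _ p2).
exact: (integrable_count_power p0 _ p2).
Qed.

Lemma integrable_fixed_count (F : nat -> R -> R) n : (forall n, measurable_fun setT (F n)) ->
  cubic_growth F -> P.-integrable setT (EFin \o (fun w => F n (X w))).
Proof.
move=> mF [A FA]; apply: (@integrable_dominated _ _ _ P _
  (fun w => A * n.+1%:R ^+ 2 * (1 + X w ^+ 3))).
- by apply: (measurableT_comp (mF n)); exact: measurable_funPT.
- by move=> w; apply: (le_trans (FA _ _ (X0 w))); rewrite mulrA.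
apply: integrableZl_real; apply: integrableD_real => //.
exact: finite_measure_integrable_cst.
Qed.

Lemma le_mean_at_count (F G : nat -> R -> R) :
  (forall n, measurable_fun setT (F n)) -> (forall n, measurable_fun setT (G n)) ->
  cubic_growth F -> cubic_growth G ->
  (forall n x, 0 <= F n x) -> (forall n x, 0 <= G n x) ->
  (forall n, mean P (fun w => F n (X w)) <= mean P (fun w => G n (X w))) ->
  mean P (fun w => F (N w) (X w)) <= mean P (fun w => G (N w) (X w)).
Proof.
move=> mF mG cF cG F0 G0 FG.
rewrite -lee_fin -!integral_mean; try exact: integrable_at_count.
rewrite (mixE (F := fun n x => (F n x)%:E)); last 2 first.
- by move=> n; apply/measurable_EFinP.
- by move=> n x; rewrite lee_fin.
rewrite (mixE (F := fun n x => (G n x)%:E)); last 2 first.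
- by move=> n; apply/measurable_EFinP.
- by move=> n x; rewrite lee_fin.
apply: le_pois_avg => n; first by apply: integral_ge0 => w _; rewrite lee_fin.
rewrite !integral_mean ?lee_fin//; exact: integrable_fixed_count.
Qed.

Definition quadratic_growth (u : R -> R) : Prop :=
  exists A, 0 <= A /\ forall x, 0 <= u x <= A * (1 + x ^+ 2).

Let growth_base (A a x : R) n : 0 <= A -> 0 <= x -> 0 <= a <= A * (1 + (n%:R * x) ^+ 2) ->
  `|a| <= (2 * A) * (n.+1%:R ^+ 2 * (1 + x ^+ 3)).
Proof.
move=> A0 x0 /andP[a0 aA]; rewrite ger0_norm//; apply: (le_trans aA).
rewrite [2 * A]mulrC -mulrA ler_wpM2l//.
have n0 : 0 <= n%:R :> R by [].
rewrite -natr1; set m := n%:R in n0 *.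
have x3 : 0 <= x ^+ 3 by exact: exprn_ge0.
have x2 : x ^+ 2 <= 1 + x ^+ 3.
  have [x1|/ltW x1] := leP x 1; first by apply: (le_trans (exprn_ile1 _ _ _)) => //; rewrite lerDl.
  by apply: (le_trans (ler_weXn2l x1 (isT : (2 <= 3)%N))); rewrite lerDr.
have m2 : m ^+ 2 <= (m + 1) ^+ 2 by rewrite lerXn2r ?nnegrE//; lra.
have m1' : 1 <= (m + 1) ^+ 2 by rewrite exprn_ege1//; lra.
have : m ^+ 2 * x ^+ 2 <= (m + 1) ^+ 2 * (1 + x ^+ 3) by rewrite ler_pM// sqr_ge0.
have : 1 * 1 <= (m + 1) ^+ 2 * (1 + x ^+ 3) by rewrite ler_pM//; lra.
by rewrite exprMn; lra.
Qed.

Let growth_base_weighted (A a x : R) n : 0 <= A -> 0 <= x ->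
  0 <= a <= A * (1 + (n.+1%:R * x) ^+ 2) ->
  `|x * a| <= (2 * A) * (n.+1%:R ^+ 2 * (1 + x ^+ 3)).
Proof.
move=> A0 x0 /andP[a0 aA]; rewrite ger0_norm ?mulr_ge0//.
apply: (le_trans (ler_wpM2l x0 aA)).
rewrite mulrCA [2 * A]mulrC -mulrA ler_wpM2l//.
have n0 : 1 <= n.+1%:R :> R by rewrite ler1n.
set m := n.+1%:R in n0 *.
have x3 : 0 <= x ^+ 3 by exact: exprn_ge0.
have x1 : x <= 1 + x ^+ 3.
  have [x1|/ltW x1] := leP x 1; first by apply: (le_trans x1); rewrite lerDl.
  by apply: (le_trans (ler_weXn2l x1 (isT : (1 <= 3)%N))); rewrite lerDr.
have m1' : 1 <= m ^+ 2 by rewrite exprn_ege1.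
have : 1 * x <= m ^+ 2 * (1 + x ^+ 3) by rewrite ler_pM.
have -> : x * (1 + (m * x) ^+ 2) = x + m ^+ 2 * x ^+ 3 by ring.
have := sqr_ge0 m; lra.
Qed.

Lemma quadratic_growth_multiple u : quadratic_growth u ->
  cubic_growth (fun n x => u (n%:R * x)).
Proof. by move=> [A [A0 uA]]; exists (2 * A) => n x x0; exact: growth_base. Qed.

Lemma quadratic_growth_weighted u : quadratic_growth u ->
  cubic_growth (fun n x => `|x| * u (n.+1%:R * x)).
Proof.
move=> [A [A0 uA]]; exists (2 * A) => n x x0.
by rewrite (ger0_norm x0); exact: growth_base_weighted.
Qed.

Lemma cubic_growthD F G : cubic_growth F -> cubic_growth G ->
  cubic_growth (fun n x => F n x + G n x).
Proof.
move=> [A FA] [B GB]; exists (A + B) => n x x0; rewrite mulrDl.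
by apply: (le_trans (ler_normD _ _)); rewrite lerD ?FA ?GB.
Qed.

Lemma cubic_growthZ F k : cubic_growth F -> cubic_growth (fun n x => k * F n x).
Proof.
move=> [A FA]; exists (`|k| * A) => n x x0; rewrite normrM -mulrA.
by rewrite ler_wpM2l// FA.
Qed.

Definition count_mean (u : R -> R) : R := mean P (fun w => u ((N w)%:R * X w)).
Definition count_weighted_mean (u : R -> R) : R :=
  mean P (fun w => X w * u ((N w).+1%:R * X w)).
Local Notation A_ := count_mean.
Local Notation B_ := count_weighted_mean.

Let mmul (u : R -> R) (k : nat -> R) : measurable_fun setT u ->
  forall n, measurable_fun setT (fun x : R => u (k n * x)).
Proof. by move=> mu n; apply: (measurableT_comp mu); exact: measurable_funM. Qed.

Let mwt (u : R -> R) (k : nat -> R) : measurable_fun setT u ->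
  forall n, measurable_fun setT (fun x : R => `|x| * u (k n * x)).
Proof. by move=> mu n; apply: measurable_funM => //; exact: (mmul k mu n). Qed.

Lemma integrable_count u : measurable_fun setT u -> quadratic_growth u ->
  P.-integrable setT (EFin \o (fun w => u ((N w)%:R * X w))).
Proof.
move=> mu gu; apply: (integrable_at_count (F := fun n x => u (n%:R * x))).
  exact: (mmul (fun n => n%:R) mu).
exact: quadratic_growth_multiple.
Qed.

Lemma integrable_count_weighted u : measurable_fun setT u -> quadratic_growth u ->
  P.-integrable setT (EFin \o (fun w => X w * u ((N w).+1%:R * X w))).
Proof.
move=> mu gu.
rewrite (_ : (fun w => X w * u _) = (fun w => `|X w| * u ((N w).+1%:R * X w))).
  apply: (integrable_at_count (F := fun n x => `|x| * u (n.+1%:R * x))).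
    exact: (mwt (fun n => n.+1%:R) mu).
  exact: quadratic_growth_weighted.
by apply/funext => w; rewrite ger0_norm.
Qed.

(** For G = u - v nondecreasing, X G((n + 1) X) - m1 G(n X) is at least
    (X - m1) G(n m1), because X G((n + 1) X) >= X G(n X) and
    (X - m1) (G(n X) - G(n m1)) >= 0; and X - m1 has mean 0.  The two parts of G are kept apart so that only nonnegative functions are
    averaged over N. *)
Lemma association (u v : R -> R) :
  measurable_fun setT u -> measurable_fun setT v ->
  quadratic_growth u -> quadratic_growth v ->
  (forall x y, 0 <= x -> x <= y -> u x - v x <= u y - v y) ->
  m1 * A_ u + B_ v <= B_ u + m1 * A_ v.
Proof.
move=> mu mv gu gv mono.
have iX := integrable_base X0 X3.
have m10 : 0 <= m1 by exact: mean_ge0.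
have absX h : B_ h = mean P (fun w => `|X w| * h ((N w).+1%:R * X w)).
  by congr (mean P _); apply/funext => w; rewrite ger0_norm.
have u0 x : 0 <= u x by have [A [_ uA]] := gu; have /andP[] := uA x.
have v0 x : 0 <= v x by have [A [_ vA]] := gv; have /andP[] := vA x.
have iu := integrableZl_real m1 (integrable_count mu gu).
have iv := integrableZl_real m1 (integrable_count mv gv).
have ju := integrable_count_weighted mu gu.
have jv := integrable_count_weighted mv gv.
pose F n (x : R) := m1 * u (n%:R * x) + `|x| * v (n.+1%:R * x).
pose G n (x : R) := `|x| * u (n.+1%:R * x) + m1 * v (n%:R * x).
have mF n : measurable_fun setT (F n).
  apply: measurable_funD; first by apply: measurable_funM => //; exact: (mmul (fun n => n%:R) mu n).
  exact: (mwt (fun n => n.+1%:R) mv n).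
have mG n : measurable_fun setT (G n).
  apply: measurable_funD; last by apply: measurable_funM => //; exact: (mmul (fun n => n%:R) mv n).
  exact: (mwt (fun n => n.+1%:R) mu n).
have cF : cubic_growth F.
  apply: cubic_growthD; last exact: quadratic_growth_weighted.
  by apply: cubic_growthZ; exact: quadratic_growth_multiple.
have cG : cubic_growth G.
  apply: cubic_growthD; first exact: quadratic_growth_weighted.
  by apply: cubic_growthZ; exact: quadratic_growth_multiple.
have -> : m1 * A_ u + B_ v = mean P (fun w => F (N w) (X w)).
  rewrite -meanZl; last exact: integrable_count.
  by rewrite -meanD//; congr (mean P _); apply/funext => w; rewrite /F ger0_norm.
have -> : B_ u + m1 * A_ v = mean P (fun w => G (N w) (X w)).
  rewrite -meanZl; last exact: integrable_count.
  by rewrite -meanD//; congr (mean P _); apply/funext => w; rewrite /G ger0_norm.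
apply: le_mean_at_count => // [n x|n x|n].
- by rewrite addr_ge0// mulr_ge0.
- by rewrite addr_ge0// mulr_ge0.
(* freeze the factor at the deterministic point n m1, where X - m1 averages to 0 *)
pose k := u (n%:R * m1) - v (n%:R * m1).
have iF := integrable_fixed_count n mF cF.
have iG := integrable_fixed_count n mG cG.
have ic : P.-integrable setT (EFin \o (fun=> m1)) by exact: finite_measure_integrable_cst.
have ik := integrableZl_real k (integrableB_real iX ic).
have ek : mean P (fun w => k * (X w - m1)) = 0.
  by rewrite meanZl; [rewrite meanB// mean_cst subrr mulr0|exact: integrableB_real].
rewrite -[X in X <= _]addr0 -ek -meanD//.
apply: le_mean => // [|w]; first exact: integrableD_real.
rewrite /F /G ger0_norm//; have x0 := X0 w; move: (X w) x0 => x x0.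
have n0 : 0 <= n%:R :> R by [].
have nx : n%:R * x <= n.+1%:R * x by rewrite ler_wpM2r// ler_nat.
have s1 := ler_wpM2l x0 (mono _ _ (mulr_ge0 n0 x0) nx).
have s2 : k * (x - m1) <= (u (n%:R * x) - v (n%:R * x)) * (x - m1).
  have /orP[xm|xm] := le_total x m1.
    rewrite ler_wnM2r ?subr_le0//; apply: mono; first exact: mulr_ge0.
    by rewrite ler_wpM2l.
  rewrite ler_wpM2r ?subr_ge0//; apply: mono; first exact: mulr_ge0.
  by rewrite ler_wpM2l.
lra.
Qed.

Lemma count_size_bias (u : R -> R) : measurable_fun setT u -> (forall x, 0 <= u x) ->
  (\int[P]_w ((N w)%:R * X w * u ((N w)%:R * X w))%:E =
   lambda%:E * \int[P]_w (X w * u ((N w).+1%:R * X w))%:E)%E.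
Proof.
move=> mu u0.
pose F n (x : R) : \bar R := (`|x| * u (n%:R * x))%:E.
have F0 n x : (0 <= F n x)%E by rewrite lee_fin mulr_ge0.
have mF n : measurable_fun setT (F n).
  by apply/measurable_EFinP; exact: (mwt (fun n => n%:R) mu n).
transitivity (\int[P]_w ((fun n x => n%:R%:E * F n x) (N w) (X w)))%E.
  by apply: eq_integral => w _; rewrite /F -EFinM ger0_norm// mulrA.
rewrite (mixE (F := fun n x => n%:R%:E * F n x)%E); last 2 first.
- by move=> n; exact: emeasurable_funM.
- by move=> n x; rewrite mule_ge0// lee_fin.
have E n : (\int[P]_w (n%:R%:E * F n (X w)) = n%:R%:E * \int[P]_w F n (X w))%E.
  by rewrite ge0_integralZl_EFin//; apply: (measurableT_comp (mF n)); exact: measurable_funPT.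
rewrite (eq_pois_avg lambda E) (pois_avg_size_bias lambda0 (a := fun n => \int[P]_w F n (X w))%E); last first.
  by move=> n; apply: integral_ge0.
congr (_ * _)%E; rewrite -(mixE (F := fun n => F n.+1))//.
by apply: eq_integral => w _; rewrite /F ger0_norm.
Qed.

Lemma mean_count_size_bias (u : R -> R) : measurable_fun setT u -> quadratic_growth u ->
  P.-integrable setT (EFin \o (fun w => (N w)%:R * X w * u ((N w)%:R * X w))) /\
  mean P (fun w => (N w)%:R * X w * u ((N w)%:R * X w)) = lambda * B_ u.
Proof.
move=> mu gu; have [A [_ uA]] := gu.
have u0 x : 0 <= u x by have /andP[] := uA x.
have E := count_size_bias mu u0.
have E' : (\int[P]_w ((N w)%:R * X w * u ((N w)%:R * X w))%:E = (lambda * B_ u)%:E)%E.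
  by rewrite E (integral_mean (integrable_count_weighted mu gu)).
have i : P.-integrable setT (EFin \o (fun w => (N w)%:R * X w * u ((N w)%:R * X w))).
  apply/integrableP; split.
    apply/measurable_EFinP.
    apply: (@measurable_at_count (fun n x => n%:R * x * u (n%:R * x))) => n.
    apply: measurable_funM; first exact: measurable_funM.
    exact: (mmul (fun n => n%:R) mu n).
  rewrite (eq_integral (fun w => ((N w)%:R * X w * u ((N w)%:R * X w))%:E)) ?E' ?ltry//.
  by move=> w _ /=; rewrite ger0_norm// mulr_ge0// mulr_ge0.
by split => //; apply: EFin_inj; rewrite -integral_mean.
Qed.

Let p1 := pois_avg_succ lambda0.
Let p2 := pois_avg_succ_sqr lambda0.

Lemma quadratic_moments (k l : R) : 0 <= k -> 0 <= l ->
  [/\ quadratic_growth (fun x => k * `|x| + l * x ^+ 2),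
    A_ (fun x => k * `|x| + l * x ^+ 2) = k * (lambda * m1) + l * ((lambda ^+ 2 + lambda) * m2) &
    B_ (fun x => k * `|x| + l * x ^+ 2) =
      k * ((lambda + 1) * m2) + l * ((lambda ^+ 2 + 3 * lambda + 1) * m3)].
Proof.
move=> k0 l0; split.
- exists (k + l); split=> [|x]; first exact: addr_ge0.
  have x2 := sqr_ge0 x; have x0 := normr_ge0 x.
  have x1 : `|x| <= 1 + x ^+ 2.
    by rewrite -[x ^+ 2]ger0_norm// normrX; have := sqr_ge0 (`|x| - 1); nra.
  apply/andP; split; first by rewrite addr_ge0// mulr_ge0.
  have := ler_wpM2l k0 x1; have := mulr_ge0 l0 x2; lra.
- have h1 n : 0 <= (n%:R : R) by [].
  have h2 n : 0 <= (n%:R : R) ^+ 2 by exact: sqr_ge0.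
  have i1 := integrable_count_power h1 (isT : (1 <= 3)%N) (pois_avg_nat lambda0).
  have i2 := integrable_count_power h2 (isT : (2 <= 3)%N) (pois_avg_sqr lambda0).
  have j1 := integrableZl_real k i1; have j2 := integrableZl_real l i2.
  have e1 := mean_count_power h1 (isT : (1 <= 3)%N) (pois_avg_nat lambda0).
  have e2 := mean_count_power h2 (isT : (2 <= 3)%N) (pois_avg_sqr lambda0).
  transitivity (k * mean P (fun w => (N w)%:R * X w ^+ 1) +
    l * mean P (fun w => (N w)%:R ^+ 2 * X w ^+ 2)); last by rewrite e1 e2.
  rewrite -!meanZl// -meanD//.
  congr (mean P _); apply/funext => w; rewrite ger0_norm ?mulr_ge0//; ring.
have h1 n : 0 <= (n.+1%:R : R) by [].
have h2 n : 0 <= (n.+1%:R : R) ^+ 2 by exact: sqr_ge0.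
have i1 := integrable_count_power h1 (isT : (2 <= 3)%N) p1.
have i2 := integrable_count_power h2 (isT : (3 <= 3)%N) p2.
have j1 := integrableZl_real k i1; have j2 := integrableZl_real l i2.
rewrite -(mean_count_power h1 (isT : (2 <= 3)%N) p1) -(mean_count_power h2 (isT : (3 <= 3)%N) p2).
rewrite -!meanZl// -meanD//.
congr (mean P _); apply/funext => w; rewrite ger0_norm ?mulr_ge0//; ring.
Qed.

Lemma measurable_quadratic (k l : R) : measurable_fun setT (fun x : R => k * `|x| + l * x ^+ 2).
Proof. by apply: measurable_funD; apply: measurable_funM => //; exact: measurable_funX. Qed.

(** The association inequality for the square; it says that beta is
    nonnegative. *)
Lemma third_moment_ge : m1 * ((lambda ^+ 2 + lambda) * m2) <= (lambda ^+ 2 + 3 * lambda + 1) * m3.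
Proof.
have [g1 a1 b1] := quadratic_moments (lexx 0) ler01.
have [g0 a0 b0] := quadratic_moments (lexx 0) (lexx 0).
have := association (measurable_quadratic 0 1) (measurable_quadratic 0 0) g1 g0.
rewrite a1 b1 a0 b0 !mul0r !add0r !mul1r mulr0 !addr0; apply=> x y x0 xy.
by rewrite !mul0r !add0r !mul1r !subr0 lerXn2r ?nnegrE// (le_trans x0).
Qed.

Variables (f g : R -> R) (K r s b c : R).
Hypothesis taylor : taylor_bound f g K (fun=> True).
Hypothesis increment : increment_bound g K (fun=> True).
Hypothesis g_itv : forall x, 0 <= g x <= 1 / 2.
Hypothesis f_ge0 : forall x, 0 <= f x.
Hypothesis K0 : 0 <= K.
Hypothesis s0 : 0 < s.
Hypothesis rsE : r / s = lambda * m1.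
Hypothesis stein_eq : forall x, 0 <= x ->
  pos_sqr b x + x / s * g x + r / s * f x = c + x * f x.

Let mg := measurable_sol_deriv increment.
Let mf := measurable_sol taylor g_itv.

Let gf : quadratic_growth f.
Proof.
exists (f 0 + 1); split=> [|x]; first by have := f_ge0 0; lra.
rewrite f_ge0/=; have := taylor_lipschitz taylor g_itv x 0.
rewrite subr0 ler_norml => /andP[_ h].
have x1 : `|x| <= 1 + x ^+ 2.
  have x2 := sqr_ge0 x; rewrite -[x ^+ 2]ger0_norm// normrX; have := sqr_ge0 (`|x| - 1); nra.
have := mulr_ge0 (f_ge0 0) (sqr_ge0 x); have := sqr_ge0 x; lra.
Qed.

Let gg : quadratic_growth g.
Proof.
exists 1; split=> // x; have /andP[g0 g1] := g_itv x; rewrite g0/=.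
by have := sqr_ge0 x; lra.
Qed.

Lemma integral_pos_sqr_count :
  (\int[P]_w (pos_sqr b ((N w)%:R * X w))%:E =
   (c + lambda * (B_ f - m1 * A_ f - s^-1 * B_ g))%:E)%E.
Proof.
have [if1 ef1] := mean_count_size_bias mf gf.
have [ig1 eg1] := mean_count_size_bias mg gg.
have i0 := integrable_count mf gf.
have j1 := integrableZl_real (lambda * m1) i0.
have j2 := integrableZl_real s^-1 ig1.
have ic : P.-integrable setT (EFin \o (fun=> c)) by exact: finite_measure_integrable_cst.
have j3 := integrableD_real ic if1.
have j4 := integrableB_real j3 j2.
have j5 := integrableB_real j4 j1.
rewrite (eq_integral (fun w => (c + (N w)%:R * X w * f ((N w)%:R * X w)
  - s^-1 * ((N w)%:R * X w * g ((N w)%:R * X w)) - lambda * m1 * f ((N w)%:R * X w))%:E)).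
  rewrite (integral_mean j5) meanB// meanB// meanD// mean_cst !meanZl// ef1 eg1 -/(A_ f).
  by congr EFin; ring.
move=> w _; congr EFin; have W0 : 0 <= (N w)%:R * X w by rewrite mulr_ge0.
by have := stein_eq W0; rewrite rsE; lra.
Qed.

Lemma count_weighted_deriv_itv :
  m1 * g 0 <= B_ g <= m1 * g 0 + K * ((lambda + 1) * m2).
Proof.
have iX := integrable_base X0 X3.
have h1 n : 0 <= (n.+1%:R : R) by [].
have i1 := integrable_count_power h1 (isT : (2 <= 3)%N) p1.
have ig := integrable_count_weighted mg gg.
have k1 := integrableZl_real (g 0) iX; have k2 := integrableZl_real K i1.
have W0 w : 0 <= (N w).+1%:R * X w by rewrite mulr_ge0.
have inc w : 0 <= g ((N w).+1%:R * X w) - g 0 <= K * ((N w).+1%:R * X w).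
  by have := increment (x := 0) (y := (N w).+1%:R * X w) I I (W0 w); rewrite subr0.
rewrite -(mean_count_power h1 (isT : (2 <= 3)%N) p1) [m1 * _]mulrC -!meanZl// -meanD//.
apply/andP; split; apply: le_mean => //.
- move=> w; have /andP[h _] := inc w; rewrite mulrC ler_wpM2l//; lra.
- exact: integrableD_real.
move=> w; have /andP[_ h] := inc w; have := ler_wpM2l (X0 w) h.
by rewrite mulrBr expr2; lra.
Qed.

(** The association inequality for f(x) - g(0) x, nondecreasing since g is. *)
Lemma count_association_lower :
  g 0 * ((lambda + 1) * m2 - lambda * m1 ^+ 2) <= B_ f - m1 * A_ f.
Proof.
have g00 : 0 <= g 0 by have /andP[] := g_itv 0.
have [gq aq bq] := quadratic_moments g00 (lexx 0).
have := association mf (measurable_quadratic (g 0) 0) gf gq.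
rewrite aq bq => /(_ _)/wrap[|h]; last by lra.
move=> x y x0 xy; rewrite !mul0r !addr0 !ger0_norm ?(le_trans x0)//.
have /andP[h _] := taylor (x := x) (y := y) I I.
have gx := increment_le increment x0.
have := ler_wpM2r (x := y - x) _ gx; rewrite subr_ge0 => /(_ xy); lra.
Qed.

(** The association inequality for g(0) x + K x^2 / 2 - f(x), nondecreasing
    since g is K-Lipschitz. *)
Lemma count_association_upper :
  B_ f - m1 * A_ f <= g 0 * ((lambda + 1) * m2 - lambda * m1 ^+ 2)
    + K / 2 * ((lambda ^+ 2 + 3 * lambda + 1) * m3 - lambda * (lambda + 1) * m1 * m2).
Proof.
have g00 : 0 <= g 0 by have /andP[] := g_itv 0.
have K2 : 0 <= K / 2 by rewrite divr_ge0.
have [gq aq bq] := quadratic_moments g00 K2.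
have := association (measurable_quadratic (g 0) (K / 2)) mf gq gf.
rewrite aq bq => /(_ _)/wrap[|h]; last by lra.
move=> x y x0 xy; rewrite !ger0_norm ?(le_trans x0)//.
have /andP[_ h] := taylor (x := x) (y := y) I I.
have /andP[_ gx] := increment I I x0; rewrite subr0 in gx.
have := ler_wpM2r (x := y - x) _ gx; rewrite subr_ge0 => /(_ xy).
move: h; rewrite !expr2; lra.
Qed.

End CountMultiplePart.

(** * From squared excesses to stop-loss functions *)

Section Smoothing.
Context {R : realType}.

(** What the smoothing argument uses of the expectations [Iq b] of the squared
    excess and [Ih a] of the stop-loss function: these inequalities are stable under
    mixtures, so Y can be treated through its two components. *)
Definition smoothing_pair (Iq Ih : R -> R) : Prop :=
  (forall b e, 0 < b -> 0 < e ->
     Iq b - Iq (b + e) <= e * Ih b <= Iq b - Iq (b + e) + e ^+ 2) /\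
  (forall a b, a <= 0 -> 0 < b -> Ih b - a <= Ih a <= Ih b + b - a).

Lemma smoothing_pair_mix (rho : R) Iq Ih Jq Jh : 0 <= rho <= 1 ->
  smoothing_pair Iq Ih -> smoothing_pair Jq Jh ->
  smoothing_pair (fun b => rho * Iq b + (1 - rho) * Jq b)
    (fun a => rho * Ih a + (1 - rho) * Jh a).
Proof.
move=> /andP[r0 r1] [I1 I2] [J1 J2]; have r1' : 0 <= 1 - rho by rewrite subr_ge0.
split=> [b e b0 e0|a b a0 b0].
  have /andP[h1 h2] := I1 b e b0 e0; have /andP[h3 h4] := J1 b e b0 e0.
  have := ler_wpM2l r0 h1; have := ler_wpM2l r0 h2.
  have := ler_wpM2l r1' h3; have := ler_wpM2l r1' h4 => k1 k2 k3 k4.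
  by apply/andP; split; lra.
have /andP[h1 h2] := I2 a b a0 b0; have /andP[h3 h4] := J2 a b a0 b0.
have := ler_wpM2l r0 h1; have := ler_wpM2l r0 h2.
have := ler_wpM2l r1' h3; have := ler_wpM2l r1' h4 => k1 k2 k3 k4.
by apply/andP; split; lra.
Qed.

(** For a > 0 the first property compares e [Ih a] with a difference of two
    squared excesses.  For a <= 0 a nonnegative variable has excess x - a, which the
    excess over a small b > 0 approximates. *)
Lemma smoothing_distance Iq Ih Jq Jh (D e a : R) :
  smoothing_pair Iq Ih -> smoothing_pair Jq Jh -> 0 < e ->
  (forall b, 0 < b -> `|Iq b - Jq b| <= D) -> `|Ih a - Jh a| <= e + 2 * D / e.
Proof.
move=> [I1 I2] [J1 J2] e0 IJ.
have pos b : 0 < b -> `|Ih b - Jh b| <= e + 2 * D / e.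
  move=> b0; have /andP[h1 h2] := I1 b e b0 e0; have /andP[h3 h4] := J1 b e b0 e0.
  have be : 0 < b + e by rewrite addr_gt0.
  have := IJ b b0; have := IJ _ be; rewrite !ler_norml => /andP[k1 k2] /andP[k3 k4].
  have E : e * (e + 2 * D / e) = e ^+ 2 + 2 * D by field; exact: lt0r_neq0.
  apply/andP; split; rewrite -(ler_pM2l e0) ?mulrN E mulrBr; lra.
have [a0|a0] := ltP 0 a; first exact: pos.
apply/ler_addgt0Pr => b b0.
have := pos b b0; have /andP[h1 h2] := I2 a b a0 b0; have /andP[h3 h4] := J2 a b a0 b0.
by rewrite !ler_norml => /andP[k1 k2]; apply/andP; split; lra.
Qed.

Lemma pos_sqr_smoothing (b e x : R) : 0 < e ->
  pos_sqr b x - pos_sqr (b + e) x <= e * Num.max 0 (x - b)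
    <= pos_sqr b x - pos_sqr (b + e) x + e ^+ 2.
Proof.
move=> e0; rewrite /pos_sqr; have -> : x - (b + e) = x - b - e by ring.
move: (x - b) => u; have [[h1 ->]|[h1 ->]] := maxr0P u; have [[h2 ->]|[h2 ->]] := maxr0P (u - e);
  rewrite ?expr0n/=; apply/andP; split; nra.
Qed.

Lemma excess_shift (a b x : R) : a <= 0 -> 0 < b -> 0 <= x ->
  Num.max 0 (x - b) - a <= Num.max 0 (x - a) <= Num.max 0 (x - b) + b - a.
Proof.
move=> a0 b0 x0; have -> : Num.max 0 (x - a) = x - a by apply/max_idPr; lra.
by have [[h1 ->]|[h1 ->]] := maxr0P (x - b); apply/andP; split; lra.
Qed.

Context {d : measure_display} {T : measurableType d}.
Variables (P : probability T R) (U : T -> R).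
Hypothesis mU : measurable_fun setT U.
Hypothesis U0 : {ae P, forall w, 0 <= U w}.
Hypothesis iU : P.-integrable setT (EFin \o U).
Hypothesis iq : forall b, 0 < b -> P.-integrable setT (EFin \o (fun w => pos_sqr b (U w))).

Lemma measurable_excess (V : T -> R) a : measurable_fun setT V ->
  measurable_fun setT (fun w => Num.max 0 (V w - a)).
Proof. by move=> mV; apply: measurable_maxr => //; exact: measurable_funB. Qed.

Lemma integrable_excess (V : T -> R) a : measurable_fun setT V ->
  P.-integrable setT (EFin \o V) ->
  P.-integrable setT (EFin \o (fun w => Num.max 0 (V w - a))).
Proof.
move=> mV iV; apply: (@integrable_dominated _ _ _ P _ (fun w => `|V w| + `|a|)).
- exact: measurable_excess.
- move=> w; apply: le_trans (ler_normB _ _).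
  by have [[h ->]|[h ->]] := maxr0P (V w - a); rewrite ?normr0.
apply: integrableD_real; first by have := integrable_norm iV.
exact: finite_measure_integrable_cst.
Qed.

Lemma mean_smoothing_pair :
  smoothing_pair (fun b => mean P (fun w => pos_sqr b (U w)))
    (fun a => mean P (fun w => Num.max 0 (U w - a))).
Proof.
have ic (k : R) : P.-integrable setT (EFin \o (fun=> k)) by exact: finite_measure_integrable_cst.
split=> [b e b0 e0|a b a0 b0].
  have be : 0 < b + e by rewrite addr_gt0.
  have ih := integrable_excess b mU iU.
  have iqq := integrableB_real (iq b0) (iq be).
  have iz := integrableZl_real e ih.
  rewrite -meanB; [|exact: iq|exact: iq]; rewrite -meanZl// -[e ^+ 2](mean_cst P) -meanD//.
  apply/andP; split; apply: le_mean => //.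
  - by move=> w; have /andP[] := pos_sqr_smoothing b (U w) e0.
  - exact: integrableD_real.
  by move=> w; have /andP[] := pos_sqr_smoothing b (U w) e0.
have mabs : measurable_fun setT (fun w => `|U w|) by exact: measurableT_comp.
have iabs : P.-integrable setT (EFin \o (fun w => `|U w|)) by have := integrable_norm iU.
have absE k : mean P (fun w => Num.max 0 (U w - k)) = mean P (fun w => Num.max 0 (`|U w| - k)).
  apply: EFin_inj; rewrite -!integral_mean; [|exact: integrable_excess|exact: integrable_excess].
  apply: ae_eq_integral => //.
  - by apply/measurable_EFinP; exact: measurable_excess.
  - by apply/measurable_EFinP; exact: measurable_excess.
  by apply: filterS U0 => w w0 _; rewrite ger0_norm.
rewrite !absE; have ia := integrable_excess a mabs iabs; have ib := integrable_excess b mabs iabs.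
have e1 : mean P (fun w => Num.max 0 (`|U w| - b)) - a = mean P (fun w => Num.max 0 (`|U w| - b) - a).
  by rewrite meanB// mean_cst.
have e2 : mean P (fun w => Num.max 0 (`|U w| - b)) + b - a =
    mean P (fun w => Num.max 0 (`|U w| - b) + (b - a)).
  by rewrite meanD// mean_cst addrA.
rewrite e1 e2; apply/andP; split; apply: le_mean => //.
- exact: integrableB_real.
- by move=> w; have /andP[] := excess_shift a0 b0 (normr_ge0 (U w)).
- exact: integrableD_real.
by move=> w; have /andP[_] := excess_shift a0 b0 (normr_ge0 (U w)); rewrite addrA.
Qed.

End Smoothing.

(** With x3 = a3 / m1, the expression is
    rho dA - rho V x3 + V (1 - sigma) (tgz - ts) - V (sigma - rho) ts, because
    (1 - rho) m2 = (1 - sigma) V.  Since rho (m2 + lambda v) = sigma V, the multiples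
    of g0 cancel, and what is left is proportional to K. *)
Lemma mixture_stein_bound (R : realType) (lambda rho m1 m2 m3 v V K g0 e dA a3 tgz ts sigma beta : R) :
  0 < lambda -> 0 <= rho <= 1 -> 0 < m1 -> 0 < m2 -> 0 <= v -> v = m2 - m1 ^+ 2 ->
  V = m2 + lambda * rho * v -> 0 <= K -> 0 <= e ->
  sigma = rho * (m2 + lambda * v) / V ->
  beta = ((lambda ^+ 2 + 3 * lambda + 1) * m3 - lambda * (lambda + 1) * m1 * m2)
    / (2 * (m2 + lambda * v)) ->
  m1 * ((lambda ^+ 2 + lambda) * m2) <= (lambda ^+ 2 + 3 * lambda + 1) * m3 ->
  m1 * g0 <= a3 <= m1 * g0 + K * ((lambda + 1) * m2) ->
  g0 * ((lambda + 1) * m2 - lambda * m1 ^+ 2) <= dA ->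
  dA <= g0 * ((lambda + 1) * m2 - lambda * m1 ^+ 2) +
    K / 2 * ((lambda ^+ 2 + 3 * lambda + 1) * m3 - lambda * (lambda + 1) * m1 * m2) ->
  `|tgz - ts| <= K * e -> g0 <= ts <= g0 + K * (lambda * m1 + m2 / m1) ->
  let B := lambda * rho * m2 / m1 + sigma * (m2 / m1 + beta) +
    (sigma - rho) * lambda * m1 + (1 - sigma) * e in
  0 <= B /\
  `|rho * (dA - V / m1 * a3) + (1 - rho) * (m2 * tgz - V * ts)| <= V * K * B.
Proof.
move=> l0 /andP[r0 r1] m10 m20 v0 vE VE K0 e0 sE bE m3h /andP[a3l a3u] dl du gap /andP[tl tu] B.
have lv : 0 < m2 + lambda * v by rewrite ltr_wpDr// mulr_ge0// ltW.
have V0 : 0 < V by rewrite VE ltr_wpDr// !mulr_ge0// ltW.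
have b0 : 0 <= beta.
  rewrite bE divr_ge0 ?mulr_ge0 ?(ltW lv)//; lra.
have sV : sigma * V = rho * (m2 + lambda * v) by rewrite sE divfK// lt0r_neq0.
have sV1 : (1 - sigma) * V = (1 - rho) * m2 by rewrite mulrBl mul1r sV VE; ring.
have r1' : 0 <= 1 - rho by rewrite subr_ge0.
have s1 : 0 <= 1 - sigma.
  by rewrite -(pmulr_lge0 _ V0) sV1 mulr_ge0// ltW.
have sr : 0 <= sigma - rho.
  rewrite -(pmulr_lge0 _ V0) mulrBl sV VE.
  have -> : rho * (m2 + lambda * v) - rho * (m2 + lambda * rho * v) =
    rho * ((1 - rho) * (lambda * v)) by ring.
  by rewrite !mulr_ge0// ltW.
have s0 : 0 <= sigma by lra.
have bK : K / 2 * ((lambda ^+ 2 + 3 * lambda + 1) * m3 - lambda * (lambda + 1) * m1 * m2) =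
    (m2 + lambda * v) * (K * beta).
  by rewrite bE; field; exact: lt0r_neq0.
have gE : (lambda + 1) * m2 - lambda * m1 ^+ 2 = m2 + lambda * v by rewrite vE; ring.
rewrite bK gE in du; rewrite gE in dl.
set p := m2 / m1 in tu B *.
have p0 : 0 < p by rewrite divr_gt0.
have pm : m2 = p * m1 by rewrite /p divfK// lt0r_neq0.
set x3 := a3 / m1.
have Vx : V / m1 * a3 = V * x3 by rewrite /x3; ring.
have x3l : g0 <= x3 by rewrite /x3 ler_pdivlMr// mulrC.
have x3u : x3 <= g0 + K * ((lambda + 1) * p).
  rewrite /x3 ler_pdivrMr//; apply: (le_trans a3u); rewrite pm; lra.
have BE : B = lambda * rho * p + sigma * (p + beta) + (sigma - rho) * lambda * m1 + (1 - sigma) * e.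
  by rewrite /B /p; ring.
have u1 : 0 <= lambda * rho * p by exact: mulr_ge0 (mulr_ge0 (ltW l0) r0) (ltW p0).
have u2 : 0 <= sigma * (p + beta) by exact: mulr_ge0 s0 (addr_ge0 (ltW p0) b0).
have u3 : 0 <= (sigma - rho) * lambda * m1 by exact: mulr_ge0 (mulr_ge0 sr (ltW l0)) (ltW m10).
have u4 : 0 <= (1 - sigma) * e by rewrite mulr_ge0.
split; first by rewrite BE !addr_ge0.
have E : rho * (dA - V / m1 * a3) + (1 - rho) * (m2 * tgz - V * ts) =
  rho * dA - rho * V * x3 + V * ((1 - sigma) * (tgz - ts)) - V * ((sigma - rho) * ts).
  rewrite Vx; have -> : (1 - rho) * (m2 * tgz - V * ts) = ((1 - rho) * m2) * tgz - (1 - rho) * V * ts by ring.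
  by rewrite -sV1; ring.
have d1 : rho * dA <= V * (sigma * (g0 + K * beta)).
  have -> : V * (sigma * (g0 + K * beta)) = rho * (g0 * (m2 + lambda * v) + (m2 + lambda * v) * (K * beta)).
    by rewrite mulrA [V * _]mulrC sV; ring.
  by rewrite ler_wpM2l.
have d2 : V * (sigma * g0) <= rho * dA.
  have -> : V * (sigma * g0) = rho * (g0 * (m2 + lambda * v)).
    by rewrite mulrA [V * _]mulrC sV; ring.
  by rewrite ler_wpM2l.
have rV : 0 <= rho * V by rewrite mulr_ge0// ltW.
have x1 := ler_wpM2l rV x3l; have x2 := ler_wpM2l rV x3u.
have Vs1 : 0 <= V * (1 - sigma) by rewrite mulr_ge0// ltW.
have Vsr : 0 <= V * (sigma - rho) by rewrite mulr_ge0// ltW.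
have VK : 0 <= V * K by rewrite mulr_ge0// ltW.
move: gap; rewrite ler_norml => /andP[gl gu].
have y1 := ler_wpM2l Vs1 gl; have y2 := ler_wpM2l Vs1 gu.
have z1 := ler_wpM2l Vsr tl; have z2 := ler_wpM2l Vsr tu.
have t1 := mulr_ge0 VK u1.
have t2 := mulr_ge0 VK (mulr_ge0 s0 (ltW p0)).
have t3 := mulr_ge0 VK (mulr_ge0 s0 b0).
have t4 := mulr_ge0 VK u3.
rewrite E BE ler_norml; apply/andP; split; lra.
Qed.

(** * Conclusion *)

Lemma mean_eq (R : realType) (d : measure_display) (T : measurableType d)
  (P : probability T R) (f : T -> R) (c : R) :
  (\int[P]_w (f w)%:E = c%:E)%E -> mean P f = c.
Proof. by move=> h; rewrite /mean expectationE h. Qed.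

Lemma ge0_integrable_eq (R : realType) (d : measure_display) (T : measurableType d)
  (P : probability T R) (f : T -> R) (c : R) :
  measurable_fun setT f -> (forall w, 0 <= f w) ->
  (\int[P]_w (f w)%:E = c%:E)%E -> P.-integrable setT (EFin \o f).
Proof.
move=> mf f0 h; apply/integrableP; split; first exact/measurable_EFinP.
rewrite (eq_integral (fun w => (f w)%:E)) ?h ?ltry//.
by move=> w _ /=; rewrite ger0_norm.
Qed.

Lemma var_meanE (R : realType) (d : measure_display) (T : measurableType d)
  (P : probability T R) (X : {RV P >-> R}) :
  P.-integrable setT (EFin \o X) -> P.-integrable setT (EFin \o (fun w => X w ^+ 2)) ->
  var P X = mean P (fun w => X w ^+ 2) - mean P X ^+ 2.
Proof.
move=> i1 i2; set m1 := mean P X.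
have ic : P.-integrable setT (EFin \o (fun=> m1 ^+ 2)) by exact: finite_measure_integrable_cst.
have j1 := integrableZl_real (2 * m1) i1.
have j2 := integrableB_real i2 j1.
transitivity (mean P (fun w => X w ^+ 2 - 2 * m1 * X w + m1 ^+ 2)); last first.
  by rewrite meanD// meanB// meanZl// mean_cst -/m1; ring.
rewrite /var /variance covariance.unlock -/(mean P X) -/m1 -[LHS]/(mean P _).
by congr (mean P _); apply/funext => w; rewrite !mulrfctE /=; ring.
Qed.

Lemma sqrt_gamma_constant (R : realType) (r : R) : 0 < r ->
  Num.sqrt (2 / (r + 2)) <=
  (Num.sqrt (2 * pi) + expR (- 1)) / Num.sqrt (r + 2) + 2 / (r + 2).
Proof.
move=> r0; have k0 : 0 < r + 2 by lra.
rewrite sqrtrM ?ler0n// sqrtrV ?(ltW k0)//.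
have h : Num.sqrt 2 <= Num.sqrt (2 * pi) + expR (- 1) :> R.
  apply: (@le_trans _ _ (Num.sqrt (2 * pi))); last by rewrite lerDl expR_ge0.
  by rewrite ler_wsqrtr// ler_peMr//; have := pi_ge2 R; lra.
apply: (@le_trans _ _ ((Num.sqrt (2 * pi) + expR (- 1)) / Num.sqrt (r + 2))).
  by rewrite ler_wpM2r// invr_ge0 sqrtr_ge0.
by rewrite lerDl divr_ge0// ltW.
Qed.

(** The choice e = sqrt S, or e arbitrarily small when S = 0. *)
Lemma optimize_smoothing (R : realType) (x D S : R) : 0 <= D -> 2 * D <= S ->
  (forall e, 0 < e -> x <= e + 2 * D / e) -> x <= 2 * Num.sqrt S.
Proof.
move=> D0 DS xe; have S0 : 0 <= S by lra.
have [S00|S00] := ltP 0 S.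
  have t0 : 0 < Num.sqrt S by rewrite sqrtr_gt0.
  apply: (le_trans (xe _ t0)).
  suff : 2 * D / Num.sqrt S <= Num.sqrt S by lra.
  by rewrite ler_pdivrMr// -expr2 sqr_sqrtr.
have -> : S = 0 by apply/eqP; rewrite eq_le S00.
rewrite sqrtr0 mulr0; apply/ler_addgt0Pr => e e0.
have := xe e e0; have -> : D = 0 by lra.
by rewrite mulr0 mul0r; lra.
Qed.

Unset Implicit Arguments.

Theorem theorem3p3 (R : realType)
  (d : measure_display) (T : measurableType d) (P : probability T R)
  (d1 : measure_display) (T1 : measurableType d1) (Q : probability T1 R)
  (d2 : measure_display) (T2 : measurableType d2) (C : probability T2 R)
  (lambda rho : R) (N : {RV P >-> nat}) (X : nat -> {RV P >-> R})
  (Z : {RV Q >-> R}) (Xs Xgz : {RV C >-> R}) :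
  0 < lambda ->
  poisson_law P lambda N ->
  (forall i w, 0 <= X i w) ->
  exchangeable P X ->
  independent_of_seq P N X ->
  (0 < 'E_P[X 0%N])%E ->
  ('E_P[fun w => (X 0%N w ^+ 3)%R] < +oo)%E ->
  0 <= rho <= 1 ->
  equally_correlated P rho X ->
  let Y : T -> R := fun w => \sum_(i < N w) X i w in
  let m1 : R := mean P (X 0%N) in
  let m2 : R := mean P (fun w => X 0%N w ^+ 2) in
  let m3 : R := mean P (fun w => X 0%N w ^+ 3) in
  let v : R := var P (X 0%N) in
  let r : R := lambda * m1 ^+ 2 / (m2 + lambda * rho * v) in
  let s : R := m1 / (m2 + lambda * rho * v) in
  let sigma : R := rho * (m2 + lambda * v) / (m2 + lambda * rho * v) in
  let c_r : R := (Num.sqrt (2 * pi) + expR (- 1)) / Num.sqrt (r + 2)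
                 + 2 / (r + 2) in
  let beta : R :=
    ((lambda ^+ 2 + 3 * lambda + 1) * m3 - lambda * (lambda + 1) * m1 * m2)
    / (2 * (m2 + lambda * v)) in
  gamma_law Q r s Z ->
  size_biased P C (X 0%N) Xs ->
  gen_zero_biased P C (X 0%N) Xgz ->
  (stop_loss_dist P Q Y Z <=
    (2 * Num.sqrt (lambda * c_r * m1 *
      (lambda * rho * m2 / m1
       + sigma * (m2 / m1 + beta)
       + (sigma - rho) * lambda * m1
       + (1 - sigma) * mean C (fun w => `| Xs w - Xgz w |))))%:E)%E.

Proof.
move=> l0 PN X0 exch indep Epos E3 rho01 corr Y m1 m2 m3 v r s sigma c_r beta Zlaw Xslaw Xgzlaw.
have x0 w : 0 <= X 0%N w by exact: X0.
have X3 : P.-integrable setT (EFin \o (fun w => X 0%N w ^+ 3)).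
  apply/integrableP; split.
    by apply/measurable_EFinP; apply: measurable_funX; exact: measurable_funPT.
  rewrite (eq_integral (fun w => (X 0%N w ^+ 3)%:E)); first by rewrite -expectationE.
  by move=> w _ /=; rewrite ger0_norm// exprn_ge0.
have iX : P.-integrable setT (EFin \o X 0%N) by exact: (integrable_base x0 X3).
have iX2 : P.-integrable setT (EFin \o (fun w => X 0%N w ^+ 2)).
  by exact: (integrable_power x0 X3 (n := 2)).
have m10 : 0 < m1 by move: Epos; rewrite expectationE integral_mean// lte_fin.
have m20 : 0 < m2 by exact: (m2_gt0 x0 m10 X3).
have vE : v = m2 - m1 ^+ 2 by exact: var_meanE.
have v0 : 0 <= v by rewrite vE subr_ge0; exact: (sqr_mean_le x0 X3).
have /andP[r0 r1] := rho01.
pose V := m2 + lambda * rho * v.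
have V0 : 0 < V by rewrite ltr_wpDr// !mulr_ge0// ltW.
have s0 : 0 < s by rewrite divr_gt0.
have rr0 : 0 < r by rewrite divr_gt0// mulr_gt0// exprn_gt0.
have rsE : r / s = lambda * m1.
  by rewrite /r /s -/V; field; rewrite !lt0r_neq0.
have sV : s^-1 = V / m1 by rewrite /s invf_div.
have [M ME] := compound_poisson_law (X 0%N) l0.
have mixE F mF F0 := @integral_count_multiple _ _ _ P lambda N X PN indep F mF F0.
pose W w : R := (N w)%:R * X 0%N w.
pose e := mean C (fun w => `| Xs w - Xgz w |).
have e0 : 0 <= e by exact: mean_ge0.
pose B := lambda * rho * m2 / m1 + sigma * (m2 / m1 + beta)
  + (sigma - rho) * lambda * m1 + (1 - sigma) * e.
pose D := lambda * m1 / 2 * Num.sqrt (2 / (r + 2)) * B.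
pose Iq b := rho * mean P (fun w => pos_sqr b (W w)) + (1 - rho) * mean M (fun x => pos_sqr b x).
pose Jq b := mean Q (fun w => pos_sqr b (Z w)).
have mW : measurable_fun setT W.
  by apply: (@measurable_at_count _ _ _ _ N (X 0%N) (fun n x => n%:R * x)) => n; exact: measurable_funM.
have iW : P.-integrable setT (EFin \o W).
  exact: (integrable_count_power x0 X3 mixE (p := fun n => n%:R) (j := 1) (fun n => ler0n _ n) isT (pois_avg_nat l0)).
have key b : 0 < b -> [/\ P.-integrable setT (EFin \o (fun w => pos_sqr b (W w))),
    M.-integrable setT (EFin \o (fun x => pos_sqr b x)),
    Q.-integrable setT (EFin \o (fun w => pos_sqr b (Z w))),
    0 <= B & `|Iq b - Jq b| <= D].
  move=> b0.
  have [f [g [K [c [tay inc fg eqn [cE /andP[K0 KE]]]]]]] := gamma_stein_solution rr0 s0 Zlaw b0.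
  have gi x : 0 <= g x <= 1 / 2 by have [] := fg x.
  have f0 x : 0 <= f x by have [] := fg x.
  have mq := measurable_pos_sqr b.
  have mqZ : measurable_fun setT (fun w => pos_sqr b (Z w)).
    by apply: measurableT_comp => //; exact: measurable_funPT.
  have mqW : measurable_fun setT (fun w => pos_sqr b (W w)) by apply: measurableT_comp.
  have c0 : 0 <= c.
    by rewrite -lee_fin -cE; apply: integral_ge0 => w _; rewrite lee_fin; exact: pos_sqr_ge0.
  have EA := integral_pos_sqr_count l0 x0 X3 mixE tay inc gi f0 rsE eqn.
  have EB := integral_pos_sqr_cpois x0 m10 X3 Xslaw Xgzlaw l0 ME tay inc gi f0 s0 rsE c0 eqn.
  have [B0 bnd] := mixture_stein_bound l0 rho01 m10 m20 v0 vE (erefl V) K0 e0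
    (erefl sigma) (erefl beta) (third_moment_ge l0 x0 X3 mixE)
    (count_weighted_deriv_itv l0 x0 X3 mixE inc gi)
    (count_association_lower l0 x0 X3 mixE tay inc gi f0)
    (count_association_upper l0 x0 X3 mixE tay inc gi f0 K0)
    (cpois_gap x0 m10 X3 Xslaw Xgzlaw M inc gi)
    (cpois_smear_itv x0 m10 X3 Xslaw l0 ME inc gi K0).
  split => //.
  - by apply: (ge0_integrable_eq _ _ EA) => // w; exact: pos_sqr_ge0.
  - by apply: (ge0_integrable_eq _ _ EB) => // w; exact: pos_sqr_ge0.
  - by apply: (ge0_integrable_eq _ _ cE) => // w; exact: pos_sqr_ge0.
  rewrite /Iq /Jq (mean_eq EA) (mean_eq EB) (mean_eq cE).
  have Vs : V * s = m1 by rewrite /s -/V mulrC divfK// lt0r_neq0.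
  set bA := count_weighted_mean N (X 0%N) f; set aA := count_mean N (X 0%N) f.
  set a3 := count_weighted_mean N (X 0%N) g.
  set tg := mean M (smear C g Xgz); set ts := mean M (smear C g Xs).
  have m1s : m1 / s = V by rewrite -Vs mulfK// lt0r_neq0.
  rewrite m1s sV.
  have -> : rho * (c + lambda * (bA - mean P (X 0%N) * aA - V / m1 * a3)) +
      (1 - rho) * (c + lambda * (mean P (fun w => X 0%N w ^+ 2) * tg - V * ts)) - c =
    lambda * (rho * (bA - m1 * aA - V / m1 * a3) + (1 - rho) * (m2 * tg - V * ts)).
    by rewrite -/m1 -/m2; ring.
  rewrite normrM (gtr0_norm l0).
  apply: (le_trans (ler_wpM2l (ltW l0) bnd)).
  have -> : D = lambda * (V * (s / 2 * Num.sqrt (2 / (r + 2))) * B).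
    by rewrite /D -Vs; ring.
  by rewrite ler_wpM2l ?(ltW l0)// ler_wpM2r// ler_wpM2l// ltW.
have [_ _ _ B0 _] := key 1 ltr01.
have D0 : 0 <= D by rewrite /D !mulr_ge0 ?sqrtr_ge0 ?(ltW l0) ?(ltW m10).
have DS : 2 * D <= lambda * c_r * m1 * B.
  have -> : 2 * D = lambda * Num.sqrt (2 / (r + 2)) * m1 * B by rewrite /D; field.
  by rewrite ler_wpM2r// ler_wpM2r ?(ltW m10)// ler_wpM2l ?(ltW l0)//; exact: sqrt_gamma_constant.
have W_ae : {ae P, forall w, 0 <= W w} by apply: aeW => w; rewrite mulr_ge0.
have Z_ae : {ae Q, forall w, 0 <= Z w} by apply: filterS (gamma_gt0_ae Zlaw) => w /ltW.
have iZ : Q.-integrable setT (EFin \o Z) by exact: (gamma_moment s0 Zlaw 1).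
have iM := integrable_cpois x0 m10 X3 l0 ME.
have M_ae := cpois_ge0_ae x0 l0 ME.
have mZ : measurable_fun setT Z by exact: measurable_funPT.
have spI := smoothing_pair_mix rho01
  (mean_smoothing_pair mW W_ae iW (fun b b0 => let: And5 h _ _ _ _ := key b b0 in h))
  (mean_smoothing_pair (@measurable_id _ _ setT) M_ae iM (fun b b0 => let: And5 _ h _ _ _ := key b b0 in h)).
have spJ := mean_smoothing_pair mZ Z_ae iZ (fun b b0 => let: And5 _ _ h _ _ := key b b0 in h).
apply: ge_ereal_sup => _ [a _ <-].
have EZ : ('E_Q[fun w => Num.max 0%R (Z w - a)%R] = (mean Q (fun w => Num.max 0 (Z w - a)))%:E)%E.
  by rewrite expectationE integral_mean//; exact: integrable_excess.
have mex : measurable_fun setT (fun x : R => (Num.max 0 (x - a))%:E).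
  by apply/measurable_EFinP; exact: (measurable_excess (V := id)).
have ex0 (x : R) : (0 <= (Num.max 0 (x - a))%:E)%E by rewrite lee_fin le_max lexx.
have EY : ('E_P[fun w => Num.max 0%R (Y w - a)%R] =
    (rho * mean P (fun w => Num.max 0 (W w - a)) +
     (1 - rho) * mean M (fun x => Num.max 0 (x - a)))%:E)%E.
  rewrite expectationE (integral_random_sum PN indep mex ex0).
  rewrite (eq_pois_avg lambda (fun n => integral_stop_loss_partial_sum X0 exch rho01 corr iX a n)).
  have r1' : 0 <= 1 - rho by rewrite subr_ge0.
  rewrite pois_avgD; last 2 first.
  - by move=> n; rewrite mule_ge0 ?lee_fin//; apply: integral_ge0 => w _; exact: ex0.
  - by move=> n; rewrite mule_ge0 ?lee_fin//; apply: integral_ge0 => w _; exact: ex0.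
  rewrite !pois_avgZl; last 2 first.
  - by move=> n; apply: integral_ge0 => w _; exact: ex0.
  - by move=> n; apply: integral_ge0 => w _; exact: ex0.
  rewrite -(ME _ mex ex0) -(mixE (fun n x => (Num.max 0 (n%:R * x - a))%:E)); last 2 first.
  - move=> n; apply/measurable_EFinP.
    have mn : measurable_fun setT (fun x : R => n%:R * x) by exact: measurable_funM.
    exact: (measurable_excess a mn).
  - by move=> n x; exact: ex0.
  rewrite integral_mean; last exact: integrable_excess.
  rewrite integral_mean; last exact: (integrable_excess (V := id)).
  by [].
rewrite EY EZ -EFinB /= lee_fin.
apply: (optimize_smoothing D0 DS) => eps eps0.
apply: (smoothing_distance a spI spJ eps0) => b b0.
by have [] := key b b0.
Qed.
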